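(* Let $p,q\in\mathbb C$ with $p\neq0$ and consider $P:\mathcal D'(\mathrm{SU}(2))\to\mathcal D'(\mathrm{SU}(2))$, $Pu:=\partial_0u-qu-p\bar u$. Then $P$ is globally solvable, i.e. for every $f\in\mathbb E$ there exists $u\in\mathcal D'(\mathrm{SU}(2))$ with $Pu=f$. Moreover, if $f\in\mathbb E\cap C^\infty(\mathrm{SU}(2))$, then there exists $u\in C^\infty(\mathrm{SU}(2))$ such that $Pu=f$.
   Context: $\widehat{\mathrm{SU}(2)}$ consists of the classes of the standard irreducible unitary representations $\mathsf t^\ell:\mathrm{SU}(2)\to\mathbb C^{(2\ell+1)\times(2\ell+1)}$, $\ell\in\frac12\mathbb N_0$ (as in Ruzhansky–Turunen), with matrix entries $\mathsf t^\ell_{mn}$, $-\ell\le m,n\le\ell$, $\ell-m,\ell-n\in\mathbb N_0$, satisfying $\overline{\mathsf t^\ell_{mn}}=(-1)^{m-n}\mathsf t^\ell_{-m,-n}$. $\partial_0$ is the neutral left-invariant vector field with symbol $\sigma_{\partial_0}(\ell)_{mn}=im\delta_{mn}$. For $u\in\mathcal D'$, $\langle\bar u,\varphi\rangle=\overline{\langle u,\bar\varphi\rangle}$. Fourier coefficients: $\widehat f(\ell)_{mn}=\langle f,\overline{\mathsf t^\ell_{nm}}\rangle$ (i.e. $\widehat f(\ell)=\int f(x)\mathsf t^\ell(x)^*dx$ for integrable $f$). Let $\Delta(\ell)_m:=-m^2+|q|^2-|p|^2-2im\,\mathrm{Re}(q)$. The admissible space is $\mathbb E:=\{f\in\mathcal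 D'(\mathrm{SU}(2)):\ \Delta(\ell)_m=0\Rightarrow (im-\bar q)\widehat f(\ell)_{mn}+p(-1)^{m-n}\overline{\widehat f(\ell)_{-m,-n}}=0 \text{ for all } -\ell\le n\le\ell\}$. *)

(* Defs.v *)
From Stdlib Require Import Reals List Arith Bool.
From Coquelicot Require Import Coquelicot.
Open Scope R_scope.

(** * The group SU(2)
    A point (a,b) : C*C with |a|^2+|b|^2 = 1 encodes the matrix
        x = [[a, b], [-conj b, conj a]] in SU(2).
    Functions on SU(2) are represented as functions on C*C; only their
    values on SU(2) matter. *)
Definition pt : Type := (C * C)%type.
Definition inSU2 (x : pt) : Prop := Cmod (fst x) ^ 2 + Cmod (snd x) ^ 2 = 1.

Definition x11 (x : pt) : C := fst x.
Definition x12 (x : pt) : C := snd x.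
Definition x21 (x : pt) : C := Copp (Cconj (snd x)).
Definition x22 (x : pt) : C := Cconj (fst x).

Definition mulSU2 (x y : pt) : pt :=
  (Cminus (Cmult (fst x) (fst y)) (Cmult (snd x) (Cconj (snd y))),
   Cplus (Cmult (fst x) (snd y)) (Cmult (snd x) (Cconj (fst y)))).

(** One-parameter subgroups t |-> exp(t Y_d) for a basis Y_0,Y_1,Y_2 of su(2):
    exp(t Y_0) = diag(e^{-it/2}, e^{it/2}),
    exp(t Y_1) = [[cos(t/2), i sin(t/2)],[i sin(t/2), cos(t/2)]],
    exp(t Y_2) = [[cos(t/2), sin(t/2)],[-sin(t/2), cos(t/2)]]. *)
Inductive dir : Type := D0 | D1 | D2.
Definition expd (d : dir) (t : R) : pt :=
  match d with
  | D0 => ((cos (t/2), - sin (t/2)), (0, 0))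
  | D1 => ((cos (t/2), 0), (0, sin (t/2)))
  | D2 => ((cos (t/2), 0), (sin (t/2), 0))
  end.

Definition CDerive (g : R -> C) (t : R) : C :=
  (Derive (fun s => fst (g s)) t, Derive (fun s => snd (g s)) t).
Definition ex_CDerive (g : R -> C) (t : R) : Prop :=
  ex_derive (fun s => fst (g s)) t /\ ex_derive (fun s => snd (g s)) t.

Definition lid (d : dir) (phi : pt -> C) : pt -> C :=
  fun x => CDerive (fun t => phi (mulSU2 x (expd d t))) 0.

(** The neutral field partial_0 = Y_0.  With the matrix entries below,
    partial_0 t^l_{mn} = i n t^l_{mn}, i.e. its symbol is (i m delta_{mn}). *)
Definition d0 (phi : pt -> C) : pt -> C := lid D0 phi.

Fixpoint Dw (w : list dir) (phi : pt -> C) : pt -> C :=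
  match w with
  | nil => phi
  | d :: w' => lid d (Dw w' phi)
  end.

Definition smooth (phi : pt -> C) : Prop :=
  forall w : list dir,
    (forall (d : dir) (x : pt), inSU2 x ->
        ex_CDerive (fun t => Dw w phi (mulSU2 x (expd d t))) 0) /\
    (forall x : pt, inSU2 x ->
        filterlim (Dw w phi) (within inSU2 (locally x)) (locally (Dw w phi x))).

Definition semibound (k : nat) (phi : pt -> C) (M : R) : Prop :=
  forall w : list dir, (length w <= k)%nat ->
    forall x, inSU2 x -> Cmod (Dw w phi x) <= M.

Definition distr (u : (pt -> C) -> C) : Prop :=
  (forall phi psi, smooth phi -> smooth psi ->
      u (fun x => Cplus (phi x) (psi x)) = Cplus (u phi) (u psi)) /\
  (forall (c : C) phi, smooth phi ->
      u (fun x => Cmult c (phi x)) = Cmult c (u phi)) /\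
  (exists (K : R) (k : nat), forall phi M, smooth phi -> semibound k phi M ->
      Cmod (u phi) <= K * M).

Definition deq (u v : (pt -> C) -> C) : Prop :=
  forall phi, smooth phi -> u phi = v phi.

(** operations on distributions (bilinear pairing <u, phi>) *)
Definition d0_distr (u : (pt -> C) -> C) : (pt -> C) -> C :=
  fun phi => Copp (u (d0 phi)).
Definition conj_distr (u : (pt -> C) -> C) : (pt -> C) -> C :=
  fun phi => Cconj (u (fun x => Cconj (phi x))).
Definition P_distr (p q : C) (u : (pt -> C) -> C) : (pt -> C) -> C :=
  fun phi => Cminus (Cminus (d0_distr u phi) (Cmult q (u phi)))
                    (Cmult p (conj_distr u phi)).

(** normalized Haar integral on SU(2) = S^3, in Hopf coordinates
    a = cos th e^{i al}, b = sin th e^{i be}, density sin th cos th / (2 pi^2). *)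
Definition hopf (th al be : R) : pt :=
  ((cos th * cos al, cos th * sin al), (sin th * cos be, sin th * sin be)).
Definition haar (g : pt -> C) : C :=
  let h (part : C -> R) : R :=
    / (2 * PI ^ 2) *
    RInt (fun th => RInt (fun al => RInt (fun be =>
          part (g (hopf th al be)) * (sin th * cos th)) 0 (2 * PI)) 0 (2 * PI)) 0 (PI / 2) in
  (h fst, h snd).

Definition T_fun (f : pt -> C) : (pt -> C) -> C :=
  fun phi => haar (fun x => Cmult (f x) (phi x)).

(** * Matrix entries t^l_{mn}
    l = L/2 (L : nat); indices m = l - j, n = l - k with j, k in {0..L}. *)
Fixpoint Cpow (z : C) (n : nat) : C :=
  match n with O => RtoC 1 | S n' => Cmult z (Cpow z n') end.

Definition mval (L j : nat) : R := INR L / 2 - INR j.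

(** t^l_{mn}(x) = sqrt((l-m)!(l+m)!(l-n)!(l+n)!) *
      sum_i x11^(l-m-i) x12^i x21^(i-n+m) x22^(l+n-i) / (i!(l-m-i)!(i-n+m)!(l+n-i)!)
    (sum over i making all exponents nonnegative); here l-m = j, l+m = L-j,
    l-n = k, l+n = L-k, i-n+m = i+k-j, l+n-i = L-k-i. *)
Definition tterm (L j k i : nat) (x : pt) : C :=
  if (j <=? i + k) && (i <=? j) && (i + k <=? L) then
    Cdiv (Cmult (Cmult (Cmult (Cpow (x11 x) (j - i)) (Cpow (x12 x) i))
                       (Cpow (x21 x) (i + k - j))) (Cpow (x22 x) (L - k - i)))
         (RtoC (INR (fact i * fact (j - i) * fact (i + k - j) * fact (L - k - i))))
  else RtoC 0.

Definition tmat (L j k : nat) (x : pt) : C :=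
  Cmult (RtoC (sqrt (INR (fact j * fact (L - j) * fact k * fact (L - k)))))
        (fold_right Cplus (RtoC 0) (map (fun i => tterm L j k i x) (seq 0 (S L)))).

Definition fhat (f : (pt -> C) -> C) (L j k : nat) : C :=
  f (fun x => Cconj (tmat L k j x)).

Definition Delta (p q : C) (L j : nat) : C :=
  (- (mval L j) ^ 2 + Cmod q ^ 2 - Cmod p ^ 2, - 2 * mval L j * Re q).

(** (-1)^(m-n) = (-1)^(k-j) = (-1)^(j+k) *)
Definition sgnC (n : nat) : C := if Nat.even n then RtoC 1 else RtoC (-1).

(** the admissible space E; -m, -n correspond to indices L-j, L-k *)
Definition inE (p q : C) (f : (pt -> C) -> C) : Prop :=
  forall L j : nat, (j <= L)%nat -> Delta p q L j = RtoC 0 ->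
    forall k : nat, (k <= L)%nat ->
      Cplus (Cmult (Cminus (0, mval L j) (Cconj q)) (fhat f L j k))
            (Cmult (Cmult p (sgnC (j + k))) (Cconj (fhat f L (L - j) (L - k))))
      = RtoC 0.

(* Main.v *)
Require Import Defs.
From Stdlib Require Import Reals List Arith Bool Lra Psatz ClassicalEpsilon Lia FunctionalExtensionality.
From Coquelicot Require Import Coquelicot.
Import ListNotations.
Open Scope R_scope.

(** Along the fibres of the right action of exp(tY_0) the equation is a 4 pi-periodic linear
    ODE.  With Qv = (d0 - conj q) v + p conj v one has PQ = (d0 - l1)(d0 - l2), where l1, l2 are
    the roots of X^2 - 2 Re(q) X + |q|^2 - |p|^2; the resolvents (d0 - l)^{-1} are averages
    of translates along the fibre against an explicit weight, so they preserve smoothness and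
    act on distributions by transposition, and no small divisors occur.  If exp(4 pi l) = 1
    the resolvent only inverts d0 - l up to the projection Pi_l onto the l-eigenspace of d0;
    this resonant part is solved by hand, u = Pi_l f / (2 (l - q)), as soon as
    (l - conj q) Pi_l f + p Pi_l (conj f) = 0.  The admissibility condition gives this identity when
    tested on matrix coefficients, and it extends to all test functions because matrix
    coefficients span the polynomials, which are dense in C^k: convolution of a test function
    with the polynomial kernels ((1 + <x,y>)/2)^N commutes with left-invariant derivatives and
    converges uniformly. *)

(** * The group SU(2) and continuity on it *)

(** P is only real-linear; Q is the operator for which the conjugate terms of PQ cancel, because d0
    commutes with conjugation. The number Delta(l)_m is the characteristic polynomial (X - q)(X -
    conj q) - |p|^2 at X = im, so admissibility concerns exactly the roots that are weights of d0.
    At a root l the product (l - q)(l - conj q) equals |p|^2, hence p <> 0 permits division by l -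
    q. The factor 2 in the resonant solution arises because d0 - q supplies one half of the resonant
    part of f and the conjugate term, through the admissibility identity, the other half. The
    encoding shapes the rest. Smoothness only provides derivatives along three one-parameter
    subgroups and continuity of their iterates, so the chain rule along other curves has to be
    derived; it is needed because translation along the fibre rotates Y_1 and Y_2, and because Haar
    measure is given in Hopf coordinates. The algebra of the solution is carried out once for
    abstract operators and applied both to distributions and to smooth functions. *)

Definition p1 (x : pt) : R := fst (fst x).
Definition p2 (x : pt) : R := snd (fst x).
Definition p3 (x : pt) : R := fst (snd x).
Definition p4 (x : pt) : R := snd (snd x).
Definition mk (a b c d : R) : pt := ((a, b), (c, d)).
Definition one : pt := mk 1 0 0 0.

Lemma mk_eta (x : pt) : x = mk (p1 x) (p2 x) (p3 x) (p4 x).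
Proof. destruct x as [[a b] [c d]]; reflexivity. Qed.

Lemma mk_eq a b c d a' b' c' d' :
  a = a' -> b = b' -> c = c' -> d = d' -> mk a b c d = mk a' b' c' d'.
Proof. now intros -> -> -> ->. Qed.

Lemma mul_mk a b c d a' b' c' d' :
  mulSU2 (mk a b c d) (mk a' b' c' d') =
  mk (a * a' - b * b' - (c * c' + d * d')) (a * b' + b * a' - (d * c' - c * d'))
     (a * c' - b * d' + (c * a' + d * b')) (a * d' + b * c' + (d * a' - c * b')).
Proof.
  unfold mulSU2, mk, Cminus, Cmult, Cplus, Copp, Cconj; simpl.
  apply (f_equal2 pair); apply (f_equal2 pair); ring.
Qed.

Lemma Cmod2 (z : C) : Cmod z ^ 2 = fst z * fst z + snd z * snd z.
Proof.
  unfold Cmod. rewrite pow2_sqrt; [ring|].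
  apply Rplus_le_le_0_compat; apply pow2_ge_0.
Qed.

Lemma inSU2_mk a b c d : inSU2 (mk a b c d) <-> a * a + b * b + c * c + d * d = 1.
Proof. unfold inSU2. rewrite !Cmod2. simpl. split; lra. Qed.

Lemma inSU2_p x :
  inSU2 x <-> p1 x * p1 x + p2 x * p2 x + p3 x * p3 x + p4 x * p4 x = 1.
Proof. rewrite (mk_eta x) at 1. apply inSU2_mk. Qed.

Lemma inSU2_one : inSU2 one.
Proof. apply inSU2_mk; ring. Qed.

Lemma inSU2_mul x y : inSU2 x -> inSU2 y -> inSU2 (mulSU2 x y).
Proof.
  rewrite (mk_eta x), (mk_eta y), mul_mk, !inSU2_mk.
  generalize (p1 x) (p2 x) (p3 x) (p4 x) (p1 y) (p2 y) (p3 y) (p4 y).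
  intros a b c d a' b' c' d' H H'.
  transitivity ((a * a + b * b + c * c + d * d) * (a' * a' + b' * b' + c' * c' + d' * d')).
  ring. rewrite H, H'; ring.
Qed.

Lemma mulA x y z : mulSU2 x (mulSU2 y z) = mulSU2 (mulSU2 x y) z.
Proof.
  rewrite (mk_eta x), (mk_eta y), (mk_eta z), !mul_mk. apply mk_eq; ring.
Qed.

Lemma mul_one x : mulSU2 x one = x.
Proof. rewrite (mk_eta x). unfold one. rewrite mul_mk. apply mk_eq; ring. Qed.

Lemma one_mul x : mulSU2 one x = x.
Proof. rewrite (mk_eta x). unfold one. rewrite mul_mk. apply mk_eq; ring. Qed.

Definition invSU2 (x : pt) : pt := mk (p1 x) (- p2 x) (- p3 x) (- p4 x).

Lemma mul_inv x : inSU2 x -> mulSU2 x (invSU2 x) = one.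
Proof.
  rewrite inSU2_p. intros H. rewrite (mk_eta x) at 1. unfold invSU2, one. rewrite mul_mk.
  apply mk_eq; try ring. rewrite <- H; ring.
Qed.

Lemma inSU2_inv x : inSU2 x -> inSU2 (invSU2 x).
Proof. rewrite inSU2_p. unfold invSU2. rewrite inSU2_mk. intros H; rewrite <- H; ring. Qed.

Lemma expd_mk d t : expd d t =
  match d with
  | D0 => mk (cos (t / 2)) (- sin (t / 2)) 0 0
  | D1 => mk (cos (t / 2)) 0 0 (sin (t / 2))
  | D2 => mk (cos (t / 2)) 0 (sin (t / 2)) 0
  end.
Proof. destruct d; reflexivity. Qed.

Lemma cs1 t : cos t * cos t + sin t * sin t = 1.
Proof. generalize (sin2_cos2 t); unfold Rsqr; lra. Qed.

Lemma inSU2_expd d t : inSU2 (expd d t).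
Proof. rewrite expd_mk. generalize (cs1 (t/2)); intros H. destruct d; rewrite inSU2_mk; lra. Qed.

Lemma inSU2_mule x d t : inSU2 x -> inSU2 (mulSU2 x (expd d t)).
Proof. intros H. apply inSU2_mul; auto. apply inSU2_expd. Qed.

Lemma expd_0 d : expd d 0 = one.
Proof.
  rewrite expd_mk. replace (0/2) with 0 by field. rewrite cos_0, sin_0.
  destruct d; unfold one; apply mk_eq; ring.
Qed.

Lemma expd_plus d s t : mulSU2 (expd d s) (expd d t) = expd d (s + t).
Proof.
  rewrite !expd_mk. replace ((s + t)/2) with (s/2 + t/2) by field.
  rewrite cos_plus, sin_plus. destruct d; rewrite mul_mk; apply mk_eq; ring.
Qed.

Lemma mule_plus x d s t : mulSU2 (mulSU2 x (expd d s)) (expd d t) = mulSU2 x (expd d (s + t)).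
Proof. now rewrite <- mulA, expd_plus. Qed.

Definition ccont (g : pt -> R) : Prop :=
  forall x, inSU2 x -> filterlim g (within inSU2 (locally x)) (locally (g x)).

Lemma continuous_mk {T : UniformSpace} (f1 f2 f3 f4 : T -> R) (p : T) :
  continuous f1 p -> continuous f2 p -> continuous f3 p -> continuous f4 p ->
  continuous (fun t => mk (f1 t) (f2 t) (f3 t) (f4 t)) p.
Proof.
  intros H1 H2 H3 H4. apply filterlim_locally. intros eps.
  apply filterlim_locally with (eps := eps) in H1.
  apply filterlim_locally with (eps := eps) in H2.
  apply filterlim_locally with (eps := eps) in H3.
  apply filterlim_locally with (eps := eps) in H4.
  generalize (filter_and _ _ (filter_and _ _ H1 H2) (filter_and _ _ H3 H4)).
  apply filter_imp. intros y [[? ?] [? ?]]. repeat split; assumption.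
Qed.

Lemma continuous_p1 (x : pt) : continuous p1 x.
Proof. apply (continuous_comp fst fst); apply continuous_fst. Qed.
Lemma continuous_p2 (x : pt) : continuous p2 x.
Proof. apply (continuous_comp fst snd); [apply continuous_fst|apply continuous_snd]. Qed.
Lemma continuous_p3 (x : pt) : continuous p3 x.
Proof. apply (continuous_comp snd fst); [apply continuous_snd|apply continuous_fst]. Qed.
Lemma continuous_p4 (x : pt) : continuous p4 x.
Proof. apply (continuous_comp snd snd); apply continuous_snd. Qed.

Lemma ccont_continuous (g : pt -> R) : (forall x, continuous g x) -> ccont g.
Proof. intros H x _. apply (filterlim_filter_le_1 (F := locally x)). 2: apply H.
  intros P HP. unfold within. revert HP. apply filter_imp. auto. Qed.

Lemma ccont_comp {T : UniformSpace} (g : pt -> R) (gam : T -> pt) (p : T) :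
  ccont g -> (forall t, inSU2 (gam t)) -> continuous gam p ->
  continuous (fun t => g (gam t)) p.
Proof.
  intros Hg Hin Hc. unfold continuous.
  apply (filterlim_comp _ _ _ gam g _ (within inSU2 (locally (gam p)))). 2: now apply Hg.
  intros P HP. unfold within in HP. apply Hc in HP. unfold filtermap in *.
  revert HP. apply filter_imp. auto.
Qed.

Lemma ccont_ext g h : (forall x, inSU2 x -> g x = h x) -> ccont g -> ccont h.
Proof.
  intros E H x Hx. rewrite <- (E x Hx).
  apply filterlim_within_ext with (f := g); auto.
Qed.

Lemma ccont_const c : ccont (fun _ => c).
Proof. intros x _. apply filterlim_const. Qed.

Lemma ccont_plus g h : ccont g -> ccont h -> ccont (fun x => g x + h x).
Proof.
  intros Hg Hh x Hx. eapply filterlim_comp_2; [now apply Hg|now apply Hh|].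
  apply (filterlim_plus (V := R_NormedModule)).
Qed.

Lemma ccont_mult g h : ccont g -> ccont h -> ccont (fun x => g x * h x).
Proof.
  intros Hg Hh x Hx. eapply filterlim_comp_2; [now apply Hg|now apply Hh|].
  apply (filterlim_mult (K := R_AbsRing)).
Qed.

Lemma Rcont_plus {T : UniformSpace} (f g : T -> R) p :
  continuous f p -> continuous g p -> continuous (fun t => f t + g t) p.
Proof. apply (continuous_plus (V := R_NormedModule)). Qed.
Lemma Rcont_minus {T : UniformSpace} (f g : T -> R) p :
  continuous f p -> continuous g p -> continuous (fun t => f t - g t) p.
Proof. apply (continuous_minus (V := R_NormedModule)). Qed.
Lemma Rcont_opp {T : UniformSpace} (f : T -> R) p :
  continuous f p -> continuous (fun t => - f t) p.
Proof. apply (continuous_opp (V := R_NormedModule)). Qed.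
Lemma Rcont_mult {T : UniformSpace} (f g : T -> R) p :
  continuous f p -> continuous g p -> continuous (fun t => f t * g t) p.
Proof. apply (continuous_mult (K := R_AbsRing)). Qed.
Lemma Rcont_cos {T : UniformSpace} (f : T -> R) p :
  continuous f p -> continuous (fun t => cos (f t)) p.
Proof. intros H. apply (continuous_comp f cos); auto. apply continuous_cos. Qed.
Lemma Rcont_sin {T : UniformSpace} (f : T -> R) p :
  continuous f p -> continuous (fun t => sin (f t)) p.
Proof. intros H. apply (continuous_comp f sin); auto. apply continuous_sin. Qed.
Lemma Rcont_exp {T : UniformSpace} (f : T -> R) p :
  continuous f p -> continuous (fun t => exp (f t)) p.
Proof. intros H. apply (continuous_comp f exp); auto.
  apply continuity_pt_filterlim. apply derivable_continuous_pt, derivable_pt_exp. Qed.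
Lemma cont_fst {T U V : UniformSpace} (f : T -> U * V) p :
  continuous f p -> continuous (fun t => fst (f t)) p.
Proof. intros H. apply (continuous_comp f fst); auto. apply continuous_fst. Qed.
Lemma cont_snd {T U V : UniformSpace} (f : T -> U * V) p :
  continuous f p -> continuous (fun t => snd (f t)) p.
Proof. intros H. apply (continuous_comp f snd); auto. apply continuous_snd. Qed.

Ltac ctac := unfold Rdiv; repeat (
  try assumption;
  match goal with
  | |- continuous (fun t => @?f t + @?g t) _ => apply (Rcont_plus f g)
  | |- continuous (fun t => @?f t - @?g t) _ => apply (Rcont_minus f g)
  | |- continuous (fun t => @?f t * @?g t) _ => apply (Rcont_mult f g)
  | |- continuous (fun t => - @?f t) _ => apply (Rcont_opp f)
  | |- continuous (fun t => cos (@?f t)) _ => apply (Rcont_cos f)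
  | |- continuous (fun t => sin (@?f t)) _ => apply (Rcont_sin f)
  | |- continuous (fun t => exp (@?f t)) _ => apply (Rcont_exp f)
  | |- continuous (fun t => fst (@?f t)) _ => apply (cont_fst f)
  | |- continuous (fun t => snd (@?f t)) _ => apply (cont_snd f)
  | |- continuous (fun t => t) _ => apply continuous_id
  | |- continuous fst _ => apply continuous_fst
  | |- continuous snd _ => apply continuous_snd
  | |- continuous (fun t => ?c) _ => apply continuous_const
  end).

Lemma continuous_mul {T : UniformSpace} (f g : T -> pt) p :
  continuous f p -> continuous g p -> continuous (fun t => mulSU2 (f t) (g t)) p.
Proof.
  intros Hf Hg.
  apply continuous_ext with (fun t =>
   mk (p1 (f t) * p1 (g t) - p2 (f t) * p2 (g t) - (p3 (f t) * p3 (g t) + p4 (f t) * p4 (g t)))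
      (p1 (f t) * p2 (g t) + p2 (f t) * p1 (g t) - (p4 (f t) * p3 (g t) - p3 (f t) * p4 (g t)))
     (p1 (f t) * p3 (g t) - p2 (f t) * p4 (g t) + (p3 (f t) * p1 (g t) + p4 (f t) * p2 (g t)))
     (p1 (f t) * p4 (g t) + p2 (f t) * p3 (g t) + (p4 (f t) * p1 (g t) - p3 (f t) * p2 (g t)))).
  - intros t. symmetry. generalize (f t) (g t); intros x y.
    rewrite <- mul_mk, <- !mk_eta. reflexivity.
  - apply continuous_mk; unfold p1, p2, p3, p4; ctac.
Qed.

Lemma continuous_expd {T : UniformSpace} d (f : T -> R) p :
  continuous f p -> continuous (fun t => expd d (f t)) p.
Proof.
  intros Hf. eapply continuous_ext. intros t. symmetry. apply expd_mk.
  destruct d; apply continuous_mk; ctac.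
Qed.

Ltac ptac := repeat (
  try assumption;
  match goal with
  | |- continuous (fun t => mulSU2 (@?f t) (@?g t)) _ => apply (continuous_mul f g)
  | |- continuous (fun t => expd ?d (@?f t)) _ => apply (continuous_expd d f)
  | |- continuous (fun t => ?c) _ => apply continuous_const
  | _ => progress ctac
  end).

(** * The chain rule along curves in SU(2) *)

Definition rl (d : dir) (g : pt -> R) : pt -> R :=
  fun x => Derive (fun t => g (mulSU2 x (expd d t))) 0.

Definition der (g : pt -> R) : Prop := forall d x, inSU2 x ->
  ex_derive (fun t => g (mulSU2 x (expd d t))) 0.

(** [der] only asserts differentiability at parameter 0; by the group law the orbit through x at
    time t is the orbit through x exp(tY_d) at time 0, which gives the derivative everywhere along
    the orbit. *)
Lemma der_along g d x t : der g -> inSU2 x ->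
  is_derive (fun t => g (mulSU2 x (expd d t))) t (rl d g (mulSU2 x (expd d t))).
Proof.
  intros Hg Hx.
  assert (H := Derive_correct _ _ (Hg d _ (inSU2_mule x d t Hx))).
  change (Derive _ 0) with (rl d g (mulSU2 x (expd d t))) in H.
  replace 0 with (t - t) in H by ring.
  apply (is_derive_comp (fun s => g (mulSU2 (mulSU2 x (expd d t)) (expd d s))) (fun s => s - t) t _ 1) in H.
  - change (scal 1 ?v) with (1 * v) in H. rewrite Rmult_1_l in H. revert H. apply is_derive_ext. intros s.
    rewrite mule_plus. do 3 f_equal. ring.
  - auto_derive; auto; ring.
Qed.

Lemma mvt_bound (h h' : R -> R) (c l e : R) :
  (forall t, Rabs t <= Rabs c -> is_derive h t (h' t)) ->
  (forall t, Rabs t <= Rabs c -> Rabs (h' t - l) <= e) ->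
  Rabs (h c - h 0 - l * c) <= e * Rabs c.
Proof.
  intros H1 H2.
  assert (HH : forall t, Rmin 0 c <= t <= Rmax 0 c -> Rabs t <= Rabs c).
  { intros t. unfold Rmin, Rmax. destruct (Rle_dec 0 c); unfold Rabs;
    destruct (Rcase_abs t), (Rcase_abs c); lra. }
  destruct (MVT_gen h 0 c h') as (t & Ht & E).
  - intros t Ht. apply H1, HH; lra.
  - intros t Ht. apply continuity_pt_filterlim.
    apply (ex_derive_continuous (K:=R_AbsRing) (V:=R_NormedModule)). exists (h' t). apply H1, HH, Ht.
  - rewrite E. replace (h' t * (c - 0) - l * c) with ((h' t - l) * c) by ring.
    rewrite Rabs_mult. apply Rmult_le_compat_r. apply Rabs_pos. apply H2, HH, Ht.
Qed.

Definition loc (x : pt) (a b c : R) : pt :=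
  mulSU2 (mulSU2 (mulSU2 x (expd D1 a)) (expd D2 b)) (expd D0 c).

(** Moving one coordinate at a time, each leg runs along a one-parameter orbit, where the mean value
    theorem applies with a left-invariant derivative; continuity keeps these derivatives within e of
    their values at x. *)
Lemma loc_est g x e : der g -> (forall d, ccont (rl d g)) -> inSU2 x -> 0 < e ->
  exists del, 0 < del /\ forall a b c, Rabs a < del -> Rabs b < del -> Rabs c < del ->
    Rabs (g (loc x a b c) - g x - (a * rl D1 g x + b * rl D2 g x + c * rl D0 g x))
      <= e * (Rabs a + Rabs b + Rabs c).
Proof.
  intros Hd Hc Hx He.
  assert (K : forall d, exists del, 0 < del /\ forall a b c, Rabs a < del -> Rabs b < del -> Rabs c < del ->
     Rabs (rl d g (loc x a b c) - rl d g x) <= e).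
  { intros d.
    assert (C : continuous (fun p : R * (R * R) => rl d g (loc x (fst p) (fst (snd p)) (snd (snd p)))) (0, (0, 0))).
    { apply ccont_comp. apply Hc.
      intros p. unfold loc. repeat apply inSU2_mule. auto.
      unfold loc. ptac. }
    assert (C' := proj1 (filterlim_locally _ _) C (mkposreal e He)).
    destruct C' as [del Hdel]. exists del. split. apply del.
    intros a b c Ha Hb Hc0. left. specialize (Hdel (a, (b, c))).
    replace (rl d g x) with (rl d g (loc x 0 0 0)).
    apply Hdel. repeat split; simpl; unfold ball, prod_ball; simpl;
      unfold AbsRing_ball, abs, minus, plus, opp; simpl; rewrite Ropp_0, Rplus_0_r; auto.
    unfold loc. now rewrite !expd_0, !mul_one. }
  destruct (K D0) as (d0 & P0 & H0), (K D1) as (d1 & P1 & H1), (K D2) as (d2 & P2 & H2).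
  exists (Rmin d0 (Rmin d1 d2)). split. repeat apply Rmin_pos; auto.
  intros a b c Ha Hb Hc0.
  assert (Hmm : forall t, Rabs t < Rmin d0 (Rmin d1 d2) -> Rabs t < d0 /\ Rabs t < d1 /\ Rabs t < d2).
  { intros t Ht. generalize (Rmin_l d0 (Rmin d1 d2)) (Rmin_r d0 (Rmin d1 d2)) (Rmin_l d1 d2) (Rmin_r d1 d2). lra. }
  destruct (Hmm _ Ha) as (A0 & A1 & A2), (Hmm _ Hb) as (B0 & B1 & B2), (Hmm _ Hc0) as (C0 & C1 & C2).
  assert (Z : forall t, 0 < t -> Rabs 0 < t) by (intros; rewrite Rabs_R0; auto).
  assert (E1 := mvt_bound (fun t => g (loc x t 0 0)) (fun t => rl D1 g (loc x t 0 0)) a (rl D1 g x) e).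
  assert (E2 := mvt_bound (fun t => g (loc x a t 0)) (fun t => rl D2 g (loc x a t 0)) b (rl D2 g x) e).
  assert (E3 := mvt_bound (fun t => g (loc x a b t)) (fun t => rl D0 g (loc x a b t)) c (rl D0 g x) e).
  lapply E1; [clear E1; intros E1; lapply E1; [clear E1; intros E1|]|].
  2: { intros t Ht. apply H1; auto; lra. }
  2: { intros t Ht. unfold loc. rewrite !expd_0, !mul_one.
       apply (is_derive_ext (fun t => g (mulSU2 x (expd D1 t)))).
       intros; now rewrite !mul_one. now apply der_along. }
  lapply E2; [clear E2; intros E2; lapply E2; [clear E2; intros E2|]|].
  2: { intros t Ht. apply H2; auto; lra. }
  2: { intros t Ht. unfold loc. rewrite !expd_0, !mul_one.
       apply (is_derive_ext (fun t => g (mulSU2 (mulSU2 x (expd D1 a)) (expd D2 t)))).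
       intros; now rewrite !mul_one. apply der_along; auto. now apply inSU2_mule. }
  lapply E3; [clear E3; intros E3; lapply E3; [clear E3; intros E3|]|].
  2: { intros t Ht. apply H0; auto; lra. }
  2: { intros t Ht. unfold loc. apply der_along; auto. now repeat apply inSU2_mule. }
  replace (g x) with (g (loc x 0 0 0)). 2: unfold loc; now rewrite !expd_0, !mul_one.
  replace (g (loc x a b c) - _ - _) with
   ((g (loc x a 0 0) - g (loc x 0 0 0) - rl D1 g x * a) +
    ((g (loc x a b 0) - g (loc x a 0 0) - rl D2 g x * b) +
     (g (loc x a b c) - g (loc x a b 0) - rl D0 g x * c))) by ring.
  eapply Rle_trans. apply Rabs_triang.
  eapply Rle_trans. apply Rplus_le_compat. apply E1.
  eapply Rle_trans. apply Rabs_triang. apply Rplus_le_compat. apply E2. apply E3. lra.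
Qed.

Lemma loc_derive g x (a b c : R -> R) t (a' b' c' : R) :
  der g -> (forall d, ccont (rl d g)) -> inSU2 x ->
  a t = 0 -> b t = 0 -> c t = 0 ->
  is_derive a t a' -> is_derive b t b' -> is_derive c t c' ->
  is_derive (fun s => g (loc x (a s) (b s) (c s))) t
    (a' * rl D1 g x + b' * rl D2 g x + c' * rl D0 g x).
Proof.
  intros Hd Hc Hx a0 b0 c0 Da Db Dc.
  apply is_derive_Reals in Da. apply is_derive_Reals in Db. apply is_derive_Reals in Dc.
  apply is_derive_Reals. intros eps Heps.
  set (g0 := rl D0 g x). set (g1 := rl D1 g x). set (g2 := rl D2 g x).
  set (L := Rabs a' + Rabs b' + Rabs c' + 3).
  set (G := Rabs g0 + Rabs g1 + Rabs g2 + 1).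
  assert (LP : 0 < L) by (unfold L; generalize (Rabs_pos a') (Rabs_pos b') (Rabs_pos c'); lra).
  assert (GP : 0 < G) by (unfold G; generalize (Rabs_pos g0) (Rabs_pos g1) (Rabs_pos g2); lra).
  destruct (loc_est g x (eps / (2 * L)) Hd Hc Hx) as (del & Pdel & Hdel).
  { apply Rdiv_lt_0_compat; lra. }
  (* The bound 1 gives |a(t + h)| <= (|a'| + 1) |h|, so that [L] controls the increments; the bound
     eps / (2 G) keeps the error of the difference quotients below eps / 2. *)
  set (e1 := Rmin 1 (eps / (2 * G))).
  assert (Pe1 : 0 < e1) by (apply Rmin_pos; [lra|apply Rdiv_lt_0_compat; lra]).
  destruct (Da e1 Pe1) as (da & Ha), (Db e1 Pe1) as (db & Hb), (Dc e1 Pe1) as (dc & Hcc).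
  assert (Pdd : 0 < Rmin (Rmin da db) (Rmin dc (del / L))).
  { repeat apply Rmin_pos; try apply cond_pos. apply Rdiv_lt_0_compat; lra. }
  exists (mkposreal _ Pdd). simpl. intros h Hh0 Hh.
  generalize (Rmin_l (Rmin da db) (Rmin dc (del / L))) (Rmin_r (Rmin da db) (Rmin dc (del / L)))
   (Rmin_l da db) (Rmin_r da db) (Rmin_l dc (del / L)) (Rmin_r dc (del / L)). intros M1 M2 M3 M4 M5 M6.
  assert (Ha' := Ha h Hh0 ltac:(lra)). assert (Hb' := Hb h Hh0 ltac:(lra)).
  assert (Hc' := Hcc h Hh0 ltac:(lra)). rewrite a0 in Ha'. rewrite b0 in Hb'. rewrite c0 in Hc'.
  rewrite Rminus_0_r in Ha', Hb', Hc'.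
  assert (E11 : e1 <= 1) by apply Rmin_l.
  assert (E12 : e1 <= eps / (2 * G)) by apply Rmin_r.
  assert (Pos : 0 < Rabs h) by now apply Rabs_pos_lt.
  assert (Big : forall u u', Rabs (u / h - u') < e1 -> Rabs u <= (Rabs u' + 1) * Rabs h).
  { intros u u' H. replace u with ((u / h - u') * h + u' * h) by (field; auto).
    eapply Rle_trans. apply Rabs_triang. rewrite !Rabs_mult.
    assert (Rabs (u / h - u') * Rabs h <= 1 * Rabs h) by (apply Rmult_le_compat_r; lra). lra. }
  assert (Ba := Big _ _ Ha'). assert (Bb := Big _ _ Hb'). assert (Bc := Big _ _ Hc').
  assert (HL : L * Rabs h < del).
  { replace del with (L * (del / L)) by (field; lra). apply Rmult_lt_compat_l; lra. }
  assert (Xa : Rabs a' * Rabs h >= 0) by (apply Rle_ge, Rmult_le_pos; apply Rabs_pos).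
  assert (Xb : Rabs b' * Rabs h >= 0) by (apply Rle_ge, Rmult_le_pos; apply Rabs_pos).
  assert (Xc : Rabs c' * Rabs h >= 0) by (apply Rle_ge, Rmult_le_pos; apply Rabs_pos).
  assert (EST := Hdel (a (t + h)) (b (t + h)) (c (t + h)) ltac:(unfold L in HL; lra)
     ltac:(unfold L in HL; lra) ltac:(unfold L in HL; lra)).
  rewrite a0, b0, c0. replace (loc x 0 0 0) with x by (unfold loc; now rewrite !expd_0, !mul_one).
  fold g0 g1 g2 in EST |- *.
  set (Z := g (loc x (a (t + h)) (b (t + h)) (c (t + h))) - g x) in *.
  replace (Z / h - (a' * g1 + b' * g2 + c' * g0)) with
   ((Z - (a (t + h) * g1 + b (t + h) * g2 + c (t + h) * g0)) / h
    + ((a (t + h) / h - a') * g1 + ((b (t + h) / h - b') * g2 + (c (t + h) / h - c') * g0))) by (field; auto).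
  eapply Rle_lt_trans. apply Rabs_triang.
  assert (Q1 : Rabs ((Z - (a (t + h) * g1 + b (t + h) * g2 + c (t + h) * g0)) / h) <= eps / 2).
  { unfold Rdiv at 1. rewrite Rabs_mult, Rabs_inv.
    apply Rmult_le_reg_r with (Rabs h); auto. rewrite Rmult_assoc, Rinv_l, Rmult_1_r by lra.
    eapply Rle_trans. apply EST.
    replace (eps / 2 * Rabs h) with (eps / (2 * L) * (L * Rabs h)) by (field; lra).
    apply Rmult_le_compat_l. left; apply Rdiv_lt_0_compat; lra. unfold L. lra. }
  assert (Q2 : Rabs ((a (t + h) / h - a') * g1 + ((b (t + h) / h - b') * g2 + (c (t + h) / h - c') * g0)) < eps / 2).
  { eapply Rle_lt_trans. apply Rabs_triang.
    eapply Rle_lt_trans. apply Rplus_le_compat_l. apply Rabs_triang. rewrite !Rabs_mult.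
    assert (F : forall u v, Rabs u < e1 -> Rabs u * Rabs v <= e1 * Rabs v)
      by (intros; apply Rmult_le_compat_r; [apply Rabs_pos|lra]).
    assert (F1 := F _ g1 Ha'). assert (F2 := F _ g2 Hb'). assert (F3 := F _ g0 Hc').
    apply Rle_lt_trans with (e1 * (Rabs g0 + Rabs g1 + Rabs g2)). lra.
    apply Rlt_le_trans with (e1 * G). apply Rmult_lt_compat_l; unfold G; lra.
    replace (eps / 2) with (eps / (2 * G) * G) by (field; lra). apply Rmult_le_compat_r; lra. }
  lra.
Qed.

(* Coordinates of the second kind near the identity: (A,B) is exp(aY_1)exp(bY_2)exp(cY_0)
   with tan c = - Im W / Re W, W = A^2 - conj(B)^2, which forces the quotient
   (A',B') = (A,B)exp(-cY_0) onto the surface Re A' Im A' = - Re B' Im B'. *)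
Lemma atan_coords n1 n2 n3 n4 : 0 < n1 ->
  n1 * n1 + n2 * n2 + n3 * n3 + n4 * n4 = 1 -> n1 * n2 = - (n3 * n4) ->
  loc one (2 * atan (n4 / n1)) (2 * atan (n3 / n1)) 0 = mk n1 n2 n3 n4.
Proof.
  intros P S E. unfold loc. rewrite expd_0, mul_one, one_mul, !expd_mk.
  replace (2 * atan (n4 / n1) / 2) with (atan (n4 / n1)) by field.
  replace (2 * atan (n3 / n1) / 2) with (atan (n3 / n1)) by field.
  set (u := n4 / n1). set (v := n3 / n1).
  assert (Hs : forall w, sin (atan w) = w * cos (atan w)).
  { intros w. rewrite sin_atan, cos_atan. unfold Rdiv. ring. }
  assert (Hp : forall w, 0 < cos (atan w)).
  { intros w. generalize (atan_bound w); intros Hw. apply cos_gt_0; lra. }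
  assert (Hq : forall w, cos (atan w) * cos (atan w) * (1 + w * w) = 1).
  { intros w. generalize (cs1 (atan w)). rewrite Hs. lra. }
  rewrite !Hs, mul_mk.
  assert (K : cos (atan u) * cos (atan v) = n1).
  { generalize (Hp u) (Hp v) (Hq u) (Hq v).
    generalize (cos (atan u)) (cos (atan v)). intros cu cv Pu Pv Qu Qv.
    assert (0 < cu * cv) by now apply Rmult_lt_0_compat.
    (* By the surface equation n3 n4 / n1 = - n2, so (1 + u^2)(1 + v^2) n1^2 is the squared norm 1;
       two positive numbers with equal squares coincide. *)
    assert (cu * cv * (cu * cv) = n1 * n1).
    { assert (T : (1 + u * u) * (1 + v * v) * (n1 * n1) = 1).
      { unfold u, v.
        replace ((1 + n4 / n1 * (n4 / n1)) * (1 + n3 / n1 * (n3 / n1)) * (n1 * n1)) with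
         (n1 * n1 + n4 * n4 + n3 * n3 + (n3 * n4 / n1) * (n3 * n4 / n1)) by (field; lra).
        replace (n3 * n4 / n1) with (- n2). rewrite <- S; ring.
        replace (n3 * n4) with (- (n1 * n2)) by lra. field; lra. }
      transitivity (cu * cv * (cu * cv) * ((1 + u * u) * (1 + v * v) * (n1 * n1))).
      rewrite T; ring.
      transitivity ((cu * cu * (1 + u * u)) * (cv * cv * (1 + v * v)) * (n1 * n1)). ring.
      rewrite Qu, Qv; ring. }
    nra. }
  assert (Un : u * n1 = n4) by (unfold u; field; lra).
  assert (Vn : v * n1 = n3) by (unfold v; field; lra).
  apply mk_eq.
  - rewrite <- K; ring.
  - assert (u * v * n1 = - n2).
    { apply Rmult_eq_reg_l with n1; [|lra]. rewrite <- Un, <- Vn in E.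
      replace (n1 * - n2) with (- (n1 * n2)) by ring. rewrite E; ring. }
    rewrite <- K in H. lra.
  - rewrite <- K in Vn. lra.
  - rewrite <- K in Un. lra.
Qed.

(** [cU] and [cV] are the real and imaginary parts of W = A^2 - conj(B)^2 for A = y1 + i y2 and B =
    y3 + i y4. The functions [n1], [n3], [n4] below are coordinates of the quotient (A',B'). *)
Definition cU y1 y2 y3 y4 := y1 * y1 - y2 * y2 - y3 * y3 + y4 * y4.
Definition cV y1 y2 y3 y4 := 2 * y1 * y2 + 2 * y3 * y4.
Definition cc y1 y2 y3 y4 := - atan (cV y1 y2 y3 y4 / cU y1 y2 y3 y4).
Definition n1 y1 y2 c := y1 * cos (c / 2) - y2 * sin (c / 2).
Definition n3 y3 y4 c := y3 * cos (c / 2) + y4 * sin (c / 2).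
Definition n4 y3 y4 c := y4 * cos (c / 2) - y3 * sin (c / 2).

(** Right multiplication by exp(-cY_0) multiplies W by e^{ic}, and the choice of c makes the product
    real; vanishing of its imaginary part is the surface equation required by [atan_coords]. *)
Lemma local_coords y1 y2 y3 y4 : inSU2 (mk y1 y2 y3 y4) ->
  let c := cc y1 y2 y3 y4 in
  0 < cU y1 y2 y3 y4 -> 0 < n1 y1 y2 c ->
  loc one (2 * atan (n4 y3 y4 c / n1 y1 y2 c)) (2 * atan (n3 y3 y4 c / n1 y1 y2 c)) c
  = mk y1 y2 y3 y4.
Proof.
  rewrite inSU2_mk. intros S c PU Pn.
  pose (n2 := y1 * sin (c / 2) + y2 * cos (c / 2)).
  assert (H := atan_coords (n1 y1 y2 c) n2 (n3 y3 y4 c) (n4 y3 y4 c) Pn).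
  assert (C := cs1 (c / 2)).
  unfold loc in *. rewrite expd_0, mul_one in H. rewrite H.
  - rewrite expd_mk, mul_mk. unfold n1, n2, n3, n4.
    clear H. revert C. generalize (cos (c / 2)) (sin (c / 2)). intros k s C.
    apply mk_eq; [transitivity (y1 * (k * k + s * s))|transitivity (y2 * (k * k + s * s))
     |transitivity (y3 * (k * k + s * s))|transitivity (y4 * (k * k + s * s))]; try ring; rewrite C; ring.
  - unfold n1, n2, n3, n4. transitivity ((y1*y1+y2*y2+y3*y3+y4*y4) * (cos (c/2) * cos (c/2) + sin (c/2) * sin (c/2))).
    ring. rewrite C, S; ring.
  - assert (E : cU y1 y2 y3 y4 * sin c + cV y1 y2 y3 y4 * cos c = 0).
    { unfold c, cc. rewrite sin_neg, cos_neg, sin_atan, cos_atan. field.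
      split. 2: lra. apply Rgt_not_eq, sqrt_lt_R0. unfold Rsqr. nra. }
    replace c with (2 * (c / 2)) in E by field. rewrite sin_2a, cos_2a in E.
    unfold cU, cV in E. unfold n1, n2, n3, n4. nra.
Qed.

(** For a curve x with velocity a these are the components of x^{-1} x' in the basis Y_0, Y_1, Y_2.
    The factors 2 compensate the half angles in [expd], and the sign in [dc0] is that of diag(-i/2,
    i/2). *)
Definition dc0 x1 x2 x3 x4 a1 a2 a3 a4 := - 2 * (x1 * a2 - x2 * a1 + x4 * a3 - x3 * a4).
Definition dc1 x1 x2 x3 x4 a1 a2 a3 a4 := 2 * (x1 * a4 - x2 * a3 - x4 * a1 + x3 * a2).
Definition dc2 x1 x2 x3 x4 a1 a2 a3 a4 := 2 * (x1 * a3 + x2 * a4 - x3 * a1 - x4 * a2).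

Lemma derive_eta (f : R -> R) t l : is_derive f t l -> Derive (fun s => f s) t = l.
Proof. apply is_derive_unique. Qed.

(** Near the identity the curve is written in coordinates of the second kind whose parameters vanish
    and are differentiable at t, so [loc_derive] applies. The positivity conditions of
    [local_coords] hold only near t, which suffices for a derivative. *)
Lemma chain_one g x (y1 y2 y3 y4 : R -> R) t (a1 a2 a3 a4 : R) :
  der g -> (forall d, ccont (rl d g)) -> inSU2 x ->
  (forall s, inSU2 (mk (y1 s) (y2 s) (y3 s) (y4 s))) ->
  y1 t = 1 -> y2 t = 0 -> y3 t = 0 -> y4 t = 0 ->
  is_derive y1 t a1 -> is_derive y2 t a2 -> is_derive y3 t a3 -> is_derive y4 t a4 ->
  is_derive (fun s => g (mulSU2 x (mk (y1 s) (y2 s) (y3 s) (y4 s)))) t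
    (2 * a4 * rl D1 g x + 2 * a3 * rl D2 g x + (- 2 * a2) * rl D0 g x).
Proof.
  intros Hd Hc Hx Hin Y1 Y2 Y3 Y4 A1 A2 A3 A4.
  pose (u := fun s => cU (y1 s) (y2 s) (y3 s) (y4 s)).
  pose (c := fun s => cc (y1 s) (y2 s) (y3 s) (y4 s)).
  pose (m1 := fun s => n1 (y1 s) (y2 s) (c s)).
  pose (a := fun s => 2 * atan (n4 (y3 s) (y4 s) (c s) / m1 s)).
  pose (b := fun s => 2 * atan (n3 (y3 s) (y4 s) (c s) / m1 s)).
  assert (E1 : ex_derive y1 t) by now exists a1.
  assert (E2 : ex_derive y2 t) by now exists a2.
  assert (E3 : ex_derive y3 t) by now exists a3.
  assert (E4 : ex_derive y4 t) by now exists a4.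
  assert (F1 := derive_eta _ _ _ A1). assert (F2 := derive_eta _ _ _ A2).
  assert (F3 := derive_eta _ _ _ A3). assert (F4 := derive_eta _ _ _ A4).
  assert (Ut : u t = 1) by (unfold u, cU; rewrite Y1, Y2, Y3, Y4; ring).
  assert (Ct : c t = 0).
  { unfold c, cc, cV. fold (u t). rewrite Ut, Y2, Y3.
    replace ((2 * y1 t * 0 + 2 * 0 * y4 t) / 1) with 0 by field. rewrite atan_0; ring. }
  assert (Mt : m1 t = 1).
  { unfold m1, n1. rewrite Ct, Y1, Y2. replace (0/2) with 0 by field. rewrite cos_0, sin_0; ring. }
  assert (Du : is_derive u t (2 * a1)).
  { unfold u, cU. auto_derive. repeat split; auto. rewrite F1, F2, F3, F4, Y1, Y2, Y3, Y4. ring. }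
  assert (Dc : is_derive c t (- 2 * a2)).
  { unfold c, cc. apply is_derive_ext with (fun s => - atan ((2 * y1 s * y2 s + 2 * y3 s * y4 s) / u s)).
    reflexivity.
    assert (ex_derive u t) by now exists (2 * a1).
    auto_derive. repeat split; auto; lra.
    rewrite (derive_eta _ _ _ Du), F1, F2, F3, F4, Ut, Y1, Y2, Y3, Y4. unfold Rsqr. field. }
  assert (Ec : ex_derive c t) by (eexists; apply Dc).
  assert (Fc := derive_eta _ _ _ Dc).
  assert (Z0 : 0 * / 2 = 0) by ring.
  assert (Dm : is_derive m1 t a1).
  { unfold m1, n1. auto_derive. repeat split; auto.
    rewrite F1, F2, Fc, Y1, Y2, Ct, Z0, cos_0, sin_0. field. }
  assert (Em : ex_derive m1 t) by (eexists; apply Dm).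
  assert (Fm := derive_eta _ _ _ Dm).
  assert (Da : is_derive a t (2 * a4)).
  { unfold a, n4. auto_derive. repeat split; auto; lra.
    rewrite Fm, F3, F4, Fc, Mt, Y3, Y4, Ct, Z0, cos_0, sin_0. unfold Rsqr. field. }
  assert (Db : is_derive b t (2 * a3)).
  { unfold b, n3. auto_derive. repeat split; auto; lra.
    rewrite Fm, F3, F4, Fc, Mt, Y3, Y4, Ct, Z0, cos_0, sin_0. unfold Rsqr. field. }
  assert (At : a t = 0).
  { unfold a, n4. rewrite Y3, Y4. replace ((0 * cos (c t / 2) - 0 * sin (c t / 2)) / m1 t) with 0
    by (rewrite Mt; field). rewrite atan_0; ring. }
  assert (Bt : b t = 0).
  { unfold b, n3. rewrite Y3, Y4. replace ((0 * cos (c t / 2) + 0 * sin (c t / 2)) / m1 t) with 0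
    by (rewrite Mt; field). rewrite atan_0; ring. }
  assert (Pos : forall f l, is_derive f t l -> f t = 1 -> locally t (fun s => 0 < f s)).
  { intros f l Df ft.
    assert (Cf : continuous f t).
    { apply (ex_derive_continuous (K:=R_AbsRing) (V:=R_NormedModule)). now exists l. }
    apply (Cf (fun r => 0 < r)). rewrite ft. apply (open_gt 0). lra. }
  apply is_derive_ext_loc with (fun s => g (loc x (a s) (b s) (c s))).
  - generalize (filter_and _ _ (Pos _ _ Du Ut) (Pos _ _ Dm Mt)). apply filter_imp.
    intros s [P Q]. rewrite <- (local_coords _ _ _ _ (Hin s) P Q).
    unfold loc. now rewrite !mulA, mul_one.
  - apply loc_derive; auto.
Qed.

(** Left translation by the inverse of the point at time t preserves the fields and reduces the
    claim to a curve through the identity. *)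
Lemma chain g (f1 f2 f3 f4 : R -> R) t (a1 a2 a3 a4 : R) :
  der g -> (forall d, ccont (rl d g)) ->
  (forall s, inSU2 (mk (f1 s) (f2 s) (f3 s) (f4 s))) ->
  is_derive f1 t a1 -> is_derive f2 t a2 -> is_derive f3 t a3 -> is_derive f4 t a4 ->
  is_derive (fun s => g (mk (f1 s) (f2 s) (f3 s) (f4 s))) t
    (dc1 (f1 t) (f2 t) (f3 t) (f4 t) a1 a2 a3 a4 * rl D1 g (mk (f1 t) (f2 t) (f3 t) (f4 t))
   + dc2 (f1 t) (f2 t) (f3 t) (f4 t) a1 a2 a3 a4 * rl D2 g (mk (f1 t) (f2 t) (f3 t) (f4 t))
   + dc0 (f1 t) (f2 t) (f3 t) (f4 t) a1 a2 a3 a4 * rl D0 g (mk (f1 t) (f2 t) (f3 t) (f4 t))).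
Proof.
  intros Hd Hc Hin A1 A2 A3 A4.
  set (x1 := f1 t). set (x2 := f2 t). set (x3 := f3 t). set (x4 := f4 t).
  assert (Hx : inSU2 (mk x1 x2 x3 x4)) by apply Hin.
  set (y := fun s => mulSU2 (invSU2 (mk x1 x2 x3 x4)) (mk (f1 s) (f2 s) (f3 s) (f4 s))).
  assert (Hy : forall s, inSU2 (y s)).
  { intros s. apply inSU2_mul; auto. now apply inSU2_inv. }
  assert (Ey := fun s => mul_mk x1 (- x2) (- x3) (- x4) (f1 s) (f2 s) (f3 s) (f4 s)).
  change (forall s, y s = mk (x1 * f1 s - - x2 * f2 s - (- x3 * f3 s + - x4 * f4 s))
       (x1 * f2 s + - x2 * f1 s - (- x4 * f3 s - - x3 * f4 s))
       (x1 * f3 s - - x2 * f4 s + (- x3 * f1 s + - x4 * f2 s))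
       (x1 * f4 s + - x2 * f3 s + (- x4 * f1 s - - x3 * f2 s))) in Ey.
  eapply is_derive_ext.
  2: evar_last; [apply (chain_one g (mk x1 x2 x3 x4)
     (fun s => x1 * f1 s - - x2 * f2 s - (- x3 * f3 s + - x4 * f4 s))
     (fun s => x1 * f2 s + - x2 * f1 s - (- x4 * f3 s - - x3 * f4 s))
     (fun s => x1 * f3 s - - x2 * f4 s + (- x3 * f1 s + - x4 * f2 s))
     (fun s => x1 * f4 s + - x2 * f3 s + (- x4 * f1 s - - x3 * f2 s)) t
     (x1 * a1 - - x2 * a2 - (- x3 * a3 + - x4 * a4))
     (x1 * a2 + - x2 * a1 - (- x4 * a3 - - x3 * a4))
     (x1 * a3 - - x2 * a4 + (- x3 * a1 + - x4 * a2))
     (x1 * a4 + - x2 * a3 + (- x4 * a1 - - x3 * a2)) Hd Hc Hx)|].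
  - intros s. simpl. rewrite <- Ey. unfold y. rewrite mulA, mul_inv, one_mul; auto.
  - intros s. rewrite <- Ey. apply Hy.
  - fold x1 x2 x3 x4. apply inSU2_mk in Hx. lra.
  - fold x1 x2 x3 x4. ring.
  - fold x1 x2 x3 x4. ring.
  - fold x1 x2 x3 x4. ring.
  1-4: auto_derive; [repeat split; eexists; eassumption|];
    rewrite (derive_eta _ _ _ A1), (derive_eta _ _ _ A2), (derive_eta _ _ _ A3), (derive_eta _ _ _ A4); ring.
  - unfold dc0, dc1, dc2. ring.
Qed.

(** * Calculus of smooth real functions *)

Fixpoint rD (w : list dir) (g : pt -> R) : pt -> R :=
  match w with
  | nil => g
  | d :: w' => rl d (rD w' g)
  end.

Definition rsm (g : pt -> R) : Prop := forall w, der (rD w g) /\ ccont (rD w g).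

Definition eqS {A : Type} (g h : pt -> A) : Prop := forall x, inSU2 x -> g x = h x.

Lemma eqS_sym {A} (g h : pt -> A) : eqS g h -> eqS h g.
Proof. intros E x Hx; symmetry; now apply E. Qed.
Lemma eqS_trans {A} (g h k : pt -> A) : eqS g h -> eqS h k -> eqS g k.
Proof. intros E F x Hx; rewrite E; auto. Qed.

Lemma rl_ext d g h : eqS g h -> eqS (rl d g) (rl d h).
Proof. intros E x Hx. apply Derive_ext. intros t. apply E, inSU2_mule, Hx. Qed.

Lemma rD_ext w g h : eqS g h -> eqS (rD w g) (rD w h).
Proof. intros E. induction w; simpl; auto. now apply rl_ext. Qed.

Lemma der_ext g h : eqS g h -> der g -> der h.
Proof.
  intros E H d x Hx. apply (ex_derive_ext (fun t => g (mulSU2 x (expd d t)))). 2: now apply H.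
  intros t. apply E, inSU2_mule, Hx.
Qed.

Lemma rsm_ext g h : eqS g h -> rsm g -> rsm h.
Proof.
  intros E H w. destruct (H w). split.
  - eapply der_ext. 2: eassumption. now apply rD_ext.
  - eapply ccont_ext. 2: eassumption. now apply rD_ext.
Qed.

Lemma rD_app w d g : rD w (rl d g) = rD (w ++ [d]) g.
Proof. induction w; simpl; congruence. Qed.

Lemma rsm_rl g d : rsm g -> rsm (rl d g).
Proof. intros H w. rewrite rD_app. apply H. Qed.

Lemma rsm_rD g w : rsm g -> rsm (rD w g).
Proof. intros H. induction w; simpl; auto. now apply rsm_rl. Qed.

Lemma rsm_der g : rsm g -> der g.
Proof. intros H. apply (H nil). Qed.

Lemma rsm_ccont g : rsm g -> ccont g.
Proof. intros H. apply (H nil). Qed.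

(** Coinduction principle: all orders are reached at once by exhibiting a class of differentiable
    continuous functions that each field maps into itself, up to equality on the group. It serves
    for polynomials, products and fibre averages. *)
Lemma rsm_coind (P : (pt -> R) -> Prop) :
  (forall g, P g -> der g /\ ccont g /\ forall d, exists h, P h /\ eqS (rl d g) h) ->
  forall g, P g -> rsm g.
Proof.
  intros HP g Hg w.
  assert (K : exists h, P h /\ eqS (rD w g) h).
  { induction w as [|d w IH]; simpl.
    - exists g. split; auto. intros x _; auto.
    - destruct IH as (h & Ph & E). destruct (HP h Ph) as (_ & _ & H3).
      destruct (H3 d) as (k & Pk & E'). exists k. split; auto.
      eapply eqS_trans. apply rl_ext, E. exact E'. }
  destruct K as (h & Ph & E). destruct (HP h Ph) as (H1 & H2 & _). apply eqS_sym in E.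
  split. now apply (der_ext h). now apply (ccont_ext h).
Qed.

Lemma der_const c : der (fun _ => c).
Proof. intros d x _. apply ex_derive_const. Qed.
Lemma der_plus g h : der g -> der h -> der (fun x => g x + h x).
Proof. intros H K d x Hx. apply (ex_derive_plus (K:=R_AbsRing) (V:=R_NormedModule)); auto. Qed.
Lemma der_mult g h : der g -> der h -> der (fun x => g x * h x).
Proof. intros H K d x Hx. apply (ex_derive_mult (fun t => g (mulSU2 x (expd d t))) (fun t => h (mulSU2 x (expd d t)))); auto. Qed.

Lemma rl_const d c x : rl d (fun _ => c) x = 0.
Proof. unfold rl. apply Derive_const. Qed.
Lemma rl_plus d g h x : der g -> der h -> inSU2 x ->
  rl d (fun x => g x + h x) x = rl d g x + rl d h x.
Proof. intros H K Hx. unfold rl. apply (Derive_plus (fun t => g (mulSU2 x (expd d t))) (fun t => h (mulSU2 x (expd d t)))); auto. Qed.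
Lemma rl_mult d g h x : der g -> der h -> inSU2 x ->
  rl d (fun x => g x * h x) x = rl d g x * h x + g x * rl d h x.
Proof.
  intros H K Hx. unfold rl.
  rewrite (Derive_mult (fun t => g (mulSU2 x (expd d t))) (fun t => h (mulSU2 x (expd d t)))); auto.
  now rewrite expd_0, mul_one.
Qed.
Lemma rl_scal d c g x : rl d (fun x => c * g x) x = c * rl d g x.
Proof. unfold rl. apply Derive_scal. Qed.

Lemma rl_coords d x :
  is_derive (fun t => p1 (mulSU2 x (expd d t))) 0
    (match d with D0 => p2 x / 2 | D1 => - p4 x / 2 | D2 => - p3 x / 2 end) /\
  is_derive (fun t => p2 (mulSU2 x (expd d t))) 0
    (match d with D0 => - p1 x / 2 | D1 => p3 x / 2 | D2 => - p4 x / 2 end) /\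
  is_derive (fun t => p3 (mulSU2 x (expd d t))) 0
    (match d with D0 => - p4 x / 2 | D1 => - p2 x / 2 | D2 => p1 x / 2 end) /\
  is_derive (fun t => p4 (mulSU2 x (expd d t))) 0
    (match d with D0 => p3 x / 2 | D1 => p1 x / 2 | D2 => p2 x / 2 end).
Proof.
  assert (Z0 : 0 * / 2 = 0) by ring.
  rewrite (mk_eta x). destruct d;
  refine (conj _ (conj _ (conj _ _)));
  (eapply is_derive_ext; [intros t; symmetry; rewrite (expd_mk D0) || rewrite (expd_mk D1) || rewrite (expd_mk D2); rewrite mul_mk; unfold mk, p1, p2, p3, p4; cbn [fst snd]; reflexivity|]);
  unfold mk, p1, p2, p3, p4; cbn [fst snd]; auto_derive; auto; rewrite ?Z0, ?cos_0, ?sin_0; field.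
Qed.

Inductive rpoly : (pt -> R) -> Prop :=
| rp_const c : rpoly (fun _ => c)
| rp_1 : rpoly p1
| rp_2 : rpoly p2
| rp_3 : rpoly p3
| rp_4 : rpoly p4
| rp_plus g h : rpoly g -> rpoly h -> rpoly (fun x => g x + h x)
| rp_mult g h : rpoly g -> rpoly h -> rpoly (fun x => g x * h x).

Lemma rpoly_scal c g : rpoly g -> rpoly (fun x => c * g x).
Proof. intros. apply (rp_mult (fun _ => c)); auto. apply rp_const. Qed.

Lemma rpoly_der g : rpoly g -> der g.
Proof.
  induction 1.
  - apply der_const.
  - intros d x _. eexists. exact (proj1 (rl_coords d x)).
  - intros d x _. eexists. exact (proj1 (proj2 (rl_coords d x))).
  - intros d x _. eexists. exact (proj1 (proj2 (proj2 (rl_coords d x)))).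
  - intros d x _. eexists. exact (proj2 (proj2 (proj2 (rl_coords d x)))).
  - now apply der_plus.
  - now apply der_mult.
Qed.

Lemma rpoly_ccont g : rpoly g -> ccont g.
Proof.
  induction 1.
  - apply ccont_const.
  - apply ccont_continuous, continuous_p1.
  - apply ccont_continuous, continuous_p2.
  - apply ccont_continuous, continuous_p3.
  - apply ccont_continuous, continuous_p4.
  - now apply ccont_plus.
  - now apply ccont_mult.
Qed.

Ltac coord := (split; [apply rpoly_scal; constructor|]); intros x _; unfold rl.

Lemma rpoly_rl g d : rpoly g -> exists h, rpoly h /\ eqS (rl d g) h.
Proof.
  induction 1 as [c| | | | |g h Hg (g' & Pg & Eg) Hh (h' & Ph & Eh)|g h Hg (g' & Pg & Eg) Hh (h' & Ph & Eh)].
  - exists (fun _ => 0). split. apply rp_const. intros x _. apply rl_const.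
  - destruct d; [exists (fun x => / 2 * p2 x)|exists (fun x => (- / 2) * p4 x)|exists (fun x => (- / 2) * p3 x)];
    coord; rewrite (is_derive_unique _ _ _ (proj1 (rl_coords _ x))); field.
  - destruct d; [exists (fun x => (- / 2) * p1 x)|exists (fun x => / 2 * p3 x)|exists (fun x => (- / 2) * p4 x)];
    coord; rewrite (is_derive_unique _ _ _ (proj1 (proj2 (rl_coords _ x)))); field.
  - destruct d; [exists (fun x => (- / 2) * p4 x)|exists (fun x => (- / 2) * p2 x)|exists (fun x => / 2 * p1 x)];
    coord; rewrite (is_derive_unique _ _ _ (proj1 (proj2 (proj2 (rl_coords _ x))))); field.
  - destruct d; [exists (fun x => / 2 * p3 x)|exists (fun x => / 2 * p1 x)|exists (fun x => / 2 * p2 x)];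
    coord; rewrite (is_derive_unique _ _ _ (proj2 (proj2 (proj2 (rl_coords _ x))))); field.
  - exists (fun x => g' x + h' x). split. now constructor.
    intros x Hx. rewrite rl_plus, Eg, Eh; auto using rpoly_der.
  - exists (fun x => g' x * h x + g x * h' x). split. repeat constructor; auto.
    intros x Hx. rewrite rl_mult, Eg, Eh; auto using rpoly_der.
Qed.

Lemma rsm_rpoly g : rpoly g -> rsm g.
Proof.
  revert g. apply rsm_coind. intros g Hg. repeat split.
  now apply rpoly_der. now apply rpoly_ccont. intros d. now apply rpoly_rl.
Qed.

Lemma rsm_const c : rsm (fun _ => c).
Proof. apply rsm_rpoly, rp_const. Qed.

Lemma rD_plus w g h : rsm g -> rsm h -> eqS (rD w (fun x => g x + h x)) (fun x => rD w g x + rD w h x).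
Proof.
  intros Hg Hh. induction w as [|d w IH]; simpl. intros x _; auto.
  eapply eqS_trans. apply rl_ext, IH. intros x Hx. apply rl_plus; auto; now apply rsm_der, rsm_rD.
Qed.

Lemma rsm_plus g h : rsm g -> rsm h -> rsm (fun x => g x + h x).
Proof.
  intros Hg Hh w. destruct (Hg w), (Hh w). assert (E := eqS_sym _ _ (rD_plus w _ _ Hg Hh)). split.
  eapply der_ext. apply E. now apply der_plus. eapply ccont_ext. apply E. now apply ccont_plus.
Qed.

(** Leibniz' rule leads out of the class of products but not out of their finite sums, which is what
    the coinduction needs. *)
Inductive sum_prod : (pt -> R) -> Prop :=
| sp_prod g h : rsm g -> rsm h -> sum_prod (fun x => g x * h x)
| sp_plus g h : sum_prod g -> sum_prod h -> sum_prod (fun x => g x + h x).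

Lemma rsm_mult g h : rsm g -> rsm h -> rsm (fun x => g x * h x).
Proof.
  intros Hg Hh. apply (rsm_coind sum_prod). 2: now constructor.
  assert (D : forall g, sum_prod g -> der g).
  { induction 1. apply der_mult; now apply rsm_der. now apply der_plus. }
  assert (C : forall g, sum_prod g -> ccont g).
  { induction 1. apply ccont_mult; now apply rsm_ccont. now apply ccont_plus. }
  intros k Hk. repeat split; auto. intros d. clear g h Hg Hh.
  induction Hk as [g h Hg Hh|g h Hg (g' & Pg & Eg) Hh (h' & Ph & Eh)].
  - exists (fun x => rl d g x * h x + g x * rl d h x). split.
    apply sp_plus; apply sp_prod; auto using rsm_rl.
    intros x Hx. apply rl_mult; auto using rsm_der.
  - exists (fun x => g' x + h' x). split. now constructor.
    intros x Hx. rewrite rl_plus, Eg, Eh; auto.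
Qed.

Lemma rsm_scal c g : rsm g -> rsm (fun x => c * g x).
Proof. intros H. apply (rsm_mult (fun _ => c)); auto. apply rsm_const. Qed.

Lemma rD_scal w c g x : rD w (fun x => c * g x) x = c * rD w g x.
Proof.
  revert x. induction w as [|d w IH]; simpl; auto. intros x.
  replace (rD w (fun x => c * g x)) with (fun x => c * rD w g x).
  apply rl_scal. apply functional_extensionality. intros; now rewrite IH.
Qed.

(** * Integrals depending on a parameter *)

(** Compactness of [a, b] upgrades joint convergence at each t to uniform convergence. The parameter
    is governed by an arbitrary filter so that limits taken within SU(2) are covered. *)
Lemma tube {U : Type} (F : (U -> Prop) -> Prop) {FF : Filter F} (f : U -> R -> R) (f0 : R -> R) a b :
  (forall t, a <= t <= b -> filterlim (fun q => f (fst q) (snd q)) (filter_prod F (locally t)) (locally (f0 t))) ->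
  (forall t, a <= t <= b -> continuous f0 t) ->
  forall e, 0 < e -> F (fun p => forall s, a <= s <= b -> Rabs (f p s - f0 s) < e).
Proof.
  intros H H0 e He.
  assert (K : forall t, a <= t <= b -> exists del : posreal, F (fun p => forall s, Rabs (s - t) < del -> a <= s <= b -> Rabs (f p s - f0 s) < e)).
  { intros t Ht. assert (He2 : 0 < e / 2) by lra.
    assert (H1 := proj1 (filterlim_locally _ _) (H t Ht) (mkposreal _ He2)).
    assert (H2 := proj1 (filterlim_locally _ _) (H0 t Ht) (mkposreal _ He2)).
    destruct H1 as [Q S HQ [d1 Hd1] HP]. destruct H2 as [d2 Hd2].
    exists (mkposreal _ (Rmin_pos _ _ (cond_pos d1) (cond_pos d2))). simpl.
    apply (filter_imp (F:=F) Q); [|exact HQ]. intros p Hp s Hs Hab.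
    assert (X1 := HP p s Hp (Hd1 s (Rlt_le_trans _ _ _ Hs (Rmin_l _ _)))).
    assert (X2 := Hd2 s (Rlt_le_trans _ _ _ Hs (Rmin_r _ _))).
    simpl in X1, X2. unfold ball in X1, X2; simpl in X1, X2.
    unfold AbsRing_ball, abs, minus, plus, opp in X1, X2; simpl in X1, X2.
    apply Rabs_lt_between in X1. apply Rabs_lt_between in X2. apply Rabs_lt_between. lra. }
  (* The cover asks for a radius at every real t; outside [a, b] the value 1 is arbitrary. *)
  assert (K' : forall t, exists del : posreal, a <= t <= b -> F (fun p => forall s, Rabs (s - t) < del -> a <= s <= b -> Rabs (f p s - f0 s) < e)).
  { intros t. destruct (excluded_middle_informative (a <= t <= b)) as [Ht|Ht].
    destruct (K t Ht) as [d Hd]. now exists d. exists (mkposreal 1 Rlt_0_1). tauto. }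
  pose (delta := fun t => proj1_sig (constructive_indefinite_description _ (K' t))).
  assert (Hdelta : forall t, a <= t <= b -> F (fun p => forall s, Rabs (s - t) < delta t -> a <= s <= b -> Rabs (f p s - f0 s) < e)).
  { intros t. apply (proj2_sig (constructive_indefinite_description _ (K' t))). }
  (* [compactness_list] yields the finite cover only under a double negation. *)
  apply Classical_Prop.NNPP. intros N.
  refine (compactness_list 1 (a, tt) (b, tt) (fun t => delta (fst t)) _). intros [l Hl]. apply N.
  assert (FL : F (fun p => forall t, In t l -> a <= fst t <= b -> forall s, Rabs (s - fst t) < delta (fst t) -> a <= s <= b -> Rabs (f p s - f0 s) < e)).
  { clear - Hdelta FF. induction l as [|t l IH].
    - apply (filter_imp (F:=F) (fun _ => True)). 2: apply filter_true. intros ? _ ? [].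
    - destruct (excluded_middle_informative (a <= fst t <= b)) as [Ht|Ht].
      + generalize (filter_and (F:=F) _ _ IH (Hdelta _ Ht)). apply (filter_imp (F:=F)).
        intros p [X Y] u [<-|Hu]; [intros _; exact Y|exact (X u Hu)].
      + refine (filter_imp (F:=F) _ _ _ IH). intros p X u [<-|Hu]; [intros; tauto|exact (X u Hu)]. }
  refine (filter_imp (F:=F) _ _ _ FL). intros p Hp s Hs.
  destruct (Hl (s, tt)) as (t & Ht & Hb & Hc). simpl; auto.
  destruct t as [t []]. simpl in Hb, Hc. apply (Hp (t, tt)); simpl; tauto.
Qed.

Lemma filterlim_RInt_param {U : Type} (F : (U -> Prop) -> Prop) {FF : Filter F} (f : U -> R -> R) (f0 : R -> R) a b :
  a <= b ->
  F (fun p => ex_RInt (f p) a b) ->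
  (forall t, a <= t <= b -> filterlim (fun q => f (fst q) (snd q)) (filter_prod F (locally t)) (locally (f0 t))) ->
  (forall t, a <= t <= b -> continuous f0 t) ->
  filterlim (fun p => RInt (f p) a b) F (locally (RInt f0 a b)).
Proof.
  intros Hab Hex H H0. apply filterlim_locally. intros eps.
  set (e := eps / (2 * (b - a + 1))).
  assert (He : 0 < e) by (apply Rdiv_lt_0_compat; [apply cond_pos|lra]).
  assert (I0 : ex_RInt f0 a b).
  { apply (ex_RInt_continuous (V:=R_CompleteNormedModule)). intros z. rewrite Rmin_left, Rmax_right; auto. }
  generalize (filter_and (F:=F) _ _ Hex (tube F f f0 a b H H0 e He)).
  apply (filter_imp (F:=F)). intros p [Ep Hp].
  change (Rabs (RInt (f p) a b - RInt f0 a b) < eps).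
  replace (RInt (f p) a b - RInt f0 a b) with (RInt (fun t => f p t - f0 t) a b)
    by exact (RInt_minus (V:=R_CompleteNormedModule) (f p) f0 a b Ep I0).
  apply Rle_lt_trans with ((b - a) * e).
  - apply abs_RInt_le_const; auto. now apply (ex_RInt_minus (V:=R_NormedModule)).
    intros t Ht. left. now apply Hp.
  - assert (e * (b - a + 1) = eps / 2) by (unfold e; field; lra).
    destruct eps as [eps Peps]; simpl in *. nra.
Qed.

Lemma filter_prod_locally {U V : UniformSpace} (p : U) (q : V) P :
  locally (p, q) P -> filter_prod (locally p) (locally q) P.
Proof.
  intros [d Hd]. apply Filter_prod with (fun y => ball p d y) (fun y => ball q d y).
  now exists d. now exists d. intros x y Hx Hy. apply Hd. now split.
Qed.

Lemma continuous_RInt_param {U : UniformSpace} (f : U -> R -> R) a b p :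
  a <= b ->
  (forall p t, continuous (fun q : U * R => f (fst q) (snd q)) (p, t)) ->
  continuous (fun p => RInt (f p) a b) p.
Proof.
  intros Hab H.
  assert (S : forall p t, continuous (f p) t).
  { intros p' t. apply (continuous_comp (fun t => (p', t)) (fun q : U * R => f (fst q) (snd q))). 2: apply H.
    apply filterlim_locally. intros eps. exists eps. intros y Hy. split; auto. apply ball_center. }
  apply (filterlim_RInt_param (locally p) f (f p)); auto.
  - apply filter_forall. intros x. apply (ex_RInt_continuous (V:=R_CompleteNormedModule)). intros; apply S.
  - intros t Ht P HP. apply filter_prod_locally. now apply H.
Qed.

Lemma is_derive_RInt_param' (f f' : R -> R -> R) a b x :
  (forall u t, is_derive (fun u => f u t) u (f' u t)) ->
  (forall u t, continuous (fun q : R * R => f' (fst q) (snd q)) (u, t)) ->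
  (forall u t, continuous (fun t => f u t) t) ->
  is_derive (fun u => RInt (f u) a b) x (RInt (f' x) a b).
Proof.
  intros H1 H2 H3.
  assert (E : forall u t, Derive (fun u => f u t) u = f' u t) by (intros; now apply is_derive_unique).
  replace (RInt (f' x) a b) with (RInt (fun t => Derive (fun u => f u t) x) a b).
  apply is_derive_RInt_param.
  - apply filter_forall. intros u t _. now exists (f' u t).
  - intros t _. apply continuity_2d_pt_ext with f'. intros; now rewrite E.
    apply continuity_2d_pt_filterlim. apply H2.
  - apply filter_forall. intros u. apply (ex_RInt_continuous (V:=R_CompleteNormedModule)). auto.
  - apply RInt_ext. intros; apply E.
Qed.

Lemma ex_RInt_cont (f : R -> R) a b : (forall t, continuous f t) -> ex_RInt f a b.
Proof. intros H. apply (ex_RInt_continuous (V:=R_CompleteNormedModule)). auto. Qed.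

Lemma RIntR_ext (f g : R -> R) a b : (forall t, Rmin a b < t < Rmax a b -> f t = g t) ->
  RInt f a b = RInt g a b.
Proof. apply (RInt_ext (V:=R_CompleteNormedModule)). Qed.

Lemma RIntR_plus (f g : R -> R) a b : (forall t, continuous f t) -> (forall t, continuous g t) ->
  RInt (fun t => f t + g t) a b = RInt f a b + RInt g a b.
Proof. intros F G. apply (RInt_plus (V:=R_CompleteNormedModule)); now apply ex_RInt_cont. Qed.

Lemma RIntR_scal k (f : R -> R) a b : (forall t, continuous f t) ->
  RInt (fun t => k * f t) a b = k * RInt f a b.
Proof. intros F. apply (RInt_scal (V:=R_CompleteNormedModule)). now apply ex_RInt_cont. Qed.

Lemma der_continuous (f : R -> R) t l : is_derive f t l -> continuous f t.
Proof. intros H. apply (ex_derive_continuous (K:=R_AbsRing) (V:=R_NormedModule)). now exists l. Qed.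

(* Coefficients of Ad(exp(-tY_0)) Y_d on Y_1, Y_2, Y_0. *)
Definition k1 d t := match d with D0 => 0 | D1 => cos t | D2 => sin t end.
Definition k2 d t := match d with D0 => 0 | D1 => - sin t | D2 => cos t end.
Definition k0 d (t : R) := match d with D0 => 1 | _ => 0 end.

Lemma k1_cont d t : continuous (k1 d) t.
Proof. destruct d; unfold k1; ctac. Qed.
Lemma k2_cont d t : continuous (k2 d) t.
Proof. destruct d; unfold k2; ctac. Qed.
Lemma k0_cont d t : continuous (k0 d) t.
Proof. destruct d; unfold k0; ctac. Qed.

Lemma k_bound d t : Rabs (k1 d t) <= 1 /\ Rabs (k2 d t) <= 1 /\ Rabs (k0 d t) <= 1.
Proof.
  generalize (COS_bound t) (SIN_bound t). intros.
  destruct d; unfold k1, k2, k0; repeat split; apply Rabs_le; lra.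
Qed.

(** The last factor is exp(-tY_0) exp(sY_d) exp(tY_0), the one-parameter group of Ad(exp(-tY_0))
    Y_d: the fields Y_1 and Y_2 turn by the angle t in their plane. *)
Lemma conj_expd d s t : mulSU2 (expd d s) (expd D0 t) =
  mulSU2 (expd D0 t) match d with
   | D0 => mk (cos (s / 2)) (- sin (s / 2)) 0 0
   | D1 => mk (cos (s / 2)) 0 (- (sin (s / 2) * sin t)) (sin (s / 2) * cos t)
   | D2 => mk (cos (s / 2)) 0 (sin (s / 2) * cos t) (sin (s / 2) * sin t) end.
Proof.
  replace t with (2 * (t / 2)) by field. replace (2 * (t / 2) / 2) with (t / 2) by field.
  rewrite sin_2a, cos_2a. rewrite !expd_mk. replace (2 * (t / 2) / 2) with (t / 2) by field.
  generalize (cs1 (t / 2)). generalize (cos (t / 2)) (sin (t / 2)). intros c i H.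
  assert (Hc : forall u v, u * (c * c + i * i) = v -> u = v) by (intros u v <-; rewrite H; ring).
  assert (Hi : c * c = 1 - i * i) by lra.
  destruct d; rewrite !mul_mk; apply mk_eq; try ring.
  all: symmetry; apply Rminus_diag_uniq; ring_simplify; try ring [Hi].
  all: replace (c ^ 3) with (c * (1 - i * i)) by (rewrite <- Hi; ring);
       replace (c ^ 2) with (1 - i * i) by (rewrite <- Hi; ring); ring.
Qed.

(** Translation along the fibre does not commute with Y_1 and Y_2, and the rotated subgroup is in
    general none of those in [expd]. The chain rule for curves expresses the derivative in the frame
    at the translated point, with coefficients bounded in t. *)
Lemma rot_derive g x d s t : rsm g -> inSU2 x ->
  is_derive (fun s => g (mulSU2 (mulSU2 x (expd d s)) (expd D0 t))) s
   (k1 d t * rl D1 g (mulSU2 (mulSU2 x (expd d s)) (expd D0 t))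
    + k2 d t * rl D2 g (mulSU2 (mulSU2 x (expd d s)) (expd D0 t))
    + k0 d t * rl D0 g (mulSU2 (mulSU2 x (expd d s)) (expd D0 t))).
Proof.
  intros Hg Hx.
  assert (Hd := rsm_der _ Hg). assert (Hc : forall d, ccont (rl d g)) by (intros; now apply rsm_ccont, rsm_rl).
  set (y := mulSU2 (mulSU2 x (expd d s)) (expd D0 t)).
  assert (Hy : inSU2 y) by (unfold y; now repeat apply inSU2_mule).
  pose (f1 := fun u => cos ((u - s) / 2)).
  pose (f2 := fun u => match d with D0 => - sin ((u - s) / 2) | _ => 0 end).
  pose (f3 := fun u => match d with D0 => 0 | D1 => - (sin ((u - s) / 2) * sin t) | D2 => sin ((u - s) / 2) * cos t end).
  pose (f4 := fun u => match d with D0 => 0 | D1 => sin ((u - s) / 2) * cos t | D2 => sin ((u - s) / 2) * sin t end).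
  assert (Z : (s - s) / 2 = 0) by field. assert (Z' : (s + - s) * / 2 = 0) by field.
  apply is_derive_ext with (fun u => g (mulSU2 y (mk (f1 u) (f2 u) (f3 u) (f4 u)))).
  - intros u. f_equal. unfold y. replace u with (s + (u - s)) at 5 by ring.
    rewrite <- (expd_plus d s (u - s)), <- !mulA, conj_expd. destruct d; reflexivity.
  - evar_last. apply (chain_one g y f1 f2 f3 f4 s 0 (match d with D0 => - / 2 | _ => 0 end)
     (match d with D0 => 0 | D1 => - (sin t / 2) | D2 => cos t / 2 end)
     (match d with D0 => 0 | D1 => cos t / 2 | D2 => sin t / 2 end)); auto.
    + intros u. unfold f1, f2, f3, f4. generalize (cs1 ((u - s) / 2)) (cs1 t).
      generalize (cos ((u - s) / 2)) (sin ((u - s) / 2)) (cos t) (sin t). intros a b c e H1 H2.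
      destruct d; apply inSU2_mk.
      lra.
      transitivity (a * a + b * b * (c * c + e * e)). ring. rewrite H2; lra.
      transitivity (a * a + b * b * (c * c + e * e)). ring. rewrite H2; lra.
    + unfold f1. now rewrite Z, cos_0.
    + unfold f2. destruct d; rewrite ?Z, ?sin_0; ring.
    + unfold f3. destruct d; rewrite ?Z, ?sin_0; ring.
    + unfold f4. destruct d; rewrite ?Z, ?sin_0; ring.
    + unfold f1. auto_derive; auto. rewrite Z', sin_0. field.
    + unfold f2. destruct d; auto_derive; auto; rewrite ?Z', ?cos_0; field.
    + unfold f3. destruct d; auto_derive; auto; rewrite ?Z', ?cos_0; field.
    + unfold f4. destruct d; auto_derive; auto; rewrite ?Z', ?cos_0; field.
    + fold y. unfold k1, k2, k0. destruct d; field.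
Qed.

(** * Weighted averages along the orbits of exp(tY_0) *)

Definition Aop (om : R -> R) (g : pt -> R) : pt -> R :=
  fun x => RInt (fun t => om t * g (mulSU2 x (expd D0 t))) 0 (4 * PI).

Lemma PI4 : 0 <= 4 * PI.
Proof. generalize PI_RGT_0; lra. Qed.

Lemma orbit_cont g x t : ccont g -> inSU2 x -> continuous (fun t => g (mulSU2 x (expd D0 t))) t.
Proof. intros Hg Hx. apply ccont_comp; auto. intros; now apply inSU2_mule. ptac. Qed.

Lemma Aop_cont (om : R -> R) g x t : (forall t, continuous om t) -> ccont g -> inSU2 x ->
  continuous (fun t => om t * g (mulSU2 x (expd D0 t))) t.
Proof. intros Ho Hg Hx. apply Rcont_mult; auto. now apply orbit_cont. Qed.

Ltac acont := intros; repeat apply Rcont_plus;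
  match goal with
  |- continuous (fun t => @?o t * ?g (mulSU2 ?x (expd D0 t))) _ => apply (Aop_cont o g)
  end; [intros; try apply Rcont_mult|..].

Lemma Aop_ext (om : R -> R) g h : eqS g h -> eqS (Aop om g) (Aop om h).
Proof. intros E x Hx. apply RIntR_ext. intros t _. rewrite E; auto. now apply inSU2_mule. Qed.

Lemma Aop_ext_om (om om' : R -> R) g x : (forall t, 0 <= t <= 4 * PI -> om t = om' t) -> Aop om g x = Aop om' g x.
Proof.
  intros E. apply RIntR_ext. intros t. rewrite Rmin_left, Rmax_right by apply PI4.
  intros Ht. rewrite E; auto; lra.
Qed.

Lemma Aop_plus (om : R -> R) g h x : (forall t, continuous om t) -> ccont g -> ccont h -> inSU2 x ->
  Aop om (fun x => g x + h x) x = Aop om g x + Aop om h x.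
Proof.
  intros Ho Hg Hh Hx. unfold Aop. rewrite <- RIntR_plus; try (intros; now apply Aop_cont).
  apply RIntR_ext. intros; ring.
Qed.

Lemma Aop_scal (om : R -> R) c g x : (forall t, continuous om t) -> ccont g -> inSU2 x ->
  Aop om (fun x => c * g x) x = c * Aop om g x.
Proof.
  intros Ho Hg Hx. unfold Aop. rewrite <- RIntR_scal; try (intros; now apply Aop_cont).
  apply RIntR_ext. intros; ring.
Qed.

Lemma Aop_om_scal (om : R -> R) c g x : (forall t, continuous om t) -> ccont g -> inSU2 x ->
  Aop (fun t => c * om t) g x = c * Aop om g x.
Proof.
  intros Ho Hg Hx. unfold Aop. rewrite <- RIntR_scal; try (intros; now apply Aop_cont).
  apply RIntR_ext. intros; ring.
Qed.

Lemma Aop_om_plus (om om' : R -> R) g x : (forall t, continuous om t) -> (forall t, continuous om' t) -> ccont g -> inSU2 x ->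
  Aop (fun t => om t + om' t) g x = Aop om g x + Aop om' g x.
Proof.
  intros Ho Ho' Hg Hx. unfold Aop. rewrite <- RIntR_plus; try (intros; now apply Aop_cont).
  apply RIntR_ext. intros; ring.
Qed.

Lemma Aop_bound (om : R -> R) g x B M : (forall t, continuous om t) -> ccont g -> inSU2 x ->
  (forall t, 0 <= t <= 4 * PI -> Rabs (om t) <= B) -> (forall x, inSU2 x -> Rabs (g x) <= M) ->
  Rabs (Aop om g x) <= 4 * PI * (B * M).
Proof.
  intros Ho Hg Hx HB HM. unfold Aop. generalize PI4; intros HP.
  replace (4 * PI) with (4 * PI - 0) at 2 by ring.
  apply abs_RInt_le_const; auto. apply ex_RInt_cont. intros; now apply Aop_cont.
  intros t Ht. rewrite Rabs_mult.
  apply Rmult_le_compat; auto using Rabs_pos. apply HM, inSU2_mule, Hx.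
Qed.

Lemma Aop_ccont (om : R -> R) g : (forall t, continuous om t) -> ccont g -> ccont (Aop om g).
Proof.
  intros Ho Hg x Hx.
  apply (filterlim_RInt_param (within inSU2 (locally x))
    (fun x t => om t * g (mulSU2 x (expd D0 t))) (fun t => om t * g (mulSU2 x (expd D0 t)))).
  - apply PI4.
  - unfold within. apply filter_forall. intros y Hy. apply ex_RInt_cont. intros; now apply Aop_cont.
  - intros t _. eapply filterlim_comp_2. 3: apply (filterlim_mult (K := R_AbsRing)).
    + apply (filterlim_comp _ _ _ snd om _ (locally t)). apply filterlim_snd. apply Ho.
    + apply (filterlim_comp _ _ _ (fun q => mulSU2 (fst q) (expd D0 (snd q))) g _ (within inSU2 (locally (mulSU2 x (expd D0 t))))).
      2: now apply Hg, inSU2_mule.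
      intros P HP. unfold within in HP.
      assert (C : continuous (fun q : pt * R => mulSU2 (fst q) (expd D0 (snd q))) (x, t)) by ptac.
      apply C in HP. apply filter_prod_locally in HP. destruct HP as [Q S HQ HS HP].
      apply Filter_prod with (fun y => inSU2 y /\ Q y) S; auto.
      * unfold within. revert HQ. apply filter_imp. auto.
      * intros y s [Hy HQy] Hs. unfold filtermap in *. apply HP; auto. now apply inSU2_mule.
  - intros; now apply Aop_cont.
Qed.

Lemma Aop_derive (om : R -> R) g x d s : (forall t, continuous om t) -> rsm g -> inSU2 x ->
  is_derive (fun s => Aop om g (mulSU2 x (expd d s))) s
   (Aop (fun t => om t * k1 d t) (rl D1 g) (mulSU2 x (expd d s))
    + Aop (fun t => om t * k2 d t) (rl D2 g) (mulSU2 x (expd d s))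
    + Aop (fun t => om t * k0 d t) (rl D0 g) (mulSU2 x (expd d s))).
Proof.
  intros Ho Hg Hx.
  assert (Hc : forall d, ccont (rl d g)) by (intros; now apply rsm_ccont, rsm_rl).
  assert (Oc : forall k, (forall t, continuous k t) -> forall t, continuous (fun t => om t * k t) t).
  { intros k Hk t. now apply Rcont_mult. }
  set (f' := fun s t => om t * (k1 d t * rl D1 g (mulSU2 (mulSU2 x (expd d s)) (expd D0 t))
    + k2 d t * rl D2 g (mulSU2 (mulSU2 x (expd d s)) (expd D0 t))
    + k0 d t * rl D0 g (mulSU2 (mulSU2 x (expd d s)) (expd D0 t)))).
  evar_last.
  - apply (is_derive_RInt_param' (fun s t => om t * g (mulSU2 (mulSU2 x (expd d s)) (expd D0 t))) f').
    + intros u t. apply (is_derive_scal (fun u => g (mulSU2 (mulSU2 x (expd d u)) (expd D0 t)))).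
      now apply rot_derive.
    + intros u t. unfold f'.
      assert (L : forall k : R -> R, (forall t, continuous k t) -> continuous (fun q : R * R => k (snd q)) (u, t)).
      { intros k Hk. apply (continuous_comp snd k). apply continuous_snd. apply Hk. }
      assert (J : forall d', continuous (fun q : R * R => rl d' g (mulSU2 (mulSU2 x (expd d (fst q))) (expd D0 (snd q)))) (u, t)).
      { intros d'. apply ccont_comp; auto. intros; now repeat apply inSU2_mule. ptac. }
      apply Rcont_mult. now apply (L om).
      repeat apply Rcont_plus; apply Rcont_mult; auto; [apply (L (k1 d))|apply (L (k2 d))|apply (L (k0 d))];
      intros; auto using k1_cont, k2_cont, k0_cont.
    + intros u t. apply Aop_cont; auto. now apply rsm_ccont. now apply inSU2_mule.
  - unfold Aop, f'. rewrite <- !RIntR_plus.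
    { apply RIntR_ext. intros; ring. }
    all: acont; auto using k1_cont, k2_cont, k0_cont, inSU2_mule.
Qed.

Lemma rl_Aop (om : R -> R) g x d : (forall t, continuous om t) -> rsm g -> inSU2 x ->
  rl d (Aop om g) x = Aop (fun t => om t * k1 d t) (rl D1 g) x
    + Aop (fun t => om t * k2 d t) (rl D2 g) x + Aop (fun t => om t * k0 d t) (rl D0 g) x.
Proof.
  intros Ho Hg Hx. assert (U := is_derive_unique _ _ _ (Aop_derive om g x d 0 Ho Hg Hx)).
  rewrite expd_0, mul_one in U. exact U.
Qed.

(** The functions met when [Aop om g] is differentiated n times: sums of averages of derivatives of
    g of order n. The real index adds up the bounds of the weights and feeds the estimate in
    [av_bound]. *)
Inductive av (g : pt -> R) : nat -> R -> (pt -> R) -> Prop :=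
| av_b (om : R -> R) w B : (forall t, continuous om t) -> (forall t, 0 <= t <= 4 * PI -> Rabs (om t) <= B) ->
    av g (length w) B (Aop om (rD w g))
| av_p n B C h k : av g n B h -> av g n C k -> av g n (B + C) (fun x => h x + k x).

Lemma av_der g n B h : rsm g -> av g n B h -> der h.
Proof.
  intros Hg. induction 1. 2: now apply der_plus.
  intros d x Hx. eexists. apply Aop_derive; auto. now apply rsm_rD.
Qed.

Lemma av_ccont g n B h : rsm g -> av g n B h -> ccont h.
Proof.
  intros Hg. induction 1. 2: now apply ccont_plus.
  apply Aop_ccont; auto. now apply rsm_ccont, rsm_rD.
Qed.

(** Each average becomes three averages whose weights are multiplied by coefficients of modulus at
    most 1, hence the factor 3 per derivative. *)
Lemma av_rl g n B h d : rsm g -> av g n B h -> exists k, av g (S n) (3 * B) k /\ eqS (rl d h) k.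
Proof.
  intros Hg. induction 1 as [om w B Ho HB|n B C h k Hh (h' & Ph & Eh) Hk (k' & Pk & Ek)].
  - exists (fun x => (Aop (fun t => om t * k1 d t) (rl D1 (rD w g)) x
    + Aop (fun t => om t * k2 d t) (rl D2 (rD w g)) x)
    + Aop (fun t => om t * k0 d t) (rl D0 (rD w g)) x). split.
    + assert (M : forall k, (forall t, Rabs (k t) <= 1) -> forall t, 0 <= t <= 4 * PI -> Rabs (om t * k t) <= B).
      { intros k Hk t Ht. rewrite Rabs_mult. rewrite <- (Rmult_1_r B).
        apply Rmult_le_compat; auto using Rabs_pos. }
      replace (3 * B) with ((B + B) + B) by ring.
      repeat apply av_p.
      * apply (av_b g (fun t => om t * k1 d t) (D1 :: w)).
        intros; apply Rcont_mult; auto using k1_cont. apply M. intros; apply k_bound.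
      * apply (av_b g (fun t => om t * k2 d t) (D2 :: w)).
        intros; apply Rcont_mult; auto using k2_cont. apply M. intros; apply k_bound.
      * apply (av_b g (fun t => om t * k0 d t) (D0 :: w)).
        intros; apply Rcont_mult; auto using k0_cont. apply M. intros; apply k_bound.
    + intros x Hx. apply rl_Aop; auto. now apply rsm_rD.
  - exists (fun x => h' x + k' x). split. replace (3 * (B + C)) with (3 * B + 3 * C) by ring. now constructor.
    intros x Hx. rewrite rl_plus, Eh, Ek; eauto using av_der.
Qed.

Lemma bounded_on (f : R -> R) : (forall t, continuous f t) -> exists B, forall t, 0 <= t <= 4 * PI -> Rabs (f t) <= B.
Proof.
  intros Ho.
  destruct (continuity_ab_maj f 0 (4 * PI) PI4) as (M & HM & _).
  { intros t _. apply continuity_pt_filterlim. apply Ho. }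
  destruct (continuity_ab_min f 0 (4 * PI) PI4) as (m & Hm & _).
  { intros t _. apply continuity_pt_filterlim. apply Ho. }
  exists (Rabs (f M) + Rabs (f m)). intros t Ht. specialize (HM t Ht). specialize (Hm t Ht).
  apply Rabs_le. generalize (Rle_abs (f M)) (Rle_abs (- f m)) (Rabs_pos (f m)) (Rabs_pos (f M)).
  rewrite Rabs_Ropp. lra.
Qed.

Lemma rsm_Aop (om : R -> R) g : (forall t, continuous om t) -> rsm g -> rsm (Aop om g).
Proof.
  intros Ho Hg. apply (rsm_coind (fun h => exists n B, av g n B h)).
  - intros h (n & B & H). repeat split. eapply av_der; eauto. eapply av_ccont; eauto.
    intros d. destruct (av_rl g n B h d Hg H) as (k & Hk & E). eauto 7.
  - destruct (bounded_on om Ho) as [B HB].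
    exists 0%nat, B. now apply (av_b g om nil).
Qed.

Lemma av_bound g n B M h : rsm g -> av g n B h ->
  (forall v, length v = n -> forall x, inSU2 x -> Rabs (rD v g x) <= M) ->
  forall x, inSU2 x -> Rabs (h x) <= 4 * PI * (B * M).
Proof.
  intros Hg. induction 1 as [om w B Ho HB|n B C h k Hh IHh Hk IHk]; intros HM x Hx.
  - apply Aop_bound; auto. now apply rsm_ccont, rsm_rD.
  - specialize (IHh HM x Hx). specialize (IHk HM x Hx).
    eapply Rle_trans. apply Rabs_triang. lra.
Qed.

Lemma Aop_semibound (om : R -> R) B w : (forall t, continuous om t) ->
  (forall t, 0 <= t <= 4 * PI -> Rabs (om t) <= B) ->
  forall g M, rsm g -> (forall v, length v = length w -> forall x, inSU2 x -> Rabs (rD v g x) <= M) ->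
  forall x, inSU2 x -> Rabs (rD w (Aop om g) x) <= 4 * PI * (3 ^ length w * B * M).
Proof.
  intros Ho HB g M Hg HM.
  assert (K : exists h, av g (length w) (3 ^ length w * B) h /\ eqS (rD w (Aop om g)) h).
  { clear M HM. induction w as [|d w (h & Ph & E)].
    - exists (Aop om g). split. simpl. rewrite Rmult_1_l. now apply (av_b g om nil). intros x _; auto.
    - destruct (av_rl g _ _ h d Hg Ph) as (k & Pk & Ek). exists k. split.
      simpl. now rewrite Rmult_assoc. simpl. eapply eqS_trans. apply rl_ext, E. auto. }
  destruct K as (h & Ph & E). intros x Hx. rewrite E by auto. now apply (av_bound g (length w)).
Qed.

Lemma rl0_Aop (om : R -> R) g : (forall t, continuous om t) -> rsm g -> eqS (rl D0 (Aop om g)) (Aop om (rl D0 g)).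
Proof.
  intros Ho Hg x Hx. rewrite rl_Aop by auto. simpl.
  assert (Hc : forall d, ccont (rl d g)) by (intros; now apply rsm_ccont, rsm_rl).
  unfold Aop. rewrite <- !RIntR_plus.
  { apply RIntR_ext. intros; ring. }
  all: acont; auto; intros; ctac; auto.
Qed.

Lemma expd_period : expd D0 (4 * PI) = one.
Proof.
  rewrite expd_mk. replace (4 * PI / 2) with (2 * PI) by field.
  rewrite cos_2PI, sin_2PI. unfold one. apply mk_eq; ring.
Qed.

(** Both boundary terms are values at x because exp(4 pi Y_0) = 1. Inverting a first-order operator
    along the fibre thus amounts to finding a weight with prescribed derivative and prescribed jump
    om(4 pi) - om(0). *)
Lemma Aop_ibp (om om' : R -> R) g x : (forall t, is_derive om t (om' t)) -> (forall t, continuous om' t) ->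
  rsm g -> inSU2 x ->
  Aop om (rl D0 g) x = (om (4 * PI) - om 0) * g x - Aop om' g x.
Proof.
  intros D C Hg Hx.
  assert (Co : forall t, continuous om t) by (intros t; exact (der_continuous _ _ _ (D t))).
  assert (H := is_RInt_derive (V:=R_CompleteNormedModule) (fun t => om t * g (mulSU2 x (expd D0 t)))
    (fun t => om' t * g (mulSU2 x (expd D0 t)) + om t * rl D0 g (mulSU2 x (expd D0 t))) 0 (4 * PI)).
  assert (Cg := rsm_ccont _ Hg). assert (Cg' := rsm_ccont _ (rsm_rl _ D0 Hg)).
  lapply H. clear H; intros H; lapply H. clear H; intros H.
  - apply is_RInt_unique in H. rewrite RIntR_plus in H by (intros; now apply Aop_cont).
    fold (Aop om' g x) in H. fold (Aop om (rl D0 g) x) in H.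
    rewrite expd_period, expd_0, mul_one in H.
    change (minus ?a ?b) with (a - b) in H. lra.
  - intros t _. apply Rcont_plus; now apply Aop_cont.
  - intros t _. apply (is_derive_mult om (fun t => g (mulSU2 x (expd D0 t))) t); auto.
    apply der_along; auto. now apply rsm_der.
    intros; apply Rmult_comm.
Qed.

(** * Integration over SU(2) *)

Definition C3 (F : R -> R -> R -> R) : Prop :=
  forall p : R * R * R, continuous (fun q : R * R * R => F (fst (fst q)) (snd (fst q)) (snd q)) p.

Lemma continuous_pair {T U V : UniformSpace} (f : T -> U) (g : T -> V) p :
  continuous f p -> continuous g p -> continuous (fun t => (f t, g t)) p.
Proof.
  intros H1 H2. apply filterlim_locally. intros eps.
  apply filterlim_locally with (eps := eps) in H1.
  apply filterlim_locally with (eps := eps) in H2.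
  generalize (filter_and _ _ H1 H2). apply filter_imp. intros y [? ?]. now split.
Qed.

Lemma C3_comp {T : UniformSpace} F (a b c : T -> R) p : C3 F ->
  continuous a p -> continuous b p -> continuous c p -> continuous (fun t => F (a t) (b t) (c t)) p.
Proof.
  intros HF Ha Hb Hc.
  apply (continuous_comp (fun t => ((a t, b t), c t)) (fun q : R * R * R => F (fst (fst q)) (snd (fst q)) (snd q))).
  - apply continuous_pair; auto. now apply continuous_pair.
  - apply HF.
Qed.

Definition J2 (F : R -> R -> R -> R) (th al : R) : R := RInt (fun be => F th al be) 0 (2 * PI).
Definition J1 (F : R -> R -> R -> R) (th : R) : R := RInt (fun al => J2 F th al) 0 (2 * PI).
Definition J (F : R -> R -> R -> R) : R := RInt (fun th => J1 F th) 0 (PI / 2).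

Lemma PI2p : 0 <= 2 * PI.
Proof. generalize PI_RGT_0; lra. Qed.
Lemma PIh : 0 <= PI / 2.
Proof. generalize PI_RGT_0; lra. Qed.

Lemma J2_cont F : C3 F -> forall p : R * R, continuous (fun q : R * R => J2 F (fst q) (snd q)) p.
Proof.
  intros HF p. unfold J2. apply (continuous_RInt_param (fun q be => F (fst q) (snd q) be)). apply PI2p.
  intros q t. apply C3_comp; auto; ctac.
Qed.

Lemma J2_comp {T : UniformSpace} F (a b : T -> R) p : C3 F -> continuous a p -> continuous b p ->
  continuous (fun t => J2 F (a t) (b t)) p.
Proof.
  intros HF Ha Hb. apply (continuous_comp (fun t => (a t, b t)) (fun q : R * R => J2 F (fst q) (snd q))).
  now apply continuous_pair. now apply J2_cont.
Qed.

Lemma J1_cont F th : C3 F -> continuous (J1 F) th.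
Proof.
  intros HF. unfold J1. apply (continuous_RInt_param (J2 F)). apply PI2p.
  intros q t. apply J2_comp; auto; ctac.
Qed.

Lemma J_plus F G : C3 F -> C3 G -> J (fun a b c => F a b c + G a b c) = J F + J G.
Proof.
  intros HF HG. unfold J. rewrite <- RIntR_plus by (intros; now apply J1_cont).
  apply RIntR_ext. intros th _. unfold J1. rewrite <- RIntR_plus by (intros; apply J2_comp; auto; ctac).
  apply RIntR_ext. intros al _. unfold J2. apply RIntR_plus; intros; apply C3_comp; auto; ctac.
Qed.

Lemma J_scal k F : C3 F -> J (fun a b c => k * F a b c) = k * J F.
Proof.
  intros HF. unfold J. rewrite <- RIntR_scal by (intros; now apply J1_cont).
  apply RIntR_ext. intros th _. unfold J1. rewrite <- RIntR_scal by (intros; apply J2_comp; auto; ctac).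
  apply RIntR_ext. intros al _. unfold J2. apply RIntR_scal; intros; apply C3_comp; auto; ctac.
Qed.

Lemma J_ext (F G : R -> R -> R -> R) : (forall a b c, F a b c = G a b c) -> J F = J G.
Proof.
  intros E. repeat (apply RIntR_ext; intros). apply E.
Qed.

Lemma J_le F G : C3 F -> C3 G -> (forall a b c, 0 <= a <= PI / 2 -> F a b c <= G a b c) -> J F <= J G.
Proof.
  intros HF HG H. unfold J. apply RInt_le. apply PIh.
  1, 2: apply ex_RInt_cont; intros; now apply J1_cont.
  intros a Ha. unfold J1. apply RInt_le. apply PI2p.
  1, 2: apply ex_RInt_cont; intros; apply J2_comp; auto; ctac.
  intros b Hb. unfold J2. apply RInt_le. apply PI2p.
  1, 2: apply ex_RInt_cont; intros; apply C3_comp; auto; ctac.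
  intros c Hc. apply H. lra.
Qed.

Lemma ftc (f f' : R -> R) a b : (forall t, is_derive f t (f' t)) -> (forall t, continuous f' t) ->
  RInt f' a b = f b - f a.
Proof.
  intros H C. apply is_RInt_unique. apply (is_RInt_derive (V:=R_CompleteNormedModule) f f'); auto.
Qed.

Lemma RIntR_0 a b : RInt (fun _ => 0) a b = 0.
Proof. rewrite RInt_const. apply Rmult_0_r. Qed.

Lemma J_be (F F' : R -> R -> R -> R) : C3 F' -> (forall a b c, is_derive (fun c => F a b c) c (F' a b c)) ->
  (forall a b, F a b (2 * PI) = F a b 0) -> J F' = 0.
Proof.
  intros HF D P. unfold J. transitivity (RInt (fun _ : R => 0) 0 (PI / 2)); [|apply RIntR_0]. apply RIntR_ext. intros a _.
  unfold J1. transitivity (RInt (fun _ : R => 0) 0 (2 * PI)); [|apply RIntR_0]. apply RIntR_ext. intros b _.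
  unfold J2. rewrite (ftc (F a b)). rewrite P; ring. auto. intros; apply C3_comp; auto; ctac.
Qed.

Lemma J_al (F F' : R -> R -> R -> R) : C3 F -> C3 F' -> (forall a b c, is_derive (fun b => F a b c) b (F' a b c)) ->
  (forall a c, F a (2 * PI) c = F a 0 c) -> J F' = 0.
Proof.
  intros HF HF' D P. unfold J. transitivity (RInt (fun _ : R => 0) 0 (PI / 2)); [|apply RIntR_0]. apply RIntR_ext. intros a _.
  unfold J1. rewrite (ftc (J2 F a)).
  - replace (J2 F a (2 * PI)) with (J2 F a 0). ring. apply RIntR_ext. intros; now rewrite P.
  - intros b. unfold J2. apply (is_derive_RInt_param' (fun b c => F a b c) (fun b c => F' a b c)); auto.
    intros; apply C3_comp; auto; ctac. intros; apply C3_comp; auto; ctac.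
  - intros; apply J2_comp; auto; ctac.
Qed.

Lemma J_th (F F' : R -> R -> R -> R) : C3 F -> C3 F' -> (forall a b c, is_derive (fun a => F a b c) a (F' a b c)) ->
  (forall b c, F (PI / 2) b c = F 0 b c) -> J F' = 0.
Proof.
  intros HF HF' D P. unfold J. rewrite (ftc (J1 F)).
  - replace (J1 F (PI / 2)) with (J1 F 0). ring.
    apply RIntR_ext. intros b _. apply RIntR_ext. intros; now rewrite P.
  - intros a. unfold J1. apply (is_derive_RInt_param' (J2 F) (J2 F')).
    + intros u b. unfold J2. apply (is_derive_RInt_param' (fun a c => F a b c) (fun a c => F' a b c)); auto.
      intros; apply C3_comp; auto; ctac. intros; apply C3_comp; auto; ctac.
    + intros; apply J2_comp; auto; ctac.
    + intros; apply J2_comp; auto; ctac.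
  - intros; now apply J1_cont.
Qed.

Definition hi (g : pt -> R) (th al be : R) : R := g (hopf th al be) * (sin th * cos th).
Definition haarR (g : pt -> R) : R := / (2 * PI ^ 2) * J (hi g).

Lemma haar_eq f : haar f = (haarR (fun x => fst (f x)), haarR (fun x => snd (f x))).
Proof. reflexivity. Qed.

Lemma inSU2_hopf th al be : inSU2 (hopf th al be).
Proof.
  apply inSU2_mk. generalize (cs1 th) (cs1 al) (cs1 be).
  generalize (cos th) (sin th) (cos al) (sin al) (cos be) (sin be). intros c s a a' b b' H1 H2 H3.
  transitivity (c * c * (a * a + a' * a') + s * s * (b * b + b' * b')). ring. rewrite H2, H3; lra.
Qed.

Lemma C3_hopf g : ccont g -> C3 (fun a b c => g (hopf a b c)).
Proof.
  intros H p. apply ccont_comp; auto. intros; apply inSU2_hopf.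
  unfold hopf. apply continuous_mk; ctac.
Qed.

Lemma C3_hi g : ccont g -> C3 (hi g).
Proof.
  intros H p. unfold hi. apply Rcont_mult. now apply (C3_hopf g). ctac.
Qed.

Lemma haarR_plus g h : ccont g -> ccont h -> haarR (fun x => g x + h x) = haarR g + haarR h.
Proof.
  intros Hg Hh. unfold haarR. rewrite <- Rmult_plus_distr_l, <- J_plus by now apply C3_hi.
  apply f_equal. apply J_ext. intros; unfold hi; ring.
Qed.

Lemma haarR_scal k g : ccont g -> haarR (fun x => k * g x) = k * haarR g.
Proof.
  intros Hg. unfold haarR. rewrite <- Rmult_assoc, (Rmult_comm k), Rmult_assoc, <- (J_scal k (hi g)) by now apply C3_hi.
  apply f_equal. apply J_ext. intros; unfold hi; ring.
Qed.

Lemma haarR_ext g h : eqS g h -> haarR g = haarR h.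
Proof.
  intros E. unfold haarR. apply f_equal. apply J_ext. intros; unfold hi. rewrite E; auto. apply inSU2_hopf.
Qed.

Lemma haarR_le g h : ccont g -> ccont h -> (forall x, inSU2 x -> g x <= h x) -> haarR g <= haarR h.
Proof.
  intros Hg Hh H. unfold haarR. apply Rmult_le_compat_l.
  - left. apply Rinv_0_lt_compat. generalize PI_RGT_0. intros; nra.
  - apply J_le; try now apply C3_hi. intros a b c Ha. unfold hi. apply Rmult_le_compat_r.
    generalize PI_RGT_0; intros. apply Rmult_le_pos. apply sin_ge_0; lra. apply cos_ge_0; lra.
    apply H, inSU2_hopf.
Qed.

Lemma haarR_one : haarR (fun _ => 1) = 1.
Proof.
  assert (P := PI_RGT_0).
  unfold haarR. replace (J (hi (fun _ => 1))) with (2 * PI ^ 2 * 1).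
  { field. lra. }
  unfold J, J1, J2, hi.
  replace (RInt _ 0 (PI / 2)) with (RInt (fun th => (2 * PI) * ((2 * PI) * (sin th * cos th))) 0 (PI / 2)).
  - rewrite (ftc (fun th => 2 * PI ^ 2 * (sin th * sin th))).
    + rewrite sin_PI2, sin_0. ring.
    + intros t. auto_derive; auto. ring.
    + intros t. ctac.
  - apply RIntR_ext. intros a _. symmetry.
    transitivity (RInt (fun al => (2 * PI) * (sin a * cos a)) 0 (2 * PI)).
    + apply RIntR_ext. intros b _. rewrite RInt_const. unfold scal; simpl; unfold mult; simpl. ring.
    + rewrite RInt_const. unfold scal; simpl; unfold mult; simpl. ring.
Qed.

Lemma haarR_abs g B : ccont g -> (forall x, inSU2 x -> Rabs (g x) <= B) -> Rabs (haarR g) <= B.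
Proof.
  intros Hg HB.
  assert (E : forall k, haarR (fun _ => k) = k).
  { intros k. rewrite (haarR_ext _ (fun _ => k * 1)). rewrite (haarR_scal k (fun _ => 1)).
    rewrite haarR_one; ring. apply ccont_const. intros x _; ring. }
  apply Rabs_le. split.
  - rewrite <- (E (- B)). apply haarR_le; auto using ccont_const.
    intros x Hx. generalize (HB x Hx). intros H. apply Rabs_le_between in H. lra.
  - rewrite <- (E B). apply haarR_le; auto using ccont_const.
    intros x Hx. generalize (HB x Hx). intros H. apply Rabs_le_between in H. lra.
Qed.

(** The three partial derivatives of g in Hopf coordinates, written in the left-invariant frame. *)
Definition hth (g : pt -> R) th al be : R :=
  2 * cos (al - be) * rl D2 g (hopf th al be) - 2 * sin (al - be) * rl D1 g (hopf th al be).
Definition hal (g : pt -> R) th al be : R :=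
  2 * (sin th * cos th) * (sin (al - be) * rl D2 g (hopf th al be) + cos (al - be) * rl D1 g (hopf th al be))
      - 2 * (cos th * cos th) * rl D0 g (hopf th al be).
Definition hbe (g : pt -> R) th al be : R :=
  2 * (sin th * cos th) * (sin (al - be) * rl D2 g (hopf th al be) + cos (al - be) * rl D1 g (hopf th al be))
      + 2 * (sin th * sin th) * rl D0 g (hopf th al be).

Lemma hopf_derive g th al be : rsm g ->
  is_derive (fun t => g (hopf t al be)) th
    (hth g th al be) /\
  is_derive (fun t => g (hopf th t be)) al
    (hal g th al be) /\
  is_derive (fun t => g (hopf th al t)) be
    (hbe g th al be).
Proof.
  intros Hg. assert (Hd := rsm_der _ Hg).
  assert (Hc : forall d, ccont (rl d g)) by (intros; now apply rsm_ccont, rsm_rl).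
  refine (conj _ (conj _ _)).
  - evar_last. apply (chain g (fun t => cos t * cos al) (fun t => cos t * sin al) (fun t => sin t * cos be) (fun t => sin t * sin be) th
      (- sin th * cos al) (- sin th * sin al) (cos th * cos be) (cos th * sin be)); auto.
    intros; apply (inSU2_hopf s). 1-4: auto_derive; auto; ring.
    change (mk (cos th * cos al) (cos th * sin al) (sin th * cos be) (sin th * sin be)) with (hopf th al be).
    unfold dc0, dc1, dc2, hth, hal, hbe. rewrite cos_minus, sin_minus. generalize (cs1 th).
    generalize (rl D0 g (hopf th al be)) (rl D1 g (hopf th al be)) (rl D2 g (hopf th al be)).
    generalize (cos th) (sin th). intros c s g0 g1 g2 H. assert (H' : c * c = 1 - s * s) by lra. simpl. ring [H'].
  - evar_last. apply (chain g (fun t => cos th * cos t) (fun t => cos th * sin t) (fun t => sin th * cos be) (fun t => sin th * sin be) al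
      (- cos th * sin al) (cos th * cos al) 0 0); auto.
    intros s; apply (inSU2_hopf th s be). 1-4: auto_derive; auto; ring.
    change (mk (cos th * cos al) (cos th * sin al) (sin th * cos be) (sin th * sin be)) with (hopf th al be).
    unfold dc0, dc1, dc2, hth, hal, hbe. rewrite cos_minus, sin_minus. generalize (cs1 al).
    generalize (rl D0 g (hopf th al be)) (rl D1 g (hopf th al be)) (rl D2 g (hopf th al be)).
    generalize (cos al) (sin al). intros c s g0 g1 g2 H. assert (H' : c * c = 1 - s * s) by lra. simpl. ring [H'].
  - evar_last. apply (chain g (fun t => cos th * cos al) (fun t => cos th * sin al) (fun t => sin th * cos t) (fun t => sin th * sin t) be
      0 0 (- sin th * sin be) (sin th * cos be)); auto.
    intros s; apply (inSU2_hopf th al s). 1-4: auto_derive; auto; ring.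
    change (mk (cos th * cos al) (cos th * sin al) (sin th * cos be) (sin th * sin be)) with (hopf th al be).
    unfold dc0, dc1, dc2, hth, hal, hbe. rewrite cos_minus, sin_minus. generalize (cs1 be).
    generalize (rl D0 g (hopf th al be)) (rl D1 g (hopf th al be)) (rl D2 g (hopf th al be)).
    generalize (cos be) (sin be). intros c s g0 g1 g2 H. assert (H' : c * c = 1 - s * s) by lra. simpl. ring [H'].
Qed.

(* In Hopf coordinates the fields Y_d are divergence free for the density sin th cos th:
   rl d g * sin th cos th = d_th (Vth d * g) + d_al (Val d * g) + d_be (Vbe d * g). *)
Definition Vth d th al be := match d with
  | D0 => 0 | D1 => - / 2 * sin (al - be) * (sin th * cos th) | D2 => / 2 * cos (al - be) * (sin th * cos th) end.
Definition Val d th al be := match d with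
  | D0 => - / 2 * (sin th * cos th)
  | D1 => / 2 * (sin th * sin th) * cos (al - be) | D2 => / 2 * (sin th * sin th) * sin (al - be) end.
Definition Vbe d th al be := match d with
  | D0 => / 2 * (sin th * cos th)
  | D1 => / 2 * (cos th * cos th) * cos (al - be) | D2 => / 2 * (cos th * cos th) * sin (al - be) end.
Definition dVth d th al be := match d with
  | D0 => 0 | D1 => - / 2 * sin (al - be) * (cos th * cos th - sin th * sin th)
  | D2 => / 2 * cos (al - be) * (cos th * cos th - sin th * sin th) end.
Definition dVal d th al be := match d with
  | D0 => 0
  | D1 => - / 2 * (sin th * sin th) * sin (al - be) | D2 => / 2 * (sin th * sin th) * cos (al - be) end.
Definition dVbe d th al be := match d with
  | D0 => 0
  | D1 => / 2 * (cos th * cos th) * sin (al - be) | D2 => - / 2 * (cos th * cos th) * cos (al - be) end.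

(** Infinitesimal right invariance of Haar measure: the divergence form above turns the integral
    into boundary terms, which cancel by periodicity in al and be and vanish in th. *)
Lemma haarR_rl d g : rsm g -> haarR (rl d g) = 0.
Proof.
  intros Hg. unfold haarR. replace (J (hi (rl d g))) with 0; [ring|]. symmetry.
  assert (Hc : forall d, ccont (rl d g)) by (intros; now apply rsm_ccont, rsm_rl).
  assert (CG : C3 (fun a b c => g (hopf a b c))) by now apply C3_hopf, rsm_ccont.
  assert (CD : forall d, C3 (fun a b c => rl d g (hopf a b c))) by (intros; now apply C3_hopf).
  assert (X0 := CD D0). assert (X1 := CD D1). assert (X2 := CD D2).
  assert (V : C3 (Vth d) /\ C3 (Val d) /\ C3 (Vbe d) /\ C3 (dVth d) /\ C3 (dVal d) /\ C3 (dVbe d)).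
  { repeat split; intros p; destruct d; unfold Vth, Val, Vbe, dVth, dVal, dVbe; ctac. }
  destruct V as (V1 & V2 & V3 & V4 & V5 & V6).
  assert (Pr : forall F G, C3 F -> C3 G -> C3 (fun a b c => F a b c * G a b c)).
  { intros F G HF HG p. apply Rcont_mult. apply HF. apply HG. }
  assert (Pl : forall F G, C3 F -> C3 G -> C3 (fun a b c => F a b c + G a b c)).
  { intros F G HF HG p. apply Rcont_plus. apply HF. apply HG. }
  assert (CGth : C3 (hth g)).
  { intros p. unfold hth. ctac. apply X2. apply X1. }
  assert (CGal : C3 (hal g)).
  { intros p. unfold hal. ctac. apply X2. apply X1. apply X0. }
  assert (CGbe : C3 (hbe g)).
  { intros p. unfold hbe. ctac. apply X2. apply X1. apply X0. }
  pose (Fth := fun a b c => dVth d a b c * g (hopf a b c) + Vth d a b c * hth g a b c).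
  pose (Fal := fun a b c => dVal d a b c * g (hopf a b c) + Val d a b c * hal g a b c).
  pose (Fbe := fun a b c => dVbe d a b c * g (hopf a b c) + Vbe d a b c * hbe g a b c).
  assert (CF1 : C3 Fth) by (apply Pl; apply Pr; auto).
  assert (CF2 : C3 Fal) by (apply Pl; apply Pr; auto).
  assert (CF3 : C3 Fbe) by (apply Pl; apply Pr; auto).
  transitivity (J Fth + (J Fal + J Fbe)).
  - rewrite <- (J_plus Fal Fbe) by auto.
    rewrite <- (J_plus Fth (fun a b c => Fal a b c + Fbe a b c)) by auto.
    apply J_ext. intros a b c. unfold hi, Fth, Fal, Fbe, hth, hal, hbe.
    generalize (cs1 a) (cs1 (b - c)). destruct d;
    generalize (g (hopf a b c)) (rl D0 g (hopf a b c)) (rl D1 g (hopf a b c)) (rl D2 g (hopf a b c));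
    intros g' g0 g1 g2; unfold Vth, Val, Vbe, dVth, dVal, dVbe;
    generalize (cos a) (sin a) (cos (b - c)) (sin (b - c)); intros k s l m H1 H2.
    + transitivity (g0 * (s * k) * (k * k + s * s)); [rewrite H1; ring|field].
    + transitivity (g1 * (s * k) * (m * m + l * l * (k * k + s * s)) + g2 * (s * k * m * l) * (k * k + s * s - 1)).
      rewrite H1. transitivity (g1 * (s * k) * (l * l + m * m)); [rewrite H2|]; ring. field.
    + transitivity (g2 * (s * k) * (l * l + m * m * (k * k + s * s)) + g1 * (s * k * m * l) * (k * k + s * s - 1)).
      rewrite H1. transitivity (g2 * (s * k) * (l * l + m * m)); [rewrite H2|]; ring. field.
  - rewrite (J_th (fun a b c => Vth d a b c * g (hopf a b c)) Fth), (J_al (fun a b c => Val d a b c * g (hopf a b c)) Fal), (J_be (fun a b c => Vbe d a b c * g (hopf a b c)) Fbe); auto; try ring.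
    + intros a b c. apply (is_derive_mult (fun c => Vbe d a b c) (fun c => g (hopf a b c)) c).
      destruct d; unfold Vbe, dVbe; auto_derive; auto; unfold Rminus; ring. now apply hopf_derive. intros; apply Rmult_comm.
    + intros a b. unfold Vbe, hopf. rewrite cos_2PI, sin_2PI, cos_0, sin_0. destruct d; auto.
      all: unfold Rminus; rewrite ?Ropp_0, ?Rplus_0_r.
      rewrite <- (cos_period (b + - (2 * PI)) 1). do 3 f_equal. simpl; ring.
      rewrite <- (sin_period (b + - (2 * PI)) 1). do 3 f_equal. simpl; ring.
    + intros a b c. apply (is_derive_mult (fun b => Val d a b c) (fun b => g (hopf a b c)) b).
      destruct d; unfold Val, dVal; auto_derive; auto; unfold Rminus; ring. now apply hopf_derive. intros; apply Rmult_comm.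
    + intros a c. unfold Val, hopf. rewrite cos_2PI, sin_2PI, cos_0, sin_0. destruct d; auto.
      replace (2 * PI - c) with ((0 - c) + 2 * INR 1 * PI) by (simpl; ring). now rewrite cos_period.
      replace (2 * PI - c) with ((0 - c) + 2 * INR 1 * PI) by (simpl; ring). now rewrite sin_period.
    + intros a b c. apply (is_derive_mult (fun a => Vth d a b c) (fun a => g (hopf a b c)) a).
      destruct d; unfold Vth, dVth; auto_derive; auto; unfold Rminus; ring. now apply hopf_derive. intros; apply Rmult_comm.
    (* The factor sin th cos th in [Vth] vanishes at both ends of the th interval, where Hopf
       coordinates degenerate. *)
    + intros b c. unfold Vth. rewrite sin_0, cos_PI2. destruct d; ring.
Qed.

(** * Density of polynomials *)

Definition close (x y : pt) (d : R) : Prop :=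
  Rabs (p1 y - p1 x) < d /\ Rabs (p2 y - p2 x) < d /\ Rabs (p3 y - p3 x) < d /\ Rabs (p4 y - p4 x) < d.

Lemma ccont_close h x e : ccont h -> inSU2 x -> 0 < e ->
  exists d : posreal, forall y, inSU2 y -> close x y d -> Rabs (h y - h x) < e.
Proof.
  intros Hh Hx He.
  destruct (proj1 (filterlim_locally _ _) (Hh x Hx) (mkposreal e He)) as [d Hd].
  exists d. intros y Hy (A & B & C & D). apply (Hd y); auto.
  destruct x as [[x1 x2] [x3 x4]], y as [[y1 y2] [y3 y4]]. repeat split; assumption.
Qed.

Lemma SU2_coord_bound x : inSU2 x ->
  -1 <= p1 x <= 1 /\ -1 <= p2 x <= 1 /\ -1 <= p3 x <= 1 /\ -1 <= p4 x <= 1.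
Proof.
  rewrite inSU2_p. intros H.
  generalize (Rle_0_sqr (p1 x)) (Rle_0_sqr (p2 x)) (Rle_0_sqr (p3 x)) (Rle_0_sqr (p4 x)); unfold Rsqr; intros.
  repeat split; nra.
Qed.

(** Lebesgue number form of compactness, obtained inside the cube [-1, 1]^4: the gauge is extended
    to points off SU(2) by radii too small for their balls to meet SU(2). The double negation is
    inherited from [compactness_value] and is harmless for the inequalities deduced from it. *)
Lemma compact_SU2 (delta : pt -> posreal) : exists d, 0 < d /\
  forall x, inSU2 x -> ~ ~ exists t, inSU2 t /\ close t x (delta t) /\ d <= delta t.
Proof.
  pose (tp := fun v : R * (R * (R * (R * unit))) => mk (fst v) (fst (snd v)) (fst (snd (snd v))) (fst (snd (snd (snd v))))).
  pose (N := fun x : pt => p1 x * p1 x + p2 x * p2 x + p3 x * p3 x + p4 x * p4 x).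
  (* If a point of SU(2) lay within d of [tp v] in every coordinate, each of the four differences of
     squares would be below 2 d; this is the origin of the 8. *)
  assert (Hdel : forall v, exists d : posreal, (inSU2 (tp v) -> d = delta (tp v)) /\
     (~ inSU2 (tp v) -> 8 * d <= Rabs (N (tp v) - 1))).
  { intros v. destruct (excluded_middle_informative (inSU2 (tp v))) as [H|H].
    - exists (delta (tp v)). tauto.
    - assert (P : 0 < Rabs (N (tp v) - 1) / 8).
      { apply Rdiv_lt_0_compat; [|lra]. apply Rabs_pos_lt. intros E. apply H, inSU2_p. unfold N in E. lra. }
      exists (mkposreal _ P). split. tauto. simpl. intros _. lra. }
  pose (del := fun v => proj1_sig (constructive_indefinite_description _ (Hdel v))).
  assert (D : forall v, (inSU2 (tp v) -> del v = delta (tp v)) /\ (~ inSU2 (tp v) -> 8 * del v <= Rabs (N (tp v) - 1))).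
  { intros v. apply (proj2_sig (constructive_indefinite_description _ (Hdel v))). }
  destruct (compactness_value 4 (-1, (-1, (-1, (-1, tt)))) (1, (1, (1, (1, tt)))) del) as [d Hd].
  exists d. split. apply cond_pos. intros x Hx.
  assert (B := SU2_coord_bound x Hx).
  intros K. refine (Hd (p1 x, (p2 x, (p3 x, (p4 x, tt)))) _ _). simpl; tauto.
  intros ([t1 [t2 [t3 [t4 []]]]] & Hb & Hc & Hl). apply K.
  simpl in Hb, Hc. set (v := (t1, (t2, (t3, (t4, tt))))) in *.
  destruct (D v) as [Dl Dr].
  destruct (excluded_middle_informative (inSU2 (tp v))) as [H|H].
  - exists (tp v). rewrite <- Dl by auto. unfold close; simpl. tauto.
  - exfalso. specialize (Dr H). apply inSU2_p in Hx.
    destruct Hc as (C1 & C2 & C3 & C4 & _).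
    apply (Rlt_irrefl (Rabs (N (tp v) - 1))).
    apply Rlt_le_trans with (8 * del v); [|exact Dr].
    replace (N (tp v) - 1) with (- ((p1 x - t1) * (p1 x + t1) + (p2 x - t2) * (p2 x + t2) + (p3 x - t3) * (p3 x + t3) + (p4 x - t4) * (p4 x + t4))).
    2: { unfold N, tp, v. unfold mk; simpl. unfold p1, p2, p3, p4 in *; simpl in *. lra. }
    rewrite Rabs_Ropp.
    eapply Rle_lt_trans. apply Rabs_triang. 
    assert (T : Rabs ((p1 x - t1) * (p1 x + t1) + (p2 x - t2) * (p2 x + t2) + (p3 x - t3) * (p3 x + t3)) <= 
      Rabs ((p1 x - t1) * (p1 x + t1)) + Rabs ((p2 x - t2) * (p2 x + t2)) + Rabs ((p3 x - t3) * (p3 x + t3))).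
    { eapply Rle_trans. apply Rabs_triang. apply Rplus_le_compat_r. apply Rabs_triang. }
    assert (S : forall a b, -1 <= a <= 1 -> -1 <= b <= 1 -> Rabs (a - b) < del v -> Rabs ((a - b) * (a + b)) < 2 * del v).
    { intros a b Ha Hb' Hab. rewrite Rabs_mult. assert (Rabs (a + b) <= 2) by (apply Rabs_le; lra).
      generalize (Rabs_pos (a - b)) (Rabs_pos (a + b)). intros. nra. }
    assert (S1 := S (p1 x) t1 ltac:(tauto) ltac:(tauto) C1).
    assert (S2 := S (p2 x) t2 ltac:(tauto) ltac:(tauto) C2).
    assert (S3 := S (p3 x) t3 ltac:(tauto) ltac:(tauto) C3).
    assert (S4 := S (p4 x) t4 ltac:(tauto) ltac:(tauto) C4).
    lra.
Qed.

Definition dot (x y : pt) : R := p1 x * p1 y + p2 x * p2 y + p3 x * p3 y + p4 x * p4 y.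

Lemma dot_dist x y : inSU2 x -> inSU2 y ->
  2 - 2 * dot x y = (p1 y - p1 x) * (p1 y - p1 x) + (p2 y - p2 x) * (p2 y - p2 x)
    + (p3 y - p3 x) * (p3 y - p3 x) + (p4 y - p4 x) * (p4 y - p4 x).
Proof. rewrite !inSU2_p. unfold dot. intros H1 H2. lra. Qed.

Lemma dot_bound x y : inSU2 x -> inSU2 y -> -1 <= dot x y <= 1.
Proof.
  intros Hx Hy. assert (H := dot_dist x y Hx Hy). revert H.
  apply inSU2_p in Hx. apply inSU2_p in Hy. unfold dot.
  generalize (Rle_0_sqr (p1 y - p1 x)) (Rle_0_sqr (p2 y - p2 x)) (Rle_0_sqr (p3 y - p3 x)) (Rle_0_sqr (p4 y - p4 x)).
  generalize (Rle_0_sqr (p1 y + p1 x)) (Rle_0_sqr (p2 y + p2 x)) (Rle_0_sqr (p3 y + p3 x)) (Rle_0_sqr (p4 y + p4 x)).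
  unfold Rsqr. intros. split; lra.
Qed.

(** Since 1 - <x,y> is half the squared distance, nearby points are handled by uniform continuity
    and distant ones by boundedness. In this form the modulus can be integrated exactly against
    powers of [wk], because 1 - <x,y> = 2 (1 - [wk x y]). *)
Lemma modulus h e : ccont h -> 0 < e ->
  exists C, 0 <= C /\ forall x y, inSU2 x -> inSU2 y -> Rabs (h y - h x) <= e + C * (1 - dot x y).
Proof.
  intros Hh He. assert (He2 : 0 < e / 2) by lra.
  (* The radii serve twice: the condition d <= 1 / (1 + |h t|) makes the Lebesgue number d bound |h|
     by 1 / d + e / 2, and the factor 2 leaves room for a second point at distance d from the one
     covered. *)
  assert (Hdel : forall t, exists d : posreal, inSU2 t ->
     (forall y, inSU2 y -> close t y (2 * d) -> Rabs (h y - h t) < e / 2) /\ d <= / (1 + Rabs (h t))).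
  { intros t. destruct (excluded_middle_informative (inSU2 t)) as [Ht|Ht].
    - destruct (ccont_close h t (e / 2) Hh Ht He2) as [d Hd].
      assert (P : 0 < / (1 + Rabs (h t))) by (apply Rinv_0_lt_compat; generalize (Rabs_pos (h t)); lra).
      assert (P' : 0 < Rmin (d / 2) (/ (1 + Rabs (h t)))).
      { apply Rmin_pos; auto. generalize (cond_pos d); lra. }
      exists (mkposreal _ P'). simpl. intros _. split.
      + intros y Hy (A & B & C & D). apply Hd; auto. generalize (Rmin_l (d / 2) (/ (1 + Rabs (h t)))).
        unfold close. intros. repeat split; lra.
      + apply Rmin_r.
    - exists (mkposreal 1 Rlt_0_1). tauto. }
  pose (del := fun v => proj1_sig (constructive_indefinite_description _ (Hdel v))).
  assert (D : forall t, inSU2 t -> (forall y, inSU2 y -> close t y (2 * del t) -> Rabs (h y - h t) < e / 2) /\ del t <= / (1 + Rabs (h t))).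
  { intros v. apply (proj2_sig (constructive_indefinite_description _ (Hdel v))). }
  destruct (compact_SU2 del) as (d & Pd & Hd).
  assert (Pd' : 0 < / d) by now apply Rinv_0_lt_compat.
  assert (Bd : forall x, inSU2 x -> Rabs (h x) <= / d + e / 2).
  { intros x Hx. apply Rnot_lt_le. intros K. apply (Hd x Hx). intros (t & Ht & Hc & Hl).
    destruct (D t Ht) as [D1 D2].
    assert (X : Rabs (h x - h t) < e / 2).
    { apply D1; auto. destruct Hc as (A & B & C & E). generalize (cond_pos (del t)). unfold close. intros. repeat split; lra. }
    assert (Y : 1 + Rabs (h t) <= / d).
    { rewrite <- (Rinv_inv (1 + Rabs (h t))). apply Rinv_le_contravar; lra. }
    replace (h x) with ((h x - h t) + h t) in K by ring.
    generalize (Rabs_triang (h x - h t) (h t)). lra. }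
  set (M := / d + e / 2).
  assert (PM : 0 < M) by (unfold M; lra).
  assert (Pdd : 0 < d * d) by now apply Rmult_lt_0_compat.
  (* Points that are not close satisfy d^2 <= 2 - 2 <x,y>, so with this constant the second term is
     at least 2 M, which bounds the oscillation of h. *)
  exists (4 * M / (d * d)). split. apply Rlt_le, Rdiv_lt_0_compat; lra.
  intros x y Hx Hy.
  assert (DD := dot_dist x y Hx Hy).
  generalize (Rle_0_sqr (p1 y - p1 x)) (Rle_0_sqr (p2 y - p2 x)) (Rle_0_sqr (p3 y - p3 x)) (Rle_0_sqr (p4 y - p4 x)).
  unfold Rsqr. intros Q1 Q2 Q3 Q4.
  assert (Hnn : 0 <= 4 * M / (d * d) * (1 - dot x y)).
  { apply Rmult_le_pos. apply Rlt_le, Rdiv_lt_0_compat; lra. lra. }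
  destruct (excluded_middle_informative (close x y d)) as [H|H].
  - apply Rnot_lt_le. intros K. apply (Hd x Hx). intros (t & Ht & Hc & Hl).
    destruct (D t Ht) as [D1 D2].
    assert (X : Rabs (h x - h t) < e / 2).
    { apply D1; auto. destruct Hc as (A & B & C & E). generalize (cond_pos (del t)). unfold close. intros. repeat split; lra. }
    assert (Y : Rabs (h y - h t) < e / 2).
    { apply D1; auto. destruct Hc as (A & B & C & E), H as (A' & B' & C' & E').
      apply Rabs_lt_between in A. apply Rabs_lt_between in B. apply Rabs_lt_between in C. apply Rabs_lt_between in E.
      apply Rabs_lt_between in A'. apply Rabs_lt_between in B'. apply Rabs_lt_between in C'. apply Rabs_lt_between in E'.
      unfold close. repeat split; apply Rabs_lt_between; lra. }
    apply Rabs_lt_between in X. apply Rabs_lt_between in Y.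
    assert (Rabs (h y - h x) < e) by (apply Rabs_lt_between; lra). lra.
  - assert (far : d * d <= 2 - 2 * dot x y).
    { rewrite DD. apply Rnot_lt_le. intros K. apply H.
      assert (G : forall a, a * a < d * d -> Rabs a < d).
      { intros a Ha. apply Rsqr_lt_abs_0 in Ha. now rewrite (Rabs_pos_eq d) in Ha by lra. }
      unfold close. repeat split; apply G; lra. }
    assert (Bx := Bd x Hx). assert (By := Bd y Hy). fold M in Bx, By.
    assert (Rabs (h y - h x) <= 2 * M).
    { eapply Rle_trans. apply Rabs_triang. rewrite Rabs_Ropp. lra. }
    assert (2 * M <= 4 * M / (d * d) * (1 - dot x y)).
    { replace (2 * M) with (4 * M / (d * d) * (d * d / 2)) by (field; lra).
      apply Rmult_le_compat_l. apply Rlt_le, Rdiv_lt_0_compat; lra. lra. }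
    lra.
Qed.

(** * Polynomial kernels concentrating on the diagonal *)

Definition wk (x y : pt) : R := (1 + dot x y) / 2.

Lemma rpoly_ext g h : rpoly g -> (forall x, g x = h x) -> rpoly h.
Proof. intros H E. replace h with g; auto. now apply functional_extensionality. Qed.

Lemma rpoly_pow g n : rpoly g -> rpoly (fun x => g x ^ n).
Proof. intros H. induction n; simpl. apply rp_const. now apply rp_mult. Qed.

Lemma rpoly_dot x : rpoly (dot x).
Proof. unfold dot. repeat apply rp_plus; apply rpoly_scal; constructor. Qed.

Lemma rpoly_wk x : rpoly (wk x).
Proof.
  apply rpoly_ext with (fun y => / 2 + / 2 * dot x y).
  - apply rp_plus. apply rp_const. apply rpoly_scal, rpoly_dot.
  - intros y. unfold wk. field.
Qed.

Lemma dot_comm x y : dot x y = dot y x.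
Proof. unfold dot; ring. Qed.
Lemma wk_comm x y : wk x y = wk y x.
Proof. unfold wk. now rewrite dot_comm. Qed.

(** The Y_d derivative of <x,.> at y, see [lin_derive]; the antisymmetry [ddot_anti] reflects that
    right translation is orthogonal for <.,.>. *)
Definition ddot (d : dir) (x y : pt) : R := match d with
  | D0 => / 2 * (p1 x * p2 y - p2 x * p1 y - p3 x * p4 y + p4 x * p3 y)
  | D1 => / 2 * (- (p1 x * p4 y) + p2 x * p3 y - p3 x * p2 y + p4 x * p1 y)
  | D2 => / 2 * (- (p1 x * p3 y) - p2 x * p4 y + p3 x * p1 y + p4 x * p2 y) end.

Lemma ddot_anti d x y : ddot d y x = - ddot d x y.
Proof. destruct d; unfold ddot; ring. Qed.

Lemma lin4_derive (f1 f2 f3 f4 : R -> R) t a1 a2 a3 a4 c1 c2 c3 c4 :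
  is_derive f1 t a1 -> is_derive f2 t a2 -> is_derive f3 t a3 -> is_derive f4 t a4 ->
  is_derive (fun t => c1 * f1 t + c2 * f2 t + c3 * f3 t + c4 * f4 t) t (c1 * a1 + c2 * a2 + c3 * a3 + c4 * a4).
Proof.
  intros A1 A2 A3 A4. auto_derive.
  - repeat split; eexists; eassumption.
  - rewrite (derive_eta _ _ _ A1), (derive_eta _ _ _ A2), (derive_eta _ _ _ A3), (derive_eta _ _ _ A4). ring.
Qed.

Lemma lin_derive d x (k : pt) :
  is_derive (fun t => dot k (mulSU2 x (expd d t))) 0 (ddot d k x).
Proof.
  destruct (rl_coords d x) as (A & B & C & E). evar_last.
  - exact (lin4_derive _ _ _ _ 0 _ _ _ _ (p1 k) (p2 k) (p3 k) (p4 k) A B C E).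
  - destruct d; unfold ddot; field.
Qed.

Lemma rpoly_ddot d x : rpoly (ddot d x).
Proof.
  destruct d; unfold ddot.
  - apply rpoly_ext with (fun y => (/ 2 * p1 x) * p2 y + ((- / 2 * p2 x) * p1 y + ((- / 2 * p3 x) * p4 y + (/ 2 * p4 x) * p3 y))).
    repeat apply rp_plus; apply rpoly_scal; constructor. intros; ring.
  - apply rpoly_ext with (fun y => (- / 2 * p1 x) * p4 y + ((/ 2 * p2 x) * p3 y + ((- / 2 * p3 x) * p2 y + (/ 2 * p4 x) * p1 y))).
    repeat apply rp_plus; apply rpoly_scal; constructor. intros; ring.
  - apply rpoly_ext with (fun y => (- / 2 * p1 x) * p3 y + ((- / 2 * p2 x) * p4 y + ((/ 2 * p3 x) * p1 y + (/ 2 * p4 x) * p2 y))).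
    repeat apply rp_plus; apply rpoly_scal; constructor. intros; ring.
Qed.

Lemma ddot_derive d x y : is_derive (fun t => ddot d x (mulSU2 y (expd d t))) 0 (- / 4 * dot x y).
Proof.
  destruct (rl_coords d y) as (A & B & C & E).
  (* The vector for which [ddot d x] is <k,.> / 2, so that [lin_derive] can be applied a second
     time. *)
  pose (k := match d with D0 => mk (- p2 x) (p1 x) (p4 x) (- p3 x)
    | D1 => mk (p4 x) (- p3 x) (p2 x) (- p1 x) | D2 => mk (p3 x) (p4 x) (- p1 x) (- p2 x) end).
  apply is_derive_ext with (fun t => / 2 * dot k (mulSU2 y (expd d t))).
  - intros t. unfold k, dot, ddot. destruct d; unfold mk, p1, p2, p3, p4; simpl; ring.
  - evar_last. apply (is_derive_scal (fun t => dot k (mulSU2 y (expd d t)))). apply lin_derive.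
    unfold k, dot, ddot. destruct d; unfold mk, p1, p2, p3, p4; simpl; field.
Qed.

Lemma rl_ddot d x y : rl d (ddot d x) y = - / 4 * dot x y.
Proof. apply is_derive_unique, ddot_derive. Qed.

Lemma rl_pow d g n y : der g -> inSU2 y -> rl d (fun y => g y ^ n) y = INR n * rl d g y * g y ^ pred n.
Proof.
  intros Hg Hy. unfold rl.
  rewrite (Derive_pow (fun t => g (mulSU2 y (expd d t)))) by now apply Hg.
  now rewrite expd_0, mul_one.
Qed.

Lemma aff_derive (f : R -> R) t a c k : is_derive f t a -> is_derive (fun t => c + k * f t) t (k * a).
Proof.
  intros A. auto_derive. repeat split; eexists; eassumption. rewrite (derive_eta _ _ _ A). ring.
Qed.

Lemma rl_wk d x y : rl d (wk x) y = / 2 * ddot d x y.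
Proof.
  replace (wk x) with (fun y => / 2 + / 2 * dot x y)
    by (apply functional_extensionality; intros; unfold wk; field).
  apply is_derive_unique. apply (aff_derive (fun t => dot x (mulSU2 y (expd d t)))), lin_derive.
Qed.

(** The vectors y, 2 yY_0, 2 yY_1, 2 yY_2 form an orthonormal basis of R^4, and the identity is
    Parseval's for x. *)
Lemma ddot_sum x y : inSU2 x -> inSU2 y ->
  ddot D0 x y * ddot D0 x y + ddot D1 x y * ddot D1 x y + ddot D2 x y * ddot D2 x y = (1 - dot x y * dot x y) / 4.
Proof.
  rewrite !inSU2_p. intros Hx Hy.
  transitivity (((p1 x * p1 x + p2 x * p2 x + p3 x * p3 x + p4 x * p4 x) * (p1 y * p1 y + p2 y * p2 y + p3 y * p3 y + p4 y * p4 y) - dot x y * dot x y) / 4).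
  unfold ddot, dot. field. rewrite Hx, Hy. field.
Qed.

(** Moments of [wk x] for Haar measure, evaluated in [haar_wk]. The ratio of successive values is 1
    - 3 / (2 n + 6); its convergence to 1 expresses the concentration of the kernel. *)
Fixpoint cst (n : nat) : R := match n with
  | O => 1
  | S n => cst n * ((2 * INR n + 3) / (2 * INR n + 6)) end.

Lemma cst_pos n : 0 < cst n.
Proof.
  induction n; simpl. lra. apply Rmult_lt_0_compat; auto.
  generalize (pos_INR n). intros. apply Rdiv_lt_0_compat; lra.
Qed.

(* Integrate sum_d Y_d (w^n Y_d <x,.>) to 0, where sum_d (Y_d <x,.>)^2 = (1 - <x,.>^2) / 4
   and sum_d Y_d^2 <x,.> = - 3/4 <x,.>. *)
Lemma haar_wk n x : inSU2 x -> haarR (fun y => wk x y ^ n) = cst n.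
Proof.
  intros Hx. assert (PW : forall n, rpoly (fun y => wk x y ^ n)) by (intros; apply rpoly_pow, rpoly_wk).
  induction n; simpl cst.
  - rewrite <- haarR_one. now apply haarR_ext.
  - pose (I := fun d y => wk x y ^ n * ddot d x y).
    assert (PI : forall d, rpoly (I d)) by (intros; apply rp_mult; auto using rpoly_ddot).
    (* With <x,y> = 2 w - 1 the sum of the squared derivatives is w (1 - w), so everything becomes a
       combination of w^n and w^(n+1). *)
    assert (E : eqS (fun y => (rl D0 (I D0) y + rl D1 (I D1) y) + rl D2 (I D2) y)
       (fun y => (INR n / 2 + 3 / 4) * wk x y ^ n + (- (INR n / 2 + 3 / 2)) * wk x y ^ (S n))).
    { intros y Hy. unfold I.
      assert (F : forall d, rl d (fun y => wk x y ^ n * ddot d x y) y =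
         INR n * (/ 2 * ddot d x y) * wk x y ^ pred n * ddot d x y + wk x y ^ n * (- / 4 * dot x y)).
      { intros d. rewrite rl_mult; auto using rpoly_der, rpoly_ddot.
        rewrite rl_pow by auto using rpoly_der, rpoly_wk. rewrite rl_wk.
        now rewrite rl_ddot. }
      rewrite !F.
      transitivity (INR n / 2 * wk x y ^ pred n * (ddot D0 x y * ddot D0 x y + ddot D1 x y * ddot D1 x y + ddot D2 x y * ddot D2 x y) - 3 / 4 * dot x y * wk x y ^ n). field.
      rewrite ddot_sum by auto. replace (dot x y) with (2 * wk x y - 1) by (unfold wk; field).
      destruct n. simpl; field. simpl pred. simpl pow. field. }
    apply haarR_ext in E.
    assert (CI : forall d, ccont (rl d (I d))) by (intros; now apply rsm_ccont, rsm_rl, rsm_rpoly).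
    rewrite !haarR_plus in E; auto using ccont_plus.
    2: apply ccont_mult; auto using ccont_const; now apply rpoly_ccont.
    2: apply ccont_mult; [apply ccont_const|]; apply rpoly_ccont, (PW (S n)).
    rewrite !haarR_rl in E by now apply rsm_rpoly.
    rewrite (haarR_scal _ (fun y => wk x y ^ n)) in E by now apply rpoly_ccont.
    rewrite (haarR_scal _ (fun y => wk x y ^ S n)) in E by apply rpoly_ccont, (PW (S n)).
    rewrite IHn in E. generalize (pos_INR n); intros.
    apply Rmult_eq_reg_l with (INR n / 2 + 3 / 2); [|lra].
    transitivity ((INR n / 2 + 3 / 4) * cst n). lra. field. lra.
Qed.

Definition psi0 (n : nat) (g : pt -> R) (x : pt) : R := haarR (fun y => wk x y ^ n * g y).

(** Finite sums of P(x) Q(y): for such kernels the convolution with g is visibly polynomial in x,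
    and differentiation under the integral sign is algebra. *)
Inductive sep : (pt -> pt -> R) -> Prop :=
| sep_prod P Q : rpoly P -> rpoly Q -> sep (fun x y => P x * Q y)
| sep_plus K L : sep K -> sep L -> sep (fun x y => K x y + L x y).

Lemma sep_ext K L : sep K -> (forall x y, K x y = L x y) -> sep L.
Proof. intros H E. replace L with K; auto. do 2 (apply functional_extensionality; intros); auto. Qed.

Lemma sep_mult K L : sep K -> sep L -> sep (fun x y => K x y * L x y).
Proof.
  intros HK HL. induction HK as [P Q HP HQ|K K' HK IHK HK' IHK'].
  - induction HL as [P' Q' HP' HQ'|L L' HL IHL HL' IHL'].
    + apply sep_ext with (fun x y => (P x * P' x) * (Q y * Q' y)). 2: intros; ring.
      apply (sep_prod (fun x => P x * P' x) (fun y => Q y * Q' y)); now apply rp_mult.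
    + eapply sep_ext. apply sep_plus. apply IHL. apply IHL'. intros; simpl; ring.
  - eapply sep_ext. apply sep_plus. apply IHK. apply IHK'. intros; simpl; ring.
Qed.

Lemma sep_wk n : sep (fun x y => wk x y ^ n).
Proof.
  assert (P1 : rpoly (fun _ => 1)) by apply rp_const.
  induction n; simpl.
  - apply sep_ext with (fun x y => 1 * 1). 2: intros; ring. now apply (sep_prod (fun _ => 1) (fun _ => 1)).
  - apply sep_mult; auto.
    apply sep_ext with (fun x y => 1 * / 2 + ((p1 x * (/ 2 * p1 y) + p2 x * (/ 2 * p2 y)) + (p3 x * (/ 2 * p3 y) + p4 x * (/ 2 * p4 y)))).
    2: intros; unfold wk, dot; field.
    apply sep_plus. apply (sep_prod (fun _ => 1) (fun _ => / 2)); auto. apply rp_const.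
    repeat apply sep_plus.
    apply (sep_prod p1 (fun y => / 2 * p1 y)); auto using rpoly_scal, rp_1.
    apply (sep_prod p2 (fun y => / 2 * p2 y)); auto using rpoly_scal, rp_2.
    apply (sep_prod p3 (fun y => / 2 * p3 y)); auto using rpoly_scal, rp_3.
    apply (sep_prod p4 (fun y => / 2 * p4 y)); auto using rpoly_scal, rp_4.
Qed.

Lemma sep_l K y : sep K -> rpoly (fun x => K x y).
Proof.
  induction 1. apply rpoly_ext with (fun x => Q y * P x). now apply rpoly_scal. intros; ring. now apply rp_plus.
Qed.
Lemma sep_r K x : sep K -> rpoly (K x).
Proof. induction 1. now apply rpoly_scal. now apply rp_plus. Qed.

Lemma sep_haar K g : sep K -> ccont g -> rpoly (fun x => haarR (fun y => K x y * g y)) /\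
  forall d x, inSU2 x -> ccont (fun y => rl d (fun x => K x y) x * g y) /\
   rl d (fun x => haarR (fun y => K x y * g y)) x = haarR (fun y => rl d (fun x => K x y) x * g y).
Proof.
  intros HK Hg. induction HK as [P Q HP HQ|K L HK [K1 K2] HL [L1 L2]].
  - assert (C : ccont (fun y => Q y * g y)) by (apply ccont_mult; auto; now apply rpoly_ccont).
    assert (E : (fun x => haarR (fun y => P x * Q y * g y)) = (fun x => haarR (fun y => Q y * g y) * P x)).
    { apply functional_extensionality. intros x. rewrite Rmult_comm, <- haarR_scal by auto.
      apply haarR_ext. intros y _; ring. }
    rewrite E. split. now apply rpoly_scal.
    intros d x Hx.
    assert (E' : (fun y => rl d (fun x => P x * Q y) x * g y) = (fun y => rl d P x * (Q y * g y))).
    { apply functional_extensionality. intros y.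
      replace (fun x => P x * Q y) with (fun x => Q y * P x) by (apply functional_extensionality; intros; ring).
      rewrite rl_scal. ring. }
    rewrite E'. split. apply ccont_mult; auto using ccont_const.
    rewrite rl_scal, haarR_scal by auto. ring.
  - assert (C : forall K x, sep K -> ccont (fun y => K x y * g y)).
    { intros M x HM. apply ccont_mult; auto. apply rpoly_ccont. now apply sep_r. }
    assert (E : (fun x => haarR (fun y => (K x y + L x y) * g y)) = (fun x => haarR (fun y => K x y * g y) + haarR (fun y => L x y * g y))).
    { apply functional_extensionality. intros x. rewrite <- haarR_plus by auto.
      apply haarR_ext. intros y _; ring. }
    rewrite E. split. now apply rp_plus.
    intros d x Hx. destruct (K2 d x Hx) as [K3 K4], (L2 d x Hx) as [L3 L4].
    assert (E' : (fun y => rl d (fun x => K x y + L x y) x * g y) = (fun y => rl d (fun x => K x y) x * g y + rl d (fun x => L x y) x * g y)).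
    { apply functional_extensionality. intros y. rewrite rl_plus; auto. ring.
      now apply rpoly_der, (sep_l K). now apply rpoly_der, (sep_l L). }
    rewrite E'. split. now apply ccont_plus.
    rewrite rl_plus, haarR_plus, K4, L4; auto using rpoly_der.
Qed.

(* The kernel depends on x y^{-1} only, so that a left-invariant derivative in x is minus
   the one in y, and integration by parts moves it onto g. *)
Lemma rl_psi0 n d g : rsm g -> eqS (rl d (psi0 n g)) (psi0 n (rl d g)).
Proof.
  intros Hg x Hx. unfold psi0.
  destruct (proj2 (sep_haar _ g (sep_wk n) (rsm_ccont _ Hg)) d x Hx) as [C ->].
  assert (SW : rsm (fun y => wk x y ^ n)) by (apply rsm_rpoly, rpoly_pow, rpoly_wk).
  assert (H := haarR_rl d _ (rsm_mult _ _ SW Hg)).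
  rewrite (haarR_ext _ (fun y => (-1) * (rl d (fun x => wk x y ^ n) x * g y) + wk x y ^ n * rl d g y)) in H.
  - rewrite (haarR_plus (fun y => (-1) * (rl d (fun x => wk x y ^ n) x * g y)) (fun y => wk x y ^ n * rl d g y)) in H.
    rewrite (haarR_scal (-1) _ C) in H. lra.
    apply ccont_mult; auto using ccont_const. apply ccont_mult; apply rsm_ccont; auto using rsm_rl.
  - intros y Hy. rewrite rl_mult; auto using rsm_der. f_equal.
    rewrite rl_pow by auto using rpoly_der, rpoly_wk. rewrite rl_wk.
    replace (fun x0 => wk x0 y ^ n) with (fun x0 => wk y x0 ^ n).
    rewrite rl_pow by auto using rpoly_der, rpoly_wk. rewrite rl_wk, (ddot_anti d x y), (wk_comm y x). ring.
    apply functional_extensionality. intros z. now rewrite wk_comm.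
Qed.

Definition psi (n : nat) (g : pt -> R) (x : pt) : R := / cst n * psi0 n g x.

Lemma rpoly_psi n g : ccont g -> rpoly (psi n g).
Proof. intros Hg. unfold psi. apply rpoly_scal. apply (sep_haar _ g (sep_wk n) Hg). Qed.

Lemma rD_psi n w g : rsm g -> eqS (rD w (psi n g)) (psi n (rD w g)).
Proof.
  intros Hg. induction w as [|d w IH]; simpl. intros x _; auto.
  eapply eqS_trans. apply rl_ext, IH. intros x Hx. unfold psi. rewrite rl_scal. f_equal.
  apply rl_psi0; auto. now apply rsm_rD.
Qed.

(** By [modulus] the error is at most e / 2 plus C times the normalized mean of 1 - <x,y> = 2 (1 -
    w), that is 2 C (1 - cst (S n) / cst n) = 3 C / (n + 3), uniformly in x. *)
Lemma psi_approx h e : ccont h -> 0 < e ->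
  exists n0, forall n, (n0 <= n)%nat -> forall x, inSU2 x -> Rabs (psi n h x - h x) <= e.
Proof.
  intros Hh He. destruct (modulus h (e / 2) Hh) as (C & PC & HC). lra.
  (* The 6 yields 3 C / (n + 3) <= e / 2; C + 1 replaces C because C may be zero. *)
  destruct (archimed_cor1 (e / (6 * (C + 1)))) as (n0 & Hn0 & Pn0).
  { apply Rdiv_lt_0_compat; lra. }
  exists n0. intros n Hn x Hx.
  assert (CW : forall n, ccont (fun y => wk x y ^ n)) by (intros; apply rpoly_ccont, rpoly_pow, rpoly_wk).
  assert (Pc := cst_pos n). generalize (pos_INR n). intros Pn.
  assert (X : Rabs (psi0 n h x - cst n * h x) <= (e / 2) * cst n + (2 * C) * (cst n - cst (S n))).
  { assert (E1 : psi0 n h x - cst n * h x = haarR (fun y => wk x y ^ n * h y + (- h x) * wk x y ^ n)).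
    { unfold psi0. rewrite haarR_plus, haarR_scal, haar_wk; auto. ring. apply ccont_mult; auto.
      apply ccont_mult; auto using ccont_const. }
    pose (B := fun y => (e / 2 + 2 * C) * wk x y ^ n + (- (2 * C)) * wk x y ^ S n).
    assert (CB : ccont B) by (apply ccont_plus; (apply ccont_mult; [apply ccont_const|apply CW])).
    assert (E2 : (e / 2) * cst n + (2 * C) * (cst n - cst (S n)) = haarR B).
    { unfold B. rewrite haarR_plus.
      rewrite (haarR_scal _ (fun y => wk x y ^ n)) by apply CW.
      rewrite (haarR_scal _ (fun y => wk x y ^ S n)) by apply CW. rewrite !haar_wk by auto. ring.
      apply ccont_mult; [apply ccont_const|apply CW]. apply ccont_mult; [apply ccont_const|apply CW]. }
    rewrite E1, E2.
    assert (CC : ccont (fun y => wk x y ^ n * h y + (- h x) * wk x y ^ n)).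
    { apply ccont_plus; apply ccont_mult; auto using ccont_const. }
    assert (PT : forall y, inSU2 y -> Rabs (wk x y ^ n * h y + (- h x) * wk x y ^ n) <= B y).
    { intros y Hy. replace (wk x y ^ n * h y + - h x * wk x y ^ n) with (wk x y ^ n * (h y - h x)) by ring.
      rewrite Rabs_mult. assert (D := dot_bound x y Hx Hy).
      assert (W : 0 <= wk x y ^ n) by (apply pow_le; unfold wk; lra).
      rewrite (Rabs_pos_eq _ W).
      replace (B y) with (wk x y ^ n * (e / 2 + C * (1 - dot x y))).
      apply Rmult_le_compat_l; auto.
      replace (dot x y) with (2 * wk x y - 1) by (unfold wk; field). unfold B. simpl. ring. }
    apply Rabs_le. split.
    - replace (- haarR B) with (haarR (fun y => (-1) * B y)) by (rewrite haarR_scal by auto; ring).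
      apply haarR_le; auto. apply ccont_mult; auto using ccont_const.
      intros y Hy. generalize (PT y Hy). intros K. apply Rabs_le_between in K. lra.
    - apply haarR_le; auto. intros y Hy. generalize (PT y Hy). intros K. apply Rabs_le_between in K. lra. }
  unfold psi. replace (/ cst n * psi0 n h x - h x) with (/ cst n * (psi0 n h x - cst n * h x)) by (field; lra).
  rewrite Rabs_mult, (Rabs_pos_eq (/ cst n)) by (left; now apply Rinv_0_lt_compat).
  apply Rmult_le_reg_l with (cst n); auto. rewrite <- Rmult_assoc, Rinv_r, Rmult_1_l by lra.
  eapply Rle_trans. apply X. simpl cst.
  replace (e / 2 * cst n + 2 * C * (cst n - cst n * ((2 * INR n + 3) / (2 * INR n + 6)))) with
    (cst n * (e / 2 + 2 * C * (3 / (2 * INR n + 6)))) by (field; lra).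
  apply Rmult_le_compat_l. lra.
  assert (Y : / INR n0 >= / (INR n + 3)).
  { apply Rle_ge, Rinv_le_contravar. now apply lt_0_INR. apply le_INR in Hn. lra. }
  assert (2 * C * (3 / (2 * INR n + 6)) <= e / 2); [|lra].
  replace (2 * C * (3 / (2 * INR n + 6))) with (3 * C * / (INR n + 3)) by (field; lra).
  apply Rle_trans with (3 * C * (e / (6 * (C + 1)))).
  apply Rmult_le_compat_l; lra.
  replace (e / 2) with (3 * (C + 1) * (e / (6 * (C + 1)))) by (field; lra).
  apply Rmult_le_compat_r. left; apply Rdiv_lt_0_compat; lra. lra.
Qed.

(** Induction on the order, with g replaced by its three first derivatives, gives a common n for the
    finitely many words. The letter peeled off is the last of w, which acts first. *)
Lemma psi_approx_words k : forall g e, rsm g -> 0 < e ->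
  exists n0, forall n, (n0 <= n)%nat -> forall w, (length w <= k)%nat ->
  forall x, inSU2 x -> Rabs (psi n (rD w g) x - rD w g x) <= e.
Proof.
  induction k as [|k IH]; intros g e Hg He.
  - destruct (psi_approx g e (rsm_ccont _ Hg) He) as [n0 H]. exists n0. intros n Hn [|d w] Hw.
    simpl. auto. simpl in Hw. lia.
  - destruct (psi_approx g e (rsm_ccont _ Hg) He) as [n0 H].
    destruct (IH (rl D0 g) e (rsm_rl _ _ Hg) He) as [m0 H0].
    destruct (IH (rl D1 g) e (rsm_rl _ _ Hg) He) as [m1 H1].
    destruct (IH (rl D2 g) e (rsm_rl _ _ Hg) He) as [m2 H2].
    exists (n0 + m0 + m1 + m2)%nat. intros n Hn w Hw.
    destruct w as [|d w _] using rev_ind.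
    + simpl. intros. apply H; auto. lia.
    + rewrite length_app in Hw. simpl in Hw. rewrite <- rD_app.
      destruct d; [apply H0|apply H1|apply H2]; lia.
Qed.

Lemma density g k e : rsm g -> 0 < e -> exists P, rpoly P /\
  forall w, (length w <= k)%nat -> forall x, inSU2 x -> Rabs (rD w g x - rD w P x) <= e.
Proof.
  intros Hg He. destruct (psi_approx_words k g e Hg He) as [n H].
  exists (psi n g). split. now apply rpoly_psi, rsm_ccont.
  intros w Hw x Hx. rewrite (rD_psi n w g Hg x Hx), Rabs_minus_sym. apply (H n); auto.
Qed.

(** * Complex-valued functions *)

Definition re (phi : pt -> C) : pt -> R := fun x => fst (phi x).
Definition im (phi : pt -> C) : pt -> R := fun x => snd (phi x).

Lemma Dw_comp w phi : Dw w phi = fun x => (rD w (re phi) x, rD w (im phi) x).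
Proof.
  induction w as [|d w IH]; simpl.
  - apply functional_extensionality. intros x. unfold re, im. now destruct (phi x).
  - rewrite IH. reflexivity.
Qed.

Lemma smooth_comp phi : smooth phi <-> rsm (re phi) /\ rsm (im phi).
Proof.
  unfold smooth. split.
  - intros H. split; intros w; destruct (H w) as [H1 H2]; rewrite Dw_comp in H1, H2; split.
    + intros d x Hx. apply (H1 d x Hx).
    + intros x Hx. apply filterlim_locally. intros eps.
      generalize (proj1 (filterlim_locally _ _) (H2 x Hx) eps). apply filter_imp. intros y Hy; apply Hy.
    + intros d x Hx. apply (H1 d x Hx).
    + intros x Hx. apply filterlim_locally. intros eps.
      generalize (proj1 (filterlim_locally _ _) (H2 x Hx) eps). apply filter_imp. intros y Hy; apply Hy.
  - intros [H1 H2] w. destruct (H1 w) as [A1 B1], (H2 w) as [A2 B2]. rewrite Dw_comp. split.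
    + intros d x Hx. split. now apply A1. now apply A2.
    + intros x Hx. apply filterlim_locally. intros eps.
      generalize (filter_and _ _ (proj1 (filterlim_locally _ _) (B1 x Hx) eps) (proj1 (filterlim_locally _ _) (B2 x Hx) eps)).
      apply filter_imp. intros y [? ?]; now split.
Qed.

Lemma smooth_pair f g : rsm f -> rsm g -> smooth (fun x => (f x, g x)).
Proof. intros. apply smooth_comp. now split. Qed.

Lemma smooth_ext phi psi : eqS phi psi -> smooth phi -> smooth psi.
Proof.
  rewrite !smooth_comp. intros E [H1 H2]. split;
  [apply (rsm_ext (re phi))|apply (rsm_ext (im phi))]; auto; intros x Hx; unfold re, im; now rewrite E.
Qed.

Lemma smooth_plus phi psi : smooth phi -> smooth psi -> smooth (fun x => Cplus (phi x) (psi x)).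
Proof. rewrite !smooth_comp. intros [] []. split; [apply (rsm_plus (re phi))|apply (rsm_plus (im phi))]; auto. Qed.

Lemma rsm_minus g h : rsm g -> rsm h -> rsm (fun x => g x - h x).
Proof.
  intros Hg Hh. apply rsm_ext with (fun x => g x + (-1) * h x). intros x _; ring.
  apply rsm_plus; auto. now apply rsm_scal.
Qed.

Lemma smooth_mult phi psi : smooth phi -> smooth psi -> smooth (fun x => Cmult (phi x) (psi x)).
Proof.
  rewrite !smooth_comp. intros [] []. split.
  apply (rsm_minus (fun x => re phi x * re psi x) (fun x => im phi x * im psi x)); now apply rsm_mult.
  apply (rsm_plus (fun x => re phi x * im psi x) (fun x => im phi x * re psi x)); now apply rsm_mult.
Qed.

Lemma smooth_const c : smooth (fun _ => c).
Proof. apply smooth_comp. split. exact (rsm_const (fst c)). exact (rsm_const (snd c)). Qed.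

Lemma smooth_scal c phi : smooth phi -> smooth (fun x => Cmult c (phi x)).
Proof. intros. apply (smooth_mult (fun _ => c)); auto. apply smooth_const. Qed.

Lemma smooth_conj phi : smooth phi -> smooth (fun x => Cconj (phi x)).
Proof.
  rewrite !smooth_comp. intros [H1 H2]. split. exact H1.
  apply rsm_ext with (fun x => (-1) * im phi x). intros x _. unfold im, Cconj; simpl; ring. now apply rsm_scal.
Qed.

Lemma d0_comp phi x : d0 phi x = (rl D0 (re phi) x, rl D0 (im phi) x).
Proof. reflexivity. Qed.

Lemma smooth_d0 phi : smooth phi -> smooth (d0 phi).
Proof. rewrite smooth_comp. intros []. apply (smooth_pair (rl D0 (re phi)) (rl D0 (im phi))); now apply rsm_rl. Qed.

Lemma d0_ext phi psi : eqS phi psi -> eqS (d0 phi) (d0 psi).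
Proof.
  intros E x Hx. rewrite !d0_comp. f_equal; apply rl_ext; auto; intros y Hy; unfold re, im; now rewrite E.
Qed.

Lemma d0_plus phi psi x : smooth phi -> smooth psi -> inSU2 x ->
  d0 (fun x => Cplus (phi x) (psi x)) x = Cplus (d0 phi x) (d0 psi x).
Proof.
  rewrite !smooth_comp. intros [A B] [A' B'] Hx. unfold Cplus. rewrite !d0_comp. simpl. f_equal.
  apply (rl_plus D0 (re phi) (re psi)); auto using rsm_der.
  apply (rl_plus D0 (im phi) (im psi)); auto using rsm_der.
Qed.

Lemma rl_minus d g h x : der g -> der h -> inSU2 x ->
  rl d (fun x => g x - h x) x = rl d g x - rl d h x.
Proof.
  intros Hg Hh Hx. rewrite (rl_ext d _ (fun x => g x + (-1) * h x)); auto. 2: intros y _; ring.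
  rewrite rl_plus, rl_scal; auto. ring. apply der_mult; auto. apply der_const.
Qed.

Lemma d0_mult phi psi x : smooth phi -> smooth psi -> inSU2 x ->
  d0 (fun x => Cmult (phi x) (psi x)) x = Cplus (Cmult (d0 phi x) (psi x)) (Cmult (phi x) (d0 psi x)).
Proof.
  rewrite !smooth_comp. intros [A B] [A' B'] Hx. rewrite !d0_comp.
  assert (DA := rsm_der _ A). assert (DB := rsm_der _ B). assert (DA' := rsm_der _ A'). assert (DB' := rsm_der _ B').
  transitivity (rl D0 (fun x => re phi x * re psi x - im phi x * im psi x) x, rl D0 (fun x => re phi x * im psi x + im phi x * re psi x) x).
  reflexivity.
  rewrite rl_minus, rl_plus, !rl_mult; auto using der_mult.
  unfold Cplus, Cmult. simpl. unfold re, im. f_equal; ring.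
Qed.

Lemma d0_const c x : d0 (fun _ => c) x = RtoC 0.
Proof. rewrite d0_comp. unfold re, im. now rewrite !rl_const. Qed.

Lemma d0_scal c phi x : smooth phi -> inSU2 x -> d0 (fun x => Cmult c (phi x)) x = Cmult c (d0 phi x).
Proof.
  intros H Hx. rewrite (d0_mult (fun _ => c)); auto using smooth_const. rewrite d0_const. ring.
Qed.

Lemma d0_conj phi x : d0 (fun x => Cconj (phi x)) x = Cconj (d0 phi x).
Proof.
  rewrite !d0_comp. unfold Cconj. simpl. f_equal.
  transitivity (rl D0 (fun x => (-1) * im phi x) x).
  f_equal. apply functional_extensionality. intros; unfold im; simpl; ring.
  rewrite rl_scal. ring.
Qed.

Lemma semibound_comp k phi M : semibound k phi M ->
  (forall w, (length w <= k)%nat -> forall x, inSU2 x -> Rabs (rD w (re phi) x) <= M) /\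
  (forall w, (length w <= k)%nat -> forall x, inSU2 x -> Rabs (rD w (im phi) x) <= M).
Proof.
  intros H. split; intros w Hw x Hx; specialize (H w Hw x Hx); rewrite Dw_comp in H;
  eapply Rle_trans; try apply H; (eapply Rle_trans; [|apply Rmax_Cmod]); simpl.
  apply Rmax_l. apply Rmax_r.
Qed.

Lemma Cmod_le_sum (z : C) : Cmod z <= Rabs (fst z) + Rabs (snd z).
Proof.
  replace z with (Cplus (RtoC (fst z)) (Cmult Ci (RtoC (snd z)))) at 1.
  - eapply Rle_trans. apply Cmod_triangle. rewrite Cmod_mult, !Cmod_R.
    assert (E : Cmod Ci = 1).
    { unfold Cmod, Ci; simpl. replace (0 * (0 * 1) + 1 * (1 * 1)) with 1 by ring. apply sqrt_1. }
    rewrite E. lra.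
  - destruct z; unfold Cplus, Cmult, Ci, RtoC; simpl. f_equal; ring.
Qed.

Lemma comp_semibound k phi M M' :
  (forall w, (length w <= k)%nat -> forall x, inSU2 x -> Rabs (rD w (re phi) x) <= M) ->
  (forall w, (length w <= k)%nat -> forall x, inSU2 x -> Rabs (rD w (im phi) x) <= M') ->
  semibound k phi (M + M').
Proof.
  intros H H' w Hw x Hx. rewrite Dw_comp. eapply Rle_trans. apply Cmod_le_sum. simpl.
  apply Rplus_le_compat; auto.
Qed.

(** * Complex weights *)

Definition wcont (om : R -> C) : Prop :=
  (forall t, continuous (fun t => fst (om t)) t) /\ (forall t, continuous (fun t => snd (om t)) t).

(** The fibre average of phi against a complex weight, with the complex product expanded into real
    averages. *)
Definition cA (om : R -> C) (phi : pt -> C) : pt -> C := fun x =>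
  (Aop (fun t => fst (om t)) (re phi) x - Aop (fun t => snd (om t)) (im phi) x,
   Aop (fun t => fst (om t)) (im phi) x + Aop (fun t => snd (om t)) (re phi) x).

Lemma smooth_cA om phi : wcont om -> smooth phi -> smooth (cA om phi).
Proof.
  rewrite (smooth_comp phi). intros [] []. apply smooth_pair.
  apply rsm_minus; now apply rsm_Aop. apply rsm_plus; now apply rsm_Aop.
Qed.

Lemma cA_ext om phi psi : eqS phi psi -> eqS (cA om phi) (cA om psi).
Proof.
  intros E x Hx. unfold cA.
  assert (E1 : eqS (re phi) (re psi)) by (intros y Hy; unfold re; now rewrite E).
  assert (E2 : eqS (im phi) (im psi)) by (intros y Hy; unfold im; now rewrite E).
  now rewrite !(Aop_ext _ _ _ E1 x Hx), !(Aop_ext _ _ _ E2 x Hx).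
Qed.

Lemma cA_plus om phi psi x : wcont om -> smooth phi -> smooth psi -> inSU2 x ->
  cA om (fun x => Cplus (phi x) (psi x)) x = Cplus (cA om phi x) (cA om psi x).
Proof.
  rewrite !smooth_comp. intros [O1 O2] [A B] [A' B'] Hx. unfold cA, Cplus. simpl.
  assert (X := fun om H => Aop_plus om (re phi) (re psi) x H (rsm_ccont _ A) (rsm_ccont _ A') Hx).
  assert (Y := fun om H => Aop_plus om (im phi) (im psi) x H (rsm_ccont _ B) (rsm_ccont _ B') Hx).
  change (re (fun x0 => (fst (phi x0) + fst (psi x0), snd (phi x0) + snd (psi x0)))) with (fun x => re phi x + re psi x).
  change (im (fun x0 => (fst (phi x0) + fst (psi x0), snd (phi x0) + snd (psi x0)))) with (fun x => im phi x + im psi x).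
  rewrite !X, !Y by auto. f_equal; ring.
Qed.

Lemma cA_scal om c phi x : wcont om -> smooth phi -> inSU2 x ->
  cA om (fun x => Cmult c (phi x)) x = Cmult c (cA om phi x).
Proof.
  rewrite !smooth_comp. intros [O1 O2] [A B] Hx. unfold cA, Cmult. simpl.
  assert (CA := rsm_ccont _ A). assert (CB := rsm_ccont _ B).
  assert (X : forall om, (forall t, continuous om t) -> Aop om (re (fun x0 => (fst c * fst (phi x0) - snd c * snd (phi x0), fst c * snd (phi x0) + snd c * fst (phi x0)))) x = fst c * Aop om (re phi) x + (- snd c) * Aop om (im phi) x).
  { intros o Ho. rewrite <- !Aop_scal, <- Aop_plus; auto.
    apply Aop_ext; auto. intros y _; unfold re, im; simpl; ring.
    apply ccont_mult; auto using ccont_const. apply ccont_mult; auto using ccont_const. }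
  assert (Y : forall om, (forall t, continuous om t) -> Aop om (im (fun x0 => (fst c * fst (phi x0) - snd c * snd (phi x0), fst c * snd (phi x0) + snd c * fst (phi x0)))) x = fst c * Aop om (im phi) x + snd c * Aop om (re phi) x).
  { intros o Ho. rewrite <- !Aop_scal, <- Aop_plus; auto.
    apply ccont_mult; auto using ccont_const. apply ccont_mult; auto using ccont_const. }
  rewrite !X, !Y by auto. f_equal; ring.
Qed.

Lemma cA_conj om phi x : smooth phi -> wcont om -> inSU2 x ->
  cA (fun t => Cconj (om t)) (fun x => Cconj (phi x)) x = Cconj (cA om phi x).
Proof.
  rewrite smooth_comp. intros [A B] [O1 O2] Hx. unfold cA, Cconj. simpl.
  assert (CA := rsm_ccont _ A). assert (CB := rsm_ccont _ B).
  change (re (fun x0 => (fst (phi x0), - snd (phi x0)))) with (re phi).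
  replace (im (fun x0 => (fst (phi x0), - snd (phi x0)))) with (fun x => (-1) * im phi x)
    by (apply functional_extensionality; intros; unfold im; simpl; ring).
  replace (fun t => - snd (om t)) with (fun t => (-1) * snd (om t))
    by (apply functional_extensionality; intros; ring).
  rewrite !Aop_om_scal, !Aop_scal; auto. f_equal; ring.
  apply ccont_mult; auto using ccont_const.
Qed.

Lemma cA_om_ext om om' phi x : (forall t, om t = om' t) -> cA om phi x = cA om' phi x.
Proof. intros E. replace om with om'; auto. apply functional_extensionality; auto. Qed.

Lemma cA_om_scal om c phi x : wcont om -> smooth phi -> inSU2 x ->
  cA (fun t => Cmult c (om t)) phi x = Cmult c (cA om phi x).
Proof.
  rewrite smooth_comp. intros [O1 O2] [A B] Hx. unfold cA, Cmult. simpl.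
  assert (CA := rsm_ccont _ A). assert (CB := rsm_ccont _ B).
  assert (X : forall g, ccont g -> Aop (fun t => fst c * fst (om t) - snd c * snd (om t)) g x = fst c * Aop (fun t => fst (om t)) g x + (- snd c) * Aop (fun t => snd (om t)) g x).
  { intros g Hg. rewrite <- !Aop_om_scal, <- Aop_om_plus; auto.
    apply Aop_ext_om; intros; ring. intros; apply Rcont_mult; auto; apply continuous_const.
    intros; apply Rcont_mult; auto; apply continuous_const. }
  assert (Y : forall g, ccont g -> Aop (fun t => fst c * snd (om t) + snd c * fst (om t)) g x = fst c * Aop (fun t => snd (om t)) g x + snd c * Aop (fun t => fst (om t)) g x).
  { intros g Hg. rewrite <- !Aop_om_scal, <- Aop_om_plus; auto.
    intros; apply Rcont_mult; auto; apply continuous_const.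
    intros; apply Rcont_mult; auto; apply continuous_const. }
  rewrite !X, !Y by auto. f_equal; ring.
Qed.

Lemma cA_om_plus om om' phi x : wcont om -> wcont om' -> smooth phi -> inSU2 x ->
  cA (fun t => Cplus (om t) (om' t)) phi x = Cplus (cA om phi x) (cA om' phi x).
Proof.
  rewrite smooth_comp. intros [O1 O2] [O1' O2'] [A B] Hx. unfold cA, Cplus. simpl.
  rewrite !(Aop_om_plus (fun t => fst (om t)) (fun t => fst (om' t))), !(Aop_om_plus (fun t => snd (om t)) (fun t => snd (om' t))); auto using rsm_ccont.
  f_equal; ring.
Qed.

Lemma d0_cA om phi : wcont om -> smooth phi -> eqS (d0 (cA om phi)) (cA om (d0 phi)).
Proof.
  rewrite smooth_comp. intros [O1 O2] [A B] x Hx. rewrite d0_comp.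
  assert (X := fun om (H : forall t, continuous om t) => rl0_Aop om (re phi) H A x Hx).
  assert (Y := fun om (H : forall t, continuous om t) => rl0_Aop om (im phi) H B x Hx).
  assert (X' : forall o, (forall t, continuous o t) -> der (Aop o (re phi))) by (intros; now apply rsm_der, rsm_Aop).
  assert (Y' : forall o, (forall t, continuous o t) -> der (Aop o (im phi))) by (intros; now apply rsm_der, rsm_Aop).
  unfold cA. f_equal.
  - etransitivity. apply (rl_minus D0 (Aop (fun t => fst (om t)) (re phi)) (Aop (fun t => snd (om t)) (im phi))); auto.
    rewrite X, Y by auto. reflexivity.
  - etransitivity. apply (rl_plus D0 (Aop (fun t => fst (om t)) (im phi)) (Aop (fun t => snd (om t)) (re phi))); auto.
    rewrite X, Y by auto. reflexivity.
Qed.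

Lemma cA_ibp om om' phi x :
  (forall t, is_derive (fun t => fst (om t)) t (fst (om' t))) ->
  (forall t, is_derive (fun t => snd (om t)) t (snd (om' t))) ->
  wcont om' -> smooth phi -> inSU2 x ->
  cA om (d0 phi) x = Cminus (Cmult (Cminus (om (4 * PI)) (om 0)) (phi x)) (cA om' phi x).
Proof.
  rewrite smooth_comp. intros D1' D2' [O1 O2] [A B] Hx. unfold cA.
  change (re (d0 phi)) with (rl D0 (re phi)). change (im (d0 phi)) with (rl D0 (im phi)).
  rewrite !(Aop_ibp (fun t => fst (om t)) (fun t => fst (om' t))), !(Aop_ibp (fun t => snd (om t)) (fun t => snd (om' t))); auto.
  unfold Cminus, Cmult, Cplus, Copp, re, im. simpl. f_equal; ring.
Qed.

(** No derivatives are lost, so the transpose acts on distributions. The constant combines the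
    length 4 pi of the orbit, the 3^k of [av_rl], the bound of the weight, and 4 for two real
    averages in each of two components. *)
Lemma cA_semibound om k : wcont om -> exists K, forall phi M, smooth phi -> semibound k phi M ->
  semibound k (cA om phi) (K * M).
Proof.
  intros [O1 O2]. destruct (bounded_on _ O1) as [B1 H1], (bounded_on _ O2) as [B2 H2].
  set (B := Rmax B1 B2).
  assert (H1' : forall t, 0 <= t <= 4 * PI -> Rabs (fst (om t)) <= B).
  { intros t Ht. eapply Rle_trans. now apply H1. apply Rmax_l. }
  assert (H2' : forall t, 0 <= t <= 4 * PI -> Rabs (snd (om t)) <= B).
  { intros t Ht. eapply Rle_trans. now apply H2. apply Rmax_r. }
  assert (PB : 0 <= B).
  { generalize (H1' 0 (conj (Rle_refl 0) PI4)) (Rabs_pos (fst (om 0))). lra. }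
  set (L := 4 * PI * (3 ^ k * B)).
  exists (4 * L). intros phi M Hs Hb.
  assert (PM : 0 <= M).
  { eapply Rle_trans. 2: apply (Hb nil (Nat.le_0_l k) one inSU2_one). apply Cmod_ge_0. }
  destruct (semibound_comp _ _ _ Hb) as [Sr Si].
  apply smooth_comp in Hs. destruct Hs as [Rr Ri].
  assert (E : forall o g w, (forall t, continuous o t) -> (forall t, 0 <= t <= 4 * PI -> Rabs (o t) <= B) -> rsm g ->
    (forall w, (length w <= k)%nat -> forall x, inSU2 x -> Rabs (rD w g x) <= M) -> (length w <= k)%nat ->
    forall x, inSU2 x -> Rabs (rD w (Aop o g) x) <= L * M).
  { intros o g w Ho HB Hg Hg' Hw x Hx. eapply Rle_trans.
    apply (Aop_semibound o B w Ho HB g M Hg); auto. intros v Hv; apply Hg'; lia.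
    unfold L. rewrite !Rmult_assoc. apply Rmult_le_compat_l. lra.
    apply Rmult_le_compat_l. generalize PI_RGT_0; lra.
    apply Rmult_le_compat_r. now apply Rmult_le_pos. apply Rle_pow; auto; lra. }
  replace (4 * L * M) with ((L * M + L * M) + (L * M + L * M)) by ring.
  apply comp_semibound; intros w Hw x Hx.
  - rewrite (rD_ext w _ (fun x => Aop (fun t => fst (om t)) (re phi) x + (-1) * Aop (fun t => snd (om t)) (im phi) x)); auto.
    2: intros y _; unfold re at 1, cA; cbn [fst snd]; ring.
    rewrite rD_plus, rD_scal; auto using rsm_Aop, rsm_scal.
    eapply Rle_trans. apply Rabs_triang. apply Rplus_le_compat. now apply E.
    rewrite Rabs_mult. replace (Rabs (-1)) with 1 by (rewrite Rabs_left; lra). rewrite Rmult_1_l. now apply E.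
  - rewrite (rD_ext w _ (fun x => Aop (fun t => fst (om t)) (im phi) x + Aop (fun t => snd (om t)) (re phi) x)); auto.
    2: intros y _; unfold im at 1, cA; cbn [fst snd]; ring.
    rewrite rD_plus; auto using rsm_Aop.
    eapply Rle_trans. apply Rabs_triang. apply Rplus_le_compat; now apply E.
Qed.

(** * Exponential weights, resolvents and spectral projections of d0 *)

Definition Ew (l : C) (t : R) : C :=
  (exp (- (fst l * t)) * cos (snd l * t), - (exp (- (fst l * t)) * sin (snd l * t))).

Definition res (l : C) : Prop := Ew l (4 * PI) = RtoC 1.

(** The weight e^{-lt} / (4 pi) of the projection onto the l-eigenspace. Setting it to zero off
    resonance, where that eigenspace is trivial, keeps all later identities uniform in l. *)
Definition omP (l : C) (t : R) : C :=
  if excluded_middle_informative (res l) then Cmult (RtoC (/ (4 * PI))) (Ew l t) else RtoC 0.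

(** In both cases the weight solves om' = - l om + [omP l] with jump om(4 pi) - om(0) = 1, which by
    [cA_ibp] is the resolvent identity B (d0 - l) = 1 - Pi. At resonance the jump comes from the
    factor t / (4 pi). *)
Definition omB (l : C) (t : R) : C :=
  if excluded_middle_informative (res l) then Cmult (RtoC (t / (4 * PI))) (Ew l t)
  else Cmult (Cinv (Cminus (Ew l (4 * PI)) (RtoC 1))) (Ew l t).

Lemma Ew_0 l : Ew l 0 = RtoC 1.
Proof. unfold Ew, RtoC. rewrite !Rmult_0_r, Ropp_0, exp_0, cos_0, sin_0. f_equal; ring. Qed.

Lemma Ew_conj l t : Ew (Cconj l) t = Cconj (Ew l t).
Proof.
  unfold Ew, Cconj. simpl. replace (- snd l * t) with (- (snd l * t)) by ring.
  rewrite cos_neg, sin_neg. f_equal; ring.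
Qed.

Lemma res_conj l : res (Cconj l) <-> res l.
Proof.
  unfold res. rewrite Ew_conj. split; intros H.
  - rewrite <- (Cconj_conj (Ew l (4 * PI))), H. unfold Cconj, RtoC; simpl. now rewrite Ropp_0.
  - rewrite H. unfold Cconj, RtoC; simpl. now rewrite Ropp_0.
Qed.

Lemma omP_conj l t : omP (Cconj l) t = Cconj (omP l t).
Proof.
  assert (H := res_conj l). unfold omP.
  destruct (excluded_middle_informative (res (Cconj l))), (excluded_middle_informative (res l)); try tauto.
  - rewrite Cmult_conj, Ew_conj. f_equal. unfold Cconj, RtoC; simpl. now rewrite Ropp_0.
  - unfold Cconj, RtoC; simpl. now rewrite Ropp_0.
Qed.

Lemma wcont_omP l : wcont (omP l).
Proof.
  unfold omP. destruct (excluded_middle_informative (res l)); split; intros t; unfold Ew, Cmult; simpl; ctac.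
Qed.

Lemma wcont_omB l : wcont (omB l).
Proof.
  unfold omB. destruct (excluded_middle_informative (res l)); split; intros t; unfold Ew, Cmult; simpl; ctac.
Qed.

Lemma wcont_scal c om : wcont om -> wcont (fun t => Cmult c (om t)).
Proof.
  intros [H1 H2]. split; intros t; unfold Cmult; cbn [fst snd].
  apply Rcont_minus; apply Rcont_mult; auto; apply continuous_const.
  apply Rcont_plus; apply Rcont_mult; auto; apply continuous_const.
Qed.

Lemma omP_bd l : omP l (4 * PI) = omP l 0.
Proof.
  unfold omP. destruct (excluded_middle_informative (res l)) as [H|H]; auto. now rewrite H, Ew_0.
Qed.

Lemma omB_bd l : Cminus (omB l (4 * PI)) (omB l 0) = RtoC 1.
Proof.
  unfold omB. assert (P := PI_RGT_0). destruct (excluded_middle_informative (res l)) as [H|H].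
  - rewrite H, Ew_0. unfold Rdiv. rewrite Rinv_r by lra. rewrite Rmult_0_l. ring.
  - rewrite Ew_0. field. intros E. apply H. unfold res.
    replace (Ew l (4 * PI)) with (Cplus (Cminus (Ew l (4 * PI)) (RtoC 1)) (RtoC 1)) by ring. rewrite E. ring.
Qed.

Lemma omP_derive l t :
  is_derive (fun t => fst (omP l t)) t (fst (Cmult (Copp l) (omP l t))) /\
  is_derive (fun t => snd (omP l t)) t (snd (Cmult (Copp l) (omP l t))).
Proof.
  unfold omP. destruct (excluded_middle_informative (res l)); unfold Ew, Cmult, Copp; simpl; split;
  auto_derive; auto; ring.
Qed.

Lemma omB_derive l t :
  is_derive (fun t => fst (omB l t)) t (fst (Cplus (omP l t) (Cmult (Copp l) (omB l t)))) /\
  is_derive (fun t => snd (omB l t)) t (snd (Cplus (omP l t) (Cmult (Copp l) (omB l t)))).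
Proof.
  assert (P := PI_RGT_0).
  unfold omP, omB. destruct (excluded_middle_informative (res l)).
  - unfold Ew, Cmult, Copp, Cplus; simpl; split; auto_derive; auto; field; lra.
  - generalize (Cinv (Cminus (Ew l (4 * PI)) (RtoC 1))). intros z.
    unfold Ew, Cmult, Copp, Cplus; simpl; split; auto_derive; auto; ring.
Qed.

Definition Pop (l : C) : (pt -> C) -> pt -> C := cA (omP l).
Definition Bop (l : C) : (pt -> C) -> pt -> C := cA (omB l).

Lemma Pop_d0 l phi x : smooth phi -> inSU2 x -> Pop l (d0 phi) x = Cmult l (Pop l phi x).
Proof.
  intros H Hx. unfold Pop. assert (W := wcont_omP l).
  rewrite (cA_ibp (omP l) (fun t => Cmult (Copp l) (omP l t))); auto.
  - rewrite omP_bd, cA_om_scal by auto. ring.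
  - intros t; apply omP_derive.
  - intros t; apply omP_derive.
  - now apply wcont_scal.
Qed.

Lemma Bop_d0 l phi x : smooth phi -> inSU2 x ->
  Bop l (d0 phi) x = Cplus (Cminus (phi x) (Pop l phi x)) (Cmult l (Bop l phi x)).
Proof.
  intros H Hx. unfold Pop, Bop. assert (W := wcont_omP l). assert (W' := wcont_omB l).
  assert (S : wcont (fun t => Cmult (Copp l) (omB l t))).
  { now apply wcont_scal. }
  rewrite (cA_ibp (omB l) (fun t => Cplus (omP l t) (Cmult (Copp l) (omB l t)))); auto.
  - rewrite omB_bd, (cA_om_plus (omP l)), cA_om_scal by auto. ring.
  - intros t; apply omB_derive.
  - intros t; apply omB_derive.
  - destruct W, S. split; intros t; cbn [fst snd Cplus]; apply Rcont_plus; auto.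
Qed.

Lemma d0_Pop l phi x : smooth phi -> inSU2 x -> d0 (Pop l phi) x = Cmult l (Pop l phi x).
Proof. intros H Hx. rewrite <- Pop_d0 by auto. apply d0_cA; auto using wcont_omP. Qed.

Lemma d0_Bop l phi x : smooth phi -> inSU2 x ->
  d0 (Bop l phi) x = Cplus (Cminus (phi x) (Pop l phi x)) (Cmult l (Bop l phi x)).
Proof. intros H Hx. rewrite <- Bop_d0 by auto. apply d0_cA; auto using wcont_omB. Qed.

Lemma Pop_conj l phi x : smooth phi -> inSU2 x ->
  Pop (Cconj l) (fun x => Cconj (phi x)) x = Cconj (Pop l phi x).
Proof.
  intros H Hx. unfold Pop. rewrite <- cA_conj by auto using wcont_omP.
  apply cA_om_ext. intros; apply omP_conj.
Qed.

Lemma smooth_Pop l phi : smooth phi -> smooth (Pop l phi).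
Proof. apply smooth_cA, wcont_omP. Qed.
Lemma smooth_Bop l phi : smooth phi -> smooth (Bop l phi).
Proof. apply smooth_cA, wcont_omB. Qed.

(** Inserting d0 phi = m phi into [Bop_d0] leaves Pi phi = phi when l = m; inserting it into
    [Pop_d0] leaves (l - m) Pi phi = 0. *)
Lemma eigen_Pop l m phi x : smooth phi -> (forall x, inSU2 x -> d0 phi x = Cmult m (phi x)) -> inSU2 x ->
  (l = m -> Pop l phi x = phi x) /\ (l <> m -> Pop l phi x = RtoC 0).
Proof.
  intros H E Hx.
  assert (E' : eqS (d0 phi) (fun x => Cmult m (phi x))) by exact E.
  split; intros Hl.
  - assert (K := Bop_d0 l phi x H Hx). unfold Bop in K.
    rewrite (cA_ext _ _ _ E' x Hx), cA_scal in K by auto using wcont_omB.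
    rewrite <- Hl in K. fold (Bop l phi x) in K.
    replace (Pop l phi x) with (Cminus (Cplus (phi x) (Cmult l (Bop l phi x))) (Cplus (Cminus (phi x) (Pop l phi x)) (Cmult l (Bop l phi x)))) by ring.
    change (cA (omB l) phi x) with (Bop l phi x) in K. rewrite <- K. ring.
  - assert (K := Pop_d0 l phi x H Hx). unfold Pop in K.
    rewrite (cA_ext _ _ _ E' x Hx), cA_scal in K by auto using wcont_omP.
    change (cA (omP l) phi x) with (Pop l phi x) in K.
    assert (N : Cminus l m <> RtoC 0).
    { intros Z. apply Hl. replace l with (Cplus (Cminus l m) m) by ring. rewrite Z; ring. }
    replace (Pop l phi x) with (Cmult (Cinv (Cminus l m)) (Cminus (Cmult l (Pop l phi x)) (Cmult m (Pop l phi x)))) by (field; auto).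
    rewrite <- K. ring.
Qed.

Open Scope C_scope.

(** * Reduction to the resonant part *)

(** The quadratic has real coefficients and discriminant 4 (|p|^2 - (Im q)^2). The last clause
    records that conjugation preserves the set of roots; since it maps the l-eigenspace to the one
    of conj l, the resonant solution depends on this. *)
Lemma char_roots (p q : C) : exists l1 l2 : C,
  l1 + l2 = q + Cconj q /\ l1 * l2 = q * Cconj q - p * Cconj p /\
  ((Cconj l1 = l1 /\ Cconj l2 = l2) \/ (Cconj l1 = l2 /\ l1 <> l2)).
Proof.
  destruct p as [a b], q as [c d].
  unfold Cplus, Cmult, Cminus, Copp, Cconj, RtoC; simpl.
  destruct (Rle_lt_dec 0 (a * a + b * b - d * d)) as [H|H].
  - assert (S := sqrt_sqrt _ H). revert S. generalize (sqrt (a * a + b * b - d * d)). intros s S.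
    exists (c + s, 0)%R, (c - s, 0)%R. simpl. split; [f_equal; ring|split].
    + apply (f_equal2 pair); simpl; [|ring]. transitivity (c * c - s * s)%R. ring. rewrite S. ring.
    + left. split; apply (f_equal2 pair); ring.
  - assert (H1 : (0 <= - (a * a + b * b - d * d))%R) by lra.
    assert (H2 : (0 < - (a * a + b * b - d * d))%R) by lra.
    assert (S := sqrt_sqrt _ H1). assert (P := sqrt_lt_R0 _ H2). revert S P.
    generalize (sqrt (- (a * a + b * b - d * d))). intros s S P.
    exists (c, s)%R, (c, - s)%R. simpl. split; [apply (f_equal2 pair); ring|split].
    + apply (f_equal2 pair); simpl; [|ring]. transitivity (c * c + s * s)%R. ring. rewrite S. ring.
    + right. split; auto. intros E; injection E; lra.
Qed.

(** Elements are functions on X compared only on dom: points of SU(2) for functions, smooth test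
    functions for distributions. The map c on scalars treats linear operators and the antilinear
    conjugation alike. *)
Definition lin_on {X : Type} (dom : X -> Prop) (G : (X -> C) -> Prop) (c : C -> C)
  (T : (X -> C) -> X -> C) : Prop :=
  (forall f, G f -> G (T f)) /\
  (forall f g, G f -> G g -> (forall x, dom x -> f x = g x) -> forall x, dom x -> T f x = T g x) /\
  (forall a f b g, G f -> G g -> forall x, dom x ->
     T (fun x => a * f x + b * g x) x = c a * T f x + c b * T g x).

(** Once r solves the resonant part, the remainder g is annihilated by both projections; two
    successive resolvents then solve (d - l1)(d - l2) v = g, and u = Q v + r with Q v = d v - conj q
    v + p J v. *)
Lemma abstract_solve (X : Type) (dom : X -> Prop) (G : (X -> C) -> Prop)
  (d J : (X -> C) -> X -> C) (B Pi : C -> (X -> C) -> X -> C) (p q : C) :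
  p <> 0 ->
  (forall a f b g, G f -> G g -> G (fun x => a * f x + b * g x)) ->
  lin_on dom G (fun z => z) d -> lin_on dom G Cconj J ->
  (forall l, lin_on dom G (fun z => z) (B l)) -> (forall l, lin_on dom G (fun z => z) (Pi l)) ->
  (forall f, G f -> forall x, dom x -> J (J f) x = f x) ->
  (forall f, G f -> forall x, dom x -> J (d f) x = d (J f) x) ->
  (forall l f, G f -> forall x, dom x -> J (Pi l f) x = Pi (Cconj l) (J f) x) ->
  (forall l f, G f -> forall x, dom x -> d (B l f) x = f x - Pi l f x + l * B l f x) ->
  (forall l f, G f -> forall x, dom x -> B l (d f) x = f x - Pi l f x + l * B l f x) ->
  (forall l f, G f -> forall x, dom x -> d (Pi l f) x = l * Pi l f x) ->
  (forall l f, G f -> forall x, dom x -> Pi l (d f) x = l * Pi l f x) ->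
  forall f, G f ->
  (forall l, (l - q) * (l - Cconj q) = p * Cconj p -> forall x, dom x ->
     (l - Cconj q) * Pi l f x + p * Pi l (J f) x = 0) ->
  exists u, G u /\ forall x, dom x -> d u x - q * u x - p * J u x = f x.
Proof.
  intros Hp Gc (Gd & Ed & Ld) (GJ & EJ & LJ) HB HPi JJ Jd JPi dB Bd dPi Pid f Gf Hf.
  assert (GB : forall l f, G f -> G (B l f)) by (intros l; apply HB).
  assert (GP : forall l f, G f -> G (Pi l f)) by (intros l; apply HPi).
  assert (EB : forall l f g, G f -> G g -> (forall x, dom x -> f x = g x) -> forall x, dom x -> B l f x = B l g x) by (intros l; apply HB).
  assert (EP : forall l f g, G f -> G g -> (forall x, dom x -> f x = g x) -> forall x, dom x -> Pi l f x = Pi l g x) by (intros l; apply HPi).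
  assert (LB : forall l a f b g, G f -> G g -> forall x, dom x -> B l (fun x => a * f x + b * g x) x = a * B l f x + b * B l g x) by (intros l; apply HB).
  assert (LP : forall l a f b g, G f -> G g -> forall x, dom x -> Pi l (fun x => a * f x + b * g x) x = a * Pi l f x + b * Pi l g x) by (intros l; apply HPi).
  clear HB HPi.
  assert (G0 : G (fun x => 0 * f x + 0 * f x)) by auto.
  assert (nz : forall a b : C, a <> b -> a - b <> 0).
  { intros a b H E. apply H. replace a with (a - b + b) by ring. rewrite E. ring. }
  assert (reg : forall a z : C, a <> 0 -> a * z = 0 -> z = 0).
  { intros a z Ha E. replace z with (/ a * (a * z)) by (field; auto). rewrite E. ring. }
  assert (conj0 : Cconj 0 = 0) by (unfold Cconj, RtoC; simpl; now rewrite Ropp_0).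
  assert (conj1 : Cconj 1 = 1) by (unfold Cconj, RtoC; simpl; now rewrite Ropp_0).
  (* This is where p <> 0 enters. *)
  assert (lq : forall l, (l - q) * (l - Cconj q) = p * Cconj p -> l - q <> 0 /\ l - Cconj q <> 0).
  { intros l E. assert (N : p * Cconj p <> 0).
    { apply Cmult_neq_0; auto. intros K. apply Hp. rewrite <- (Cconj_conj p), K, conj0. reflexivity. }
    split; intros K; apply N; rewrite <- E, K; ring. }
  (* Evaluating Pi l (d (Pi m g)) in two ways gives the factor l from the outer projection and m
     from the inner one. *)
  assert (PP0 : forall l m g, G g -> l <> m -> forall x, dom x -> Pi l (Pi m g) x = 0).
  { intros l m g Gg Hlm x Hx. apply (reg (l - m)); auto.
    assert (E1 := Pid l (Pi m g) (GP m g Gg) x Hx).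
    rewrite (EP l (d (Pi m g)) (fun x => m * Pi m g x + 0 * Pi m g x)) in E1; auto.
    2: intros y Hy; rewrite dPi by auto; ring.
    rewrite LP in E1 by auto.
    replace ((l - m) * Pi l (Pi m g) x) with (l * Pi l (Pi m g) x - m * Pi l (Pi m g) x) by ring.
    rewrite <- E1. ring. }
  assert (PP1 : forall l g, G g -> forall x, dom x -> Pi l (Pi l g) x = Pi l g x).
  { intros l g Gg x Hx.
    assert (E1 := Bd l (Pi l g) (GP l g Gg) x Hx).
    rewrite (EB l (d (Pi l g)) (fun x => l * Pi l g x + 0 * Pi l g x)) in E1; auto.
    2: intros y Hy; rewrite dPi by auto; ring.
    rewrite LB in E1 by auto.
    replace (Pi l (Pi l g) x) with (Pi l g x + l * B l (Pi l g) x - (Pi l g x - Pi l (Pi l g) x + l * B l (Pi l g) x)) by ring.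
    rewrite <- E1. ring. }
  destruct (char_roots p q) as (l1 & l2 & Hs & Hm & Hc).
  assert (R1 : (l1 - q) * (l1 - Cconj q) = p * Cconj p).
  { replace ((l1 - q) * (l1 - Cconj q)) with (l1 * l1 - l1 * (q + Cconj q) + q * Cconj q) by ring.
    rewrite <- Hs. replace (q * Cconj q) with (l1 * l2 + p * Cconj p) by (rewrite Hm; ring). ring. }
  assert (R2 : (l2 - q) * (l2 - Cconj q) = p * Cconj p).
  { replace ((l2 - q) * (l2 - Cconj q)) with (l2 * l2 - l2 * (q + Cconj q) + q * Cconj q) by ring.
    rewrite <- Hs. replace (q * Cconj q) with (l1 * l2 + p * Cconj p) by (rewrite Hm; ring). ring. }
  assert (main : forall r fr, G r -> G fr ->
    (forall x, dom x -> d r x - q * r x - p * J r x = fr x) ->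
    (forall x, dom x -> Pi l1 fr x = Pi l1 f x) -> (forall x, dom x -> Pi l2 fr x = Pi l2 f x) ->
    exists u, G u /\ forall x, dom x -> d u x - q * u x - p * J u x = f x).
  { intros r fr Gr Gfr Hr H1 H2.
    pose (g := fun x => 1 * f x + (- (1)) * fr x).
    assert (Gg : G g) by (unfold g; auto).
    assert (g1 : forall x, dom x -> Pi l1 g x = 0) by (intros x Hx; unfold g; rewrite LP, H1; auto; ring).
    assert (g2 : forall x, dom x -> Pi l2 g x = 0) by (intros x Hx; unfold g; rewrite LP, H2; auto; ring).
    pose (w := B l1 g). assert (Gw : G w) by (unfold w; auto).
    assert (dw : forall x, dom x -> d w x = g x + l1 * w x).
    { intros x Hx. unfold w. rewrite dB, g1 by auto. ring. }
    pose (v := B l2 w). assert (Gv : G v) by (unfold v; auto).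
    (* The second resolvent leaves the defect Pi l2 w. As it lies in the l2-eigenspace, d - l1
       multiplies it by l2 - l1, and this product vanishes for distinct and for double roots. *)
    assert (Pw : forall x, dom x -> (l2 - l1) * Pi l2 w x = 0).
    { intros x Hx. assert (E := Pid l2 w Gw x Hx).
      rewrite (EP l2 (d w) (fun x => 1 * g x + l1 * w x)) in E; auto.
      2: intros y Hy; rewrite dw by auto; ring.
      rewrite LP, g2 in E by auto.
      replace ((l2 - l1) * Pi l2 w x) with (l2 * Pi l2 w x - l1 * Pi l2 w x) by ring. rewrite <- E. ring. }
    assert (Dv : forall x, dom x -> d (d v) x - (q + Cconj q) * d v x + (q * Cconj q - p * Cconj p) * v x = g x).
    { intros x Hx. rewrite <- Hs, <- Hm.
      assert (E : d (fun x => 1 * d v x + (- l2) * v x) x = d (fun x => 1 * w x + (- (1)) * Pi l2 w x) x).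
      { apply Ed; auto. intros y Hy. unfold v at 1. rewrite dB by auto. fold v. ring. }
      rewrite !Ld in E by auto. rewrite dPi, dw in E by auto.
      assert (E2 : d v x = w x - Pi l2 w x + l2 * v x) by (unfold v at 1; rewrite dB by auto; reflexivity).
      assert (K := Pw x Hx).
      transitivity ((1 * d (d v) x + (- l2) * d v x) - l1 * (d v x - l2 * v x)). ring.
      rewrite E, E2. transitivity (g x - (l2 - l1) * Pi l2 w x). ring. rewrite K. ring. }
    (* [u2] is Q v; in P Q v the terms with J v and d (J v) cancel. *)
    pose (u1 := fun x => 1 * d v x + (- Cconj q) * v x). assert (Gu1 : G u1) by (unfold u1; auto).
    pose (u2 := fun x => 1 * u1 x + p * J v x). assert (Gu2 : G u2) by (unfold u2; auto).
    exists (fun x => 1 * u2 x + 1 * r x). split. auto.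
    intros x Hx. rewrite Ld, LJ by auto.
    assert (Du2 : d u2 x = d (d v) x - Cconj q * d v x + p * d (J v) x).
    { unfold u2. rewrite Ld by auto. unfold u1. rewrite Ld by auto. ring. }
    assert (Ju2 : J u2 x = d (J v) x - q * J v x + Cconj p * v x).
    { unfold u2. rewrite LJ, JJ by auto. unfold u1. rewrite LJ, Jd by auto.
      rewrite conj1, Copp_conj, Cconj_conj. ring. }
    rewrite Du2, Ju2, conj1.
    assert (E := Dv x Hx). assert (E' := Hr x Hx). unfold g in E.
    transitivity ((d (d v) x - (q + Cconj q) * d v x + (q * Cconj q - p * Cconj p) * v x) + (d r x - q * r x - p * J r x)).
    unfold u2, u1. ring. rewrite E, E'. ring. }
  (* With this factor (d - q) r contributes half of the projections of f, and by [K1] and [K2] the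
     term - p J r contributes the other half. *)
  pose (c := fun l => / (2 * (l - q))).
  assert (two : RtoC 2 <> 0) by (intros E; injection E; lra).
  assert (K1 : forall x, dom x -> p * Pi l1 (J f) x = - (l1 - Cconj q) * Pi l1 f x).
  { intros x Hx. generalize (Hf l1 R1 x Hx). intros E.
    transitivity (((l1 - Cconj q) * Pi l1 f x + p * Pi l1 (J f) x) - (l1 - Cconj q) * Pi l1 f x). ring. rewrite E. ring. }
  assert (K2 : forall x, dom x -> p * Pi l2 (J f) x = - (l2 - Cconj q) * Pi l2 f x).
  { intros x Hx. generalize (Hf l2 R2 x Hx). intros E.
    transitivity (((l2 - Cconj q) * Pi l2 f x + p * Pi l2 (J f) x) - (l2 - Cconj q) * Pi l2 f x). ring. rewrite E. ring. }
  destruct (lq _ R1) as [N1 N1'], (lq _ R2) as [N2 N2'].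
  assert (cc : forall l, l - q <> 0 -> Cconj (c l) = / (2 * (Cconj l - Cconj q))).
  { intros l Hl. unfold c. rewrite Cinv_conj, Cmult_conj, Cminus_conj.
    replace (Cconj 2) with (RtoC 2) by (unfold Cconj, RtoC; simpl; now rewrite Ropp_0). reflexivity.
    apply Cmult_neq_0; auto. }
  destruct (excluded_middle_informative (l1 = l2)) as [Heq|Hneq].
  (* A double root is real, so conjugation preserves its single resonant part, which must be counted
     only once. The summands with coefficient 0 give the functions the shape of the closure
     hypothesis. *)
  - destruct Hc as [[Hc1 Hc2]|[Hc1 Hc2]]; [|tauto].
    apply (main (fun x => c l1 * Pi l1 f x + 0 * Pi l1 f x) (fun x => 1 * Pi l1 f x + 0 * Pi l1 f x)); auto.
    + intros x Hx. rewrite Ld, LJ, dPi, JPi, conj0 by auto. rewrite Hc1, cc, Hc1 by auto.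
      transitivity (c l1 * (l1 - q) * Pi l1 f x - / (2 * (l1 - Cconj q)) * (p * Pi l1 (J f) x)). ring.
      rewrite K1 by auto. unfold c. field. auto.
    + intros x Hx. rewrite LP, PP1 by auto. ring.
    + rewrite <- Heq. intros x Hx. rewrite LP, PP1 by auto. ring.
  - assert (Hneq' : l2 <> l1) by auto.
    apply (main (fun x => c l1 * Pi l1 f x + c l2 * Pi l2 f x) (fun x => 1 * Pi l1 f x + 1 * Pi l2 f x)); auto.
    + intros x Hx. rewrite Ld, LJ, !dPi, !JPi by auto. rewrite !cc by auto.
      transitivity (/ (2 * (l1 - q)) * (l1 - q) * Pi l1 f x + / (2 * (l2 - q)) * (l2 - q) * Pi l2 f x
       - / (2 * (l1 - Cconj q)) * (p * Pi l1 (J f) x) - / (2 * (l2 - Cconj q)) * (p * Pi l2 (J f) x)).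
      * destruct Hc as [[Hc1 Hc2]|[Hc1 _]].
        rewrite Hc1, Hc2. unfold c. ring.
        assert (Hc2 : Cconj l2 = l1) by (rewrite <- Hc1; apply Cconj_conj).
        rewrite Hc1, Hc2. unfold c. ring.
      * rewrite K1, K2 by auto. field. auto.
    + intros x Hx. rewrite LP, PP1, PP0 by auto. ring.
    + intros x Hx. rewrite LP, PP1, PP0 by auto. ring.
Qed.

(** * Matrix coefficients *)

Definition csum (f : nat -> C) (n : nat) : C := fold_right Cplus (RtoC 0) (map f (seq 0 (S n))).

Lemma csum_0 f : csum f 0 = f 0%nat.
Proof. unfold csum. simpl. ring. Qed.

Lemma fold_Cplus_app l l' : fold_right Cplus (RtoC 0) (l ++ l') = fold_right Cplus (RtoC 0) l + fold_right Cplus (RtoC 0) l'.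
Proof. induction l; simpl. ring. rewrite IHl. ring. Qed.

Lemma csum_S f n : csum f (S n) = csum f n + f (S n).
Proof.
  unfold csum. rewrite (seq_S (S n) 0), map_app, fold_Cplus_app. simpl. ring.
Qed.

Lemma csum_ext f g n : (forall i, (i <= n)%nat -> f i = g i) -> csum f n = csum g n.
Proof.
  induction n as [|n IH]; intros H.
  - rewrite !csum_0. apply H; lia.
  - rewrite !csum_S, IH, H; auto.
Qed.

Lemma csum_shift f n : csum f (S n) = f 0%nat + csum (fun i => f (S i)) n.
Proof.
  induction n as [|n IH].
  - rewrite csum_S, !csum_0. ring.
  - rewrite csum_S, IH, csum_S. ring.
Qed.

Lemma csum_plus f g n : csum (fun i => f i + g i) n = csum f n + csum g n.
Proof. induction n as [|n IH]. rewrite !csum_0. ring. rewrite !csum_S, IH. ring. Qed.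

Lemma csum_scal c f n : csum (fun i => c * f i) n = c * csum f n.
Proof. induction n as [|n IH]. rewrite !csum_0. ring. rewrite !csum_S, IH. ring. Qed.

Lemma csum_trunc (f : nat -> C) n m : (forall i, (n < i)%nat -> f i = 0) -> csum f (n + m) = csum f n.
Proof.
  intros H. induction m as [|m IH]. now rewrite Nat.add_0_r.
  rewrite Nat.add_succ_r, csum_S, IH, H by lia. ring.
Qed.

Definition conv (u v : nat -> C) (n : nat) : C := csum (fun i => u i * v (n - i)%nat) n.
Definition shift (u : nat -> C) (n : nat) : C := match n with O => 0 | S n => u n end.
Definition Cnat (n : nat) : C := RtoC (INR n).

Lemma Cnat_0 : Cnat 0 = 0.
Proof. reflexivity. Qed.
Lemma Cnat_neq n : Cnat (S n) <> 0.
Proof. unfold Cnat. intros E. apply RtoC_inj in E. revert E. apply not_0_INR. discriminate. Qed.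
Lemma Cnat_plus n m : Cnat (n + m) = Cnat n + Cnat m.
Proof. unfold Cnat. now rewrite plus_INR, RtoC_plus. Qed.

Lemma conv_ext u u' v v' n : (forall i, u i = u' i) -> (forall i, v i = v' i) -> conv u v n = conv u' v' n.
Proof. intros H K. apply csum_ext. intros. now rewrite H, K. Qed.
Lemma conv_lin_l a b u u' v n : conv (fun i => a * u i + b * u' i) v n = a * conv u v n + b * conv u' v n.
Proof. unfold conv. rewrite <- !csum_scal, <- csum_plus. apply csum_ext. intros; ring. Qed.
Lemma conv_lin_r a b u v v' n : conv u (fun i => a * v i + b * v' i) n = a * conv u v n + b * conv u v' n.
Proof. unfold conv. rewrite <- !csum_scal, <- csum_plus. apply csum_ext. intros; ring. Qed.

Lemma conv_shift_l u v n : conv (shift u) v n = shift (conv u v) n.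
Proof.
  destruct n; unfold conv at 1.
  - rewrite csum_0. simpl. ring.
  - rewrite csum_shift. simpl. rewrite Cmult_0_l, Cplus_0_l. reflexivity.
Qed.

Lemma conv_shift_r u v n : conv u (shift v) n = shift (conv u v) n.
Proof.
  destruct n; unfold conv at 1.
  - rewrite csum_0. simpl. ring.
  - rewrite csum_S, Nat.sub_diag. change (shift v 0) with (RtoC 0). rewrite Cmult_0_r, Cplus_0_r.
    change (shift (conv u v) (S n)) with (conv u v n). unfold conv. apply csum_ext. intros i Hi. replace (S n - i)%nat with (S (n - i)) by lia. reflexivity.
Qed.

(* The product rule for the coefficients of power series. *)
Lemma conv_deriv u v n : Cnat (S n) * conv u v (S n) =
  conv (fun i => Cnat (S i) * u (S i)) v n + conv u (fun i => Cnat (S i) * v (S i)) n.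
Proof.
  unfold conv at 1. rewrite <- csum_scal.
  transitivity (csum (fun i => Cnat i * u i * v (S n - i)%nat + u i * (Cnat (S n - i) * v (S n - i)%nat)) (S n)).
  - apply csum_ext. intros i Hi. replace (Cnat (S n)) with (Cnat i + Cnat (S n - i)). ring.
    rewrite <- Cnat_plus. f_equal. lia.
  - rewrite csum_plus. f_equal.
    + rewrite csum_shift, Cnat_0. unfold conv. simpl. ring.
    + rewrite csum_S, Nat.sub_diag, Cnat_0. unfold conv.
      transitivity (csum (fun i => u i * (Cnat (S n - i) * v (S n - i)%nat)) n). ring.
      apply csum_ext. intros i Hi. replace (S n - i)%nat with (S (n - i)) by lia. reflexivity.
Qed.

(** * Generating polynomials of the matrix entries *)

Definition dpow (z : C) (n : nat) : C := Defs.Cpow z n / RtoC (INR (fact n)).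

Lemma INR_fact_neq n : RtoC (INR (fact n)) <> 0.
Proof. intros E. apply RtoC_inj in E. revert E. apply INR_fact_neq_0. Qed.

Lemma dpow_S z n : Cnat (S n) * dpow z (S n) = z * dpow z n.
Proof.
  unfold dpow. simpl Defs.Cpow. change (fact (S n)) with (S n * fact n)%nat.
  rewrite mult_INR, RtoC_mult. fold (Cnat (S n)). field. split; [apply INR_fact_neq|apply Cnat_neq].
Qed.

(** Coefficient of Z^i in (A + B Z)^j / j!; with divided powers, multiplication by A + B Z and
    differentiation in Z become the recurrences below. *)
Definition bin (A B : C) (j i : nat) : C := if (i <=? j)%nat then dpow A (j - i) * dpow B i else 0.

Lemma bin_deriv A B j i : Cnat (S i) * bin A B (S j) (S i) = B * bin A B j i.
Proof.
  unfold bin. change (S i <=? S j)%nat with (i <=? j)%nat. destruct (i <=? j)%nat. 2: ring.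
  replace (S j - S i)%nat with (j - i)%nat by lia.
  transitivity (dpow A (j - i) * (Cnat (S i) * dpow B (S i))). ring. rewrite dpow_S. ring.
Qed.

Lemma bin_deriv0 A B i : Cnat (S i) * bin A B 0 (S i) = 0.
Proof. unfold bin. simpl. ring. Qed.

Lemma bin_rec A B j i : Cnat (S j) * bin A B (S j) i = A * bin A B j i + B * shift (bin A B j) i.
Proof.
  assert (H : forall i, (i <= S j)%nat -> Cnat (S j - i) * bin A B (S j) i = A * bin A B j i).
  { clear i. intros i Hi. unfold bin. rewrite (proj2 (Nat.leb_le i (S j)) Hi).
    destruct (Nat.leb_spec i j).
    - replace (S j - i)%nat with (S (j - i)) by lia.
      transitivity (Cnat (S (j - i)) * dpow A (S (j - i)) * dpow B i). ring. rewrite dpow_S. ring.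
    - replace (S j - i)%nat with 0%nat by lia. rewrite Cnat_0. ring. }
  destruct i as [|i]; simpl shift.
  - rewrite <- (H 0%nat) by lia. rewrite Nat.sub_0_r. ring.
  - rewrite <- bin_deriv. destruct (Nat.leb_spec i j) as [L|L].
    + rewrite <- H by lia. replace (Cnat (S j)) with (Cnat (S j - S i) + Cnat (S i)). ring.
      rewrite <- Cnat_plus. f_equal. lia.
    + unfold bin. rewrite (proj2 (Nat.leb_gt (S i) (S j))), (proj2 (Nat.leb_gt (S i) j)) by lia. ring.
Qed.

(* tau A B C D j l n is the coefficient of Z^n in (A + B Z)^j (C + D Z)^l / (j! l!). *)
Definition tau (A B Cc D : C) (j l n : nat) : C := conv (bin A B j) (bin Cc D l) n.

Lemma tau_rec_j A B Cc D j l n : Cnat (S j) * tau A B Cc D (S j) l n = A * tau A B Cc D j l n + B * shift (tau A B Cc D j l) n.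
Proof.
  unfold tau. rewrite <- conv_shift_l.
  transitivity (Cnat (S j) * conv (bin A B (S j)) (bin Cc D l) n + 0 * conv (bin A B (S j)) (bin Cc D l) n). ring.
  rewrite <- !conv_lin_l. apply conv_ext; auto. intros i. rewrite <- bin_rec. ring.
Qed.

Lemma tau_rec_l A B Cc D j l n : Cnat (S l) * tau A B Cc D j (S l) n = Cc * tau A B Cc D j l n + D * shift (tau A B Cc D j l) n.
Proof.
  unfold tau. rewrite <- conv_shift_r.
  transitivity (Cnat (S l) * conv (bin A B j) (bin Cc D (S l)) n + 0 * conv (bin A B j) (bin Cc D (S l)) n). ring.
  rewrite <- !conv_lin_r. apply conv_ext; auto. intros i. rewrite <- bin_rec. ring.
Qed.

Lemma conv_scal_l a u v n : conv (fun i => a * u i) v n = a * conv u v n.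
Proof. unfold conv. rewrite <- csum_scal. apply csum_ext. intros; ring. Qed.
Lemma conv_scal_r a u v n : conv u (fun i => a * v i) n = a * conv u v n.
Proof. unfold conv. rewrite <- csum_scal. apply csum_ext. intros; ring. Qed.

(** Differentiation of the generating polynomial in Z. The next two lemmas are the cases in which
    one of the factors is constant and its term disappears. *)
Lemma tau_deriv A B Cc D j l n : Cnat (S n) * tau A B Cc D (S j) (S l) (S n) = B * tau A B Cc D j (S l) n + D * tau A B Cc D (S j) l n.
Proof.
  unfold tau. rewrite conv_deriv, <- conv_scal_l, <- conv_scal_r. f_equal; apply conv_ext; auto; intros; apply bin_deriv.
Qed.

Lemma tau_deriv_j0 A B Cc D l n : Cnat (S n) * tau A B Cc D 0 (S l) (S n) = D * tau A B Cc D 0%nat l n.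
Proof.
  unfold tau. rewrite conv_deriv.
  transitivity (0 * conv (bin A B 0) (bin Cc D (S l)) n + D * conv (bin A B 0) (bin Cc D l) n); [|ring]. f_equal.
  - rewrite <- conv_scal_l. apply conv_ext; auto. intros i. rewrite bin_deriv0. ring.
  - rewrite <- conv_scal_r. apply conv_ext; auto. intros i. apply bin_deriv.
Qed.

Lemma tau_deriv_l0 A B Cc D j n : Cnat (S n) * tau A B Cc D (S j) 0 (S n) = B * tau A B Cc D j 0%nat n.
Proof.
  unfold tau. rewrite conv_deriv.
  transitivity (B * conv (bin A B j) (bin Cc D 0) n + 0 * conv (bin A B (S j)) (bin Cc D 0) n); [|ring]. f_equal.
  - rewrite <- conv_scal_l. apply conv_ext; auto. intros i. apply bin_deriv.
  - rewrite <- conv_scal_r. apply conv_ext; auto. intros i. rewrite bin_deriv0. ring.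
Qed.

Lemma tau_zero A B Cc D j l n : (j + l < n)%nat -> tau A B Cc D j l n = 0.
Proof.
  intros H. unfold tau, conv. rewrite (csum_ext _ (fun i => 0 * 0)). rewrite csum_scal. ring.
  intros i Hi. unfold bin. destruct (Nat.leb_spec i j), (Nat.leb_spec (n - i) l); try ring. lia.
Qed.

Lemma tau_00 A B Cc D n : tau A B Cc D 0 0 n = match n with O => 1 | _ => 0 end.
Proof.
  destruct n. 2: apply tau_zero; lia.
  unfold tau, conv. rewrite csum_0. unfold bin, dpow. simpl. field.
Qed.

Lemma sgnC_S n : sgnC (S n) = - sgnC n.
Proof.
  assert (E : RtoC (-1) = - RtoC 1) by (rewrite <- RtoC_opp; reflexivity).
  unfold sgnC. rewrite Nat.even_succ, <- Nat.negb_even. destruct (Nat.even n); simpl; rewrite E; ring.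
Qed.

Lemma Cnat_cancel n (a b : C) : Cnat (S n) * a = Cnat (S n) * b -> a = b.
Proof.
  intros E. assert (N := Cnat_neq n). replace a with (/ Cnat (S n) * (Cnat (S n) * a)) by (field; auto).
  rewrite E. field. auto.
Qed.

(** Substituting Z = -1/Y in (D - C Z)^j (-B + A Z)^l and multiplying by Y^(j+l) gives (-1)^l (A + B
    Y)^l (C + D Y)^j, which reverses the order of the coefficients. For the entries of x the new
    quadruple is the conjugate one. The induction follows the multiplication recurrences. *)
Lemma tau_flip A B Cc D j l n : (n <= j + l)%nat ->
  tau D (- Cc) (- B) A j l n = sgnC (l + n) * tau A B Cc D l j (j + l - n).
Proof.
  revert l n. induction j as [|j IHj].
  - induction l as [|l IHl]; intros n Hn.
    + replace n with 0%nat by lia. simpl. rewrite !tau_00. unfold sgnC. simpl. ring.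
    + apply (Cnat_cancel l). rewrite tau_rec_l.
      transitivity (sgnC (S l + n) * (Cnat (S l) * tau A B Cc D (S l) 0 (0 + S l - n))). 2: ring.
      rewrite tau_rec_j. simpl (0 + S l)%nat.
      destruct n as [|n]; simpl shift at 1.
      * rewrite IHl by lia. simpl (0 + l - 0)%nat. rewrite (tau_zero A B Cc D l 0 (S l - 0)) by lia.
        rewrite Nat.sub_0_r. simpl. rewrite sgnC_S. replace (l - 0)%nat with l by lia. ring.
      * rewrite (IHl n) by lia. simpl (0 + l)%nat. replace (S l - S n)%nat with (l - n)%nat by lia.
        destruct (Nat.eq_dec n l) as [->|N].
        -- rewrite (tau_zero D) by lia. rewrite Nat.sub_diag. simpl shift.
           replace (S l + S l)%nat with (S (S (l + l))) by lia. rewrite !sgnC_S. ring.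
        -- rewrite (IHl (S n)) by lia. simpl (0 + l)%nat. replace (l - n)%nat with (S (l - S n)) by lia. simpl shift.
           replace (l - S n)%nat with (l - S n)%nat by lia.
           replace (S l + S n)%nat with (S (S (l + n))) by lia. replace (l + S n)%nat with (S (l + n)) by lia.
           rewrite !sgnC_S. ring.
  - intros l n Hn. apply (Cnat_cancel j). rewrite tau_rec_j.
    transitivity (sgnC (l + n) * (Cnat (S j) * tau A B Cc D l (S j) (S j + l - n))). 2: ring.
    rewrite tau_rec_l.
    destruct n as [|n]; simpl shift at 1.
    + rewrite IHj by lia. rewrite (tau_zero A B Cc D l j (S j + l - 0)) by lia.
      rewrite !Nat.sub_0_r. simpl. ring.
    + rewrite (IHj l n) by lia. replace (S j + l - S n)%nat with (j + l - n)%nat by lia.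
      destruct (Nat.eq_dec n (j + l)) as [->|N].
      * rewrite (tau_zero D) by lia. rewrite Nat.sub_diag. simpl shift.
        replace (l + S (j + l))%nat with (S (l + (j + l))) by lia. rewrite !sgnC_S. ring.
      * rewrite (IHj l (S n)) by lia. replace (j + l - n)%nat with (S (j + l - S n)) by lia. simpl shift.
        replace (l + S n)%nat with (S (l + n)) by lia. rewrite !sgnC_S. ring.
Qed.

(** A matrix entry without its square root: for the representation of spin L / 2 with L = j + l, the
    row weight is L / 2 - j and the column weight n - L / 2. *)
Definition T (j l n : nat) (x : pt) : C := tau (x11 x) (x12 x) (x21 x) (x22 x) j l n.

Lemma T_flip j l n x : (n <= j + l)%nat -> Cconj (T j l n x) = sgnC (l + n) * T l j (j + l - n) x.
Proof.
  intros H. rewrite <- (Cconj_conj (sgnC (l + n) * T l j (j + l - n) x)). f_equal.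
  unfold T. rewrite <- tau_flip by auto.
  assert (Hp : forall z n, Cconj (dpow z n) = dpow (Cconj z) n).
  { intros z m. unfold dpow. rewrite Cdiv_conj by apply INR_fact_neq. f_equal.
    induction m; simpl. unfold Cconj, RtoC; simpl; now rewrite Ropp_0. now rewrite Cmult_conj, IHm.
    unfold Cconj, RtoC; simpl; now rewrite Ropp_0. }
  assert (C0 : Cconj 0 = 0) by (unfold Cconj, RtoC; simpl; now rewrite Ropp_0).
  assert (Hb : forall a b j i, Cconj (bin a b j i) = bin (Cconj a) (Cconj b) j i).
  { intros a b m i. unfold bin. destruct (i <=? m)%nat; auto. now rewrite Cmult_conj, !Hp. }
  assert (Hs : forall f m, Cconj (csum f m) = csum (fun i => Cconj (f i)) m).
  { intros f m. induction m. now rewrite !csum_0. now rewrite !csum_S, Cplus_conj, IHm. }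
  unfold tau, conv. rewrite Hs. apply csum_ext. intros i _. rewrite Cmult_conj, !Hb.
  unfold x11, x12, x21, x22. rewrite !Copp_conj, !Cconj_conj. 
  f_equal. f_equal. ring.
Qed.

Lemma tmat_T L j k x : (j <= L)%nat -> (k <= L)%nat ->
  tmat L j k x = RtoC (sqrt (INR (fact j * fact (L - j) * fact k * fact (L - k)))) * T j (L - j) (L - k) x.
Proof.
  intros Hj Hk. unfold tmat. f_equal.
  change (csum (fun i => tterm L j k i x) L = T j (L - j) (L - k) x).
  (* The terms with i > L - k vanish, so the sum in [tmat] may stop where the Cauchy product
     does. *)
  transitivity (csum (fun i => tterm L j k i x) ((L - k) + k)). f_equal; lia. rewrite (csum_trunc (fun i => tterm L j k i x) (L - k) k).
  - unfold T, tau, conv. apply csum_ext. intros i Hi. unfold tterm, bin.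
    replace (i + k <=? L)%nat with true by (symmetry; apply Nat.leb_le; lia).
    replace (j <=? i + k)%nat with (L - k - i <=? L - j)%nat.
    2: { destruct (Nat.leb_spec (L - k - i) (L - j)), (Nat.leb_spec j (i + k)); auto; lia. }
    destruct (Nat.leb_spec (L - k - i) (L - j)), (Nat.leb_spec i j); simpl; try ring.
    replace (L - j - (L - k - i))%nat with (i + k - j)%nat by lia.
    unfold dpow. rewrite !mult_INR, !RtoC_mult. field. repeat split; apply INR_fact_neq.
  - intros i Hi. unfold tterm. replace (i + k <=? L)%nat with false by (symmetry; apply Nat.leb_gt; lia).
    now rewrite Bool.andb_false_r.
Qed.

(** The conjugation symmetry of the matrix entries, from [tau_flip]. It turns the conjugated Fourier
    coefficient in [inE] into a test of the conjugate distribution. *)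
Lemma tmat_flip L j k x : (j <= L)%nat -> (k <= L)%nat ->
  tmat L (L - j) (L - k) x = sgnC (j + k) * Cconj (tmat L j k x).
Proof.
  intros Hj Hk. rewrite !tmat_T by lia. rewrite Cmult_conj, T_flip by lia.
  replace (L - (L - j))%nat with j by lia. replace (L - (L - k))%nat with k by lia.
  replace (j + (L - j) - (L - k))%nat with k by lia.
  replace (fact (L - j) * fact j * fact (L - k) * fact k)%nat with (fact j * fact (L - j) * fact k * fact (L - k))%nat by ring.
  assert (E : sgnC (j + k) * sgnC (L - j + (L - k)) = 1).
  { assert (Hs : forall a b, sgnC (a + b) = sgnC a * sgnC b).
    { intros a b. induction a; simpl. unfold sgnC; simpl; ring. rewrite !sgnC_S, IHa. ring. }
    assert (H1 : forall a, sgnC a * sgnC a = 1).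
    { intros a. induction a. unfold sgnC; simpl; ring. rewrite !sgnC_S, <- IHa. ring. }
    rewrite <- Hs. replace (j + k + (L - j + (L - k)))%nat with (L + L)%nat by lia. now rewrite Hs, H1. }
  replace (Cconj (RtoC _)) with (RtoC (sqrt (INR (fact j * fact (L - j) * fact k * fact (L - k))))).
  2: { unfold Cconj, RtoC; simpl; now rewrite Ropp_0. }
  transitivity (RtoC (sqrt (INR (fact j * fact (L - j) * fact k * fact (L - k)))) * (sgnC (j + k) * sgnC (L - j + (L - k))) * T (L - j) j k x).
  rewrite E. ring. ring.
Qed.

(** * Weights of the neutral field *)

Definition eig (m : C) (phi : pt -> C) : Prop :=
  smooth phi /\ forall x, inSU2 x -> d0 phi x = m * phi x.

Lemma eig_ext m phi psi : eqS phi psi -> eig m phi -> eig m psi.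
Proof.
  intros E [H1 H2]. split. now apply (smooth_ext phi).
  intros x Hx. rewrite <- (d0_ext phi psi E x Hx), H2, E; auto.
Qed.

Lemma eig_zero m : eig m (fun _ => 0).
Proof. split. apply smooth_const. intros x _. rewrite d0_const. ring. Qed.

Lemma eig_plus m phi psi : eig m phi -> eig m psi -> eig m (fun x => phi x + psi x).
Proof.
  intros [H1 H2] [K1 K2]. split. now apply smooth_plus.
  intros x Hx. rewrite d0_plus, H2, K2 by auto. ring.
Qed.

Lemma eig_scal m c phi : eig m phi -> eig m (fun x => c * phi x).
Proof.
  intros [H1 H2]. split. now apply smooth_scal.
  intros x Hx. rewrite d0_scal, H2 by auto. ring.
Qed.

Lemma eig_mult m m' phi psi : eig m phi -> eig m' psi -> eig (m + m') (fun x => phi x * psi x).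
Proof.
  intros [H1 H2] [K1 K2]. split. now apply smooth_mult.
  intros x Hx. rewrite d0_mult, H2, K2 by auto. ring.
Qed.

Lemma eig_conj m phi : eig m phi -> eig (Cconj m) (fun x => Cconj (phi x)).
Proof.
  intros [H1 H2]. split. now apply smooth_conj.
  intros x Hx. rewrite d0_conj, H2 by auto. apply Cmult_conj.
Qed.

Lemma eig_pair m g h : rsm g -> rsm h ->
  (forall x, (rl D0 g x, rl D0 h x) = m * (g x, h x)) -> eig m (fun x => (g x, h x)).
Proof. intros Hg Hh H. split. now apply smooth_pair. intros x _. apply H. Qed.

Definition hf : C := (0, / 2)%R.

Lemma rl0_coords x : (rl D0 p1 x = p2 x / 2 /\ rl D0 p2 x = - p1 x / 2 /\
  rl D0 p3 x = - p4 x / 2 /\ rl D0 p4 x = p3 x / 2)%R.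
Proof.
  destruct (rl_coords D0 x) as (A & B & A' & B').
  exact (conj (is_derive_unique _ _ _ A) (conj (is_derive_unique _ _ _ B)
    (conj (is_derive_unique _ _ _ A') (is_derive_unique _ _ _ B')))).
Qed.

Lemma eig_x11 : eig (- hf) x11.
Proof.
  apply eig_ext with (fun x => (p1 x, p2 x)). intros x _. unfold x11, p1, p2. now destruct (fst x).
  apply eig_pair. apply rsm_rpoly, rp_1. apply rsm_rpoly, rp_2.
  intros x. destruct (rl0_coords x) as (-> & -> & _).
  unfold hf, Cmult, Copp; simpl. f_equal; field.
Qed.

Lemma eig_x12 : eig hf x12.
Proof.
  apply eig_ext with (fun x => (p3 x, p4 x)). intros x _. unfold x12, p3, p4. now destruct (snd x).
  apply eig_pair. apply rsm_rpoly, rp_3. apply rsm_rpoly, rp_4.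
  intros x. destruct (rl0_coords x) as (_ & _ & -> & ->).
  unfold hf, Cmult, Copp; simpl. f_equal; field.
Qed.

Lemma conj_hf : Cconj hf = - hf.
Proof. unfold Cconj, hf, Copp; simpl. f_equal; ring. Qed.

Lemma eig_x22 : eig hf x22.
Proof.
  replace hf with (Cconj (- hf)). apply (eig_conj _ _ eig_x11).
  rewrite Copp_conj, conj_hf. ring.
Qed.

Lemma eig_x21 : eig (- hf) x21.
Proof.
  apply eig_ext with (fun x => (- (1)) * Cconj (x12 x)).
  - intros x _. unfold x21, x12. ring.
  - apply eig_scal. rewrite <- conj_hf. apply eig_conj, eig_x12.
Qed.

(** i times the column weight: with L = j + l and n = L - k the imaginary part is [mval L k]. *)
Definition wt (j l n : nat) : C := (0, INR n - INR (j + l) / 2)%R.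

Lemma eig_shift (F : nat -> pt -> C) (m : nat -> C) (c : C) n :
  (forall n, eig (m n) (F n)) -> (forall n, m (S n) = m n + c) ->
  eig (m n + - c) (fun x => shift (fun n => F n x) n).
Proof.
  intros H K. destruct n; simpl. apply eig_zero.
  rewrite K. replace (m n + c + - c) with (m n) by ring. apply H.
Qed.

Lemma wt_S j l n : wt j l (S n) = wt j l n + (hf + hf).
Proof. unfold wt, hf, Cplus. rewrite S_INR. simpl. f_equal; field. Qed.

(** The functions x11 and x21 have weight - i/2, x12 and x22 have weight i/2, and raising n by one
    raises the weight by i; the recurrences propagate this from the constant 1. *)
Lemma eig_T j l n : eig (wt j l n) (T j l n).
Proof.
  revert n. induction j as [|j IHj].
  - induction l as [|l IHl]; intros n.
    + destruct n.
      * apply eig_ext with (fun _ => 1). intros x _. unfold T. now rewrite tau_00.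
        split. apply smooth_const. intros x _. rewrite d0_const. unfold wt. simpl.
        unfold Cmult, RtoC; simpl. f_equal; field.
      * apply eig_ext with (fun _ => 0). intros x _. unfold T. now rewrite tau_00. apply eig_zero.
    + assert (E := Cnat_neq l).
      apply eig_ext with (fun x => / Cnat (S l) * (x21 x * T 0 l n x + x22 x * shift (fun n => T 0 l n x) n)).
      * intros x _. unfold T at 3. transitivity (/ Cnat (S l) * (Cnat (S l) * tau (x11 x) (x12 x) (x21 x) (x22 x) 0 (S l) n)).
        rewrite tau_rec_l. reflexivity. field. auto.
      * apply eig_scal, eig_plus.
        -- replace (wt 0 (S l) n) with (- hf + wt 0 l n). apply eig_mult; auto. apply eig_x21.
           unfold wt, hf, Cplus, Copp. rewrite !plus_INR, S_INR. simpl. f_equal; field.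
        -- replace (wt 0 (S l) n) with (hf + (wt 0 l n + - (hf + hf))). apply eig_mult. apply eig_x22.
           apply (eig_shift (T 0 l)); auto using wt_S.
           unfold wt, hf, Cplus, Copp. rewrite !plus_INR, S_INR. simpl. f_equal; field.
  - intros n. assert (E := Cnat_neq j).
    apply eig_ext with (fun x => / Cnat (S j) * (x11 x * T j l n x + x12 x * shift (fun n => T j l n x) n)).
    + intros x _. unfold T at 3. transitivity (/ Cnat (S j) * (Cnat (S j) * tau (x11 x) (x12 x) (x21 x) (x22 x) (S j) l n)).
      rewrite tau_rec_j. reflexivity. field. auto.
    + apply eig_scal, eig_plus.
      * replace (wt (S j) l n) with (- hf + wt j l n). apply eig_mult; auto. apply eig_x11.
        unfold wt, hf, Cplus, Copp. rewrite !plus_INR, S_INR. simpl. f_equal; field.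
      * replace (wt (S j) l n) with (hf + (wt j l n + - (hf + hf))). apply eig_mult. apply eig_x12.
        apply (eig_shift (T j l)); auto using wt_S.
        unfold wt, hf, Cplus, Copp. rewrite !plus_INR, S_INR. simpl. f_equal; field.
Qed.

(** * Matrix coefficients span the polynomials *)

(** Closure under equality on SU(2) is built in because the determinant relation used below holds
    only there. *)
Inductive Sp : (pt -> C) -> Prop :=
| Sp_T j l n : Sp (T j l n)
| Sp_lin a f b g : Sp f -> Sp g -> Sp (fun x => a * f x + b * g x)
| Sp_ext f g : Sp f -> eqS f g -> Sp g.

Lemma Sp_zero : Sp (fun _ => 0).
Proof. eapply Sp_ext. apply (Sp_lin 0 _ 0 _ (Sp_T 0 0 0) (Sp_T 0 0 0)). intros x _. ring. Qed.

Lemma Sp_scal a f : Sp f -> Sp (fun x => a * f x).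
Proof. intros H. eapply Sp_ext. apply (Sp_lin a _ 0 _ H H). intros x _. ring. Qed.

Lemma Sp_mult (c : pt -> C) : (forall j l n, Sp (fun x => c x * T j l n x)) -> forall f, Sp f -> Sp (fun x => c x * f x).
Proof.
  intros H f Hf. induction Hf.
  - apply H.
  - eapply Sp_ext. apply (Sp_lin a _ b _ IHHf1 IHHf2). intros x _. simpl. ring.
  - eapply Sp_ext. apply IHHf. intros x Hx. now rewrite H0.
Qed.

Lemma Sp_div (c : C) f g : c <> 0 -> Sp g -> (forall x, inSU2 x -> c * f x = g x) -> Sp f.
Proof.
  intros Hc Hg H. apply Sp_ext with (fun x => / c * g x). now apply Sp_scal.
  intros x Hx. rewrite <- H by auto. field. auto.
Qed.

Lemma Sp_shift j l n : Sp (fun x => shift (fun n => T j l n x) n).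
Proof. destruct n; simpl. apply Sp_zero. apply Sp_T. Qed.

Lemma det_x x : inSU2 x -> x11 x * x22 x - x12 x * x21 x = 1.
Proof.
  rewrite inSU2_p. intros H. unfold x11, x12, x21, x22, Cconj, Copp, Cmult, Cminus, Cplus, RtoC.
  unfold p1, p2, p3, p4 in H. simpl. f_equal; [rewrite <- H|]; simpl; ring.
Qed.

(** Elimination between the two multiplication recurrences: the shifted terms cancel, and what
    remains carries the determinant, which is 1. *)
Lemma det_T j l n x : inSU2 x ->
  x22 x * (Cnat (S j) * T (S j) l n x) - x12 x * (Cnat (S l) * T j (S l) n x) = T j l n x.
Proof.
  intros Hx. unfold T. rewrite tau_rec_j, tau_rec_l.
  transitivity ((x11 x * x22 x - x12 x * x21 x) * tau (x11 x) (x12 x) (x21 x) (x22 x) j l n). ring.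
  rewrite det_x by auto. ring.
Qed.

(* The determinant relation and the derivative of the generating polynomial form a 2x2
   linear system for conj(a) t and b t. *)
Lemma Sp_x22 : forall f, Sp f -> Sp (fun x => x22 x * f x).
Proof.
  apply Sp_mult. intros [|j] l n.
  - apply Sp_ext with (fun x => Cnat (S n) * T 0 (S l) (S n) x). apply Sp_scal, Sp_T.
    intros x _. unfold T. apply tau_deriv_j0.
  - apply Sp_div with (Cnat (S j + S l)) (fun x => 1 * T j l n x + (Cnat (S l) * Cnat (S n)) * T (S j) (S l) (S n) x).
    + apply Cnat_neq.
    + apply Sp_lin; apply Sp_T.
    + intros x Hx. rewrite <- (det_T j l n x Hx) at 1. 
      transitivity (x22 x * (Cnat (S j) * T (S j) l n x) - x12 x * (Cnat (S l) * T j (S l) n x) + Cnat (S l) * (Cnat (S n) * T (S j) (S l) (S n) x)).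
      2: ring.
      unfold T at 4. rewrite tau_deriv. rewrite Cnat_plus. fold (T j (S l) n x) (T (S j) l n x). unfold T. ring.
Qed.

Lemma Sp_x12 : forall f, Sp f -> Sp (fun x => x12 x * f x).
Proof.
  apply Sp_mult. intros j [|l] n.
  - apply Sp_ext with (fun x => Cnat (S n) * T (S j) 0 (S n) x). apply Sp_scal, Sp_T.
    intros x _. unfold T. apply tau_deriv_l0.
  - apply Sp_ext with (fun x => Cnat (S n) * T (S j) (S l) (S n) x + (- (1)) * (x22 x * T (S j) l n x)).
    + apply Sp_lin. apply Sp_T. apply Sp_x22, Sp_T.
    + intros x _. unfold T at 1. rewrite tau_deriv. unfold T. ring.
Qed.

Lemma Sp_x11 : forall f, Sp f -> Sp (fun x => x11 x * f x).
Proof.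
  apply Sp_mult. intros j l n.
  apply Sp_ext with (fun x => Cnat (S j) * T (S j) l n x + (- (1)) * (x12 x * shift (fun n => T j l n x) n)).
  - apply Sp_lin. apply Sp_T. apply Sp_x12, Sp_shift.
  - intros x _. unfold T at 1. rewrite tau_rec_j. unfold T.
    change (fun n0 => tau (x11 x) (x12 x) (x21 x) (x22 x) j l n0) with (tau (x11 x) (x12 x) (x21 x) (x22 x) j l). ring.
Qed.

Lemma Sp_x21 : forall f, Sp f -> Sp (fun x => x21 x * f x).
Proof.
  apply Sp_mult. intros j l n.
  apply Sp_ext with (fun x => Cnat (S l) * T j (S l) n x + (- (1)) * (x22 x * shift (fun n => T j l n x) n)).
  - apply Sp_lin. apply Sp_T. apply Sp_x22, Sp_shift.
  - intros x _. unfold T at 1. rewrite tau_rec_l. unfold T.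
    change (fun n0 => tau (x11 x) (x12 x) (x21 x) (x22 x) j l n0) with (tau (x11 x) (x12 x) (x21 x) (x22 x) j l). ring.
Qed.

Lemma Sp_rpoly g : rpoly g -> forall f, Sp f -> Sp (fun x => RtoC (g x) * f x).
Proof.
  induction 1 as [c| | | | |g h _ IHg _ IHh|g h _ IHg _ IHh]; intros f Hf.
  - now apply Sp_scal.
  - eapply Sp_ext. apply (Sp_lin (/ 2)%R _ (/ 2)%R _ (Sp_x11 f Hf) (Sp_x22 f Hf)).
    intros x _. unfold x11, x22, p1, Cconj, Cmult, Cplus, RtoC. simpl. f_equal; field.
  - eapply Sp_ext. apply (Sp_lin (- hf) _ hf _ (Sp_x11 f Hf) (Sp_x22 f Hf)).
    intros x _. unfold hf, x11, x22, p2, Cconj, Cmult, Cplus, Copp, RtoC. simpl. f_equal; field.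
  - eapply Sp_ext. apply (Sp_lin (/ 2)%R _ (- / 2)%R _ (Sp_x12 f Hf) (Sp_x21 f Hf)).
    intros x _. unfold x12, x21, p3, Cconj, Cmult, Cplus, Copp, RtoC. simpl. f_equal; field.
  - eapply Sp_ext. apply (Sp_lin (- hf) _ (- hf) _ (Sp_x12 f Hf) (Sp_x21 f Hf)).
    intros x _. unfold hf, x12, x21, p4, Cconj, Cmult, Cplus, Copp, RtoC. simpl. f_equal; field.
  - eapply Sp_ext. apply (Sp_lin 1 _ 1 _ (IHg f Hf) (IHh f Hf)). intros x _. simpl. rewrite RtoC_plus. ring.
  - eapply Sp_ext. apply (IHg _ (IHh f Hf)). intros x _. simpl. rewrite RtoC_mult. ring.
Qed.

Lemma Sp_poly g h : rpoly g -> rpoly h -> Sp (fun x => (g x, h x)).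
Proof.
  intros Hg Hh. assert (S1 : Sp (fun _ => 1)).
  { apply Sp_ext with (T 0 0 0). apply Sp_T. intros x _. unfold T. now rewrite tau_00. }
  eapply Sp_ext. apply (Sp_lin 1 _ Ci _ (Sp_rpoly g Hg _ S1) (Sp_rpoly h Hh _ S1)).
  intros x _. simpl. unfold Ci, Cmult, Cplus, RtoC; simpl. f_equal; ring.
Qed.

Lemma Sp_smooth f : Sp f -> smooth f.
Proof.
  induction 1. apply eig_T. apply smooth_plus; now apply smooth_scal. now apply (smooth_ext f).
Qed.

(** * Distributions *)

Lemma distr_lin u a phi b psi : distr u -> smooth phi -> smooth psi ->
  u (fun x => a * phi x + b * psi x) = a * u phi + b * u psi.
Proof.
  intros (H1 & H2 & _) Hp Hq.
  rewrite (H1 (fun x => a * phi x) (fun x => b * psi x)), !H2; auto using smooth_scal.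
Qed.

Lemma Dw_ext w phi psi : eqS phi psi -> eqS (Dw w phi) (Dw w psi).
Proof.
  intros E x Hx. rewrite !Dw_comp. apply (f_equal2 pair); apply rD_ext; auto; intros y Hy; unfold re, im; now rewrite E.
Qed.

Lemma Dw_zero w : eqS (Dw w (fun _ => 0)) (fun _ => 0).
Proof.
  intros x Hx. rewrite Dw_comp.
  assert (K : forall w, eqS (rD w (fun _ => 0%R)) (fun _ => 0%R)).
  { clear. induction w as [|d w IH]; simpl. intros x _; auto.
    eapply eqS_trans. apply rl_ext, IH. intros x _. apply rl_const. }
  unfold re, im. simpl. now rewrite !K.
Qed.

(** The order of u is not known in advance, so the approximation of phi by zeros of u is required in
    every C^k norm; continuity of u then forces the value 0. *)
Lemma distr_small u phi : distr u -> smooth phi ->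
  (forall k e, (0 < e)%R -> exists psi, smooth psi /\ u psi = 0 /\ semibound k (fun x => phi x + (- (1)) * psi x) e) ->
  u phi = 0.
Proof.
  intros Hu Hp H. assert (Hu' := Hu). destruct Hu' as (H1 & H2 & K & k & H3).
  apply Cmod_eq_0. apply Rle_antisym. 2: apply Cmod_ge_0.
  apply Rnot_lt_le. intros Hpos.
  set (e := (Cmod (u phi) / (2 * (Rabs K + 1)))%R).
  assert (PK : (0 < Rabs K + 1)%R) by (generalize (Rabs_pos K); lra).
  assert (He : (0 < e)%R) by (apply Rdiv_lt_0_compat; lra).
  destruct (H k e He) as (psi & Sp & Ep & Bp).
  assert (Sd : smooth (fun x => phi x + (- (1)) * psi x)).
  { apply smooth_plus; auto. now apply smooth_scal. }
  assert (B := H3 _ e Sd Bp).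
  rewrite H1, H2, Ep in B; auto using smooth_scal.
  replace (u phi + - (1) * 0) with (u phi) in B by ring.
  assert (K * e <= (Rabs K + 1) * e)%R.
  { apply Rmult_le_compat_r. lra. generalize (Rle_abs K). lra. }
  assert ((Rabs K + 1) * e = Cmod (u phi) / 2)%R by (unfold e; field; lra). lra.
Qed.

(** Test functions are defined on all pairs of complex numbers, but the seminorms see only SU(2), so
    the difference vanishes in all of them. *)
Lemma distr_ext u phi psi : distr u -> smooth phi -> smooth psi -> eqS phi psi -> u phi = u psi.
Proof.
  intros Hu Hp Hq E.
  assert (Z : u (fun x => 1 * phi x + (- (1)) * psi x) = 0).
  { apply distr_small; auto. apply smooth_plus; now apply smooth_scal.
    intros k e He. exists (fun x => 0 * phi x). split. now apply smooth_scal. split.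
    - rewrite (proj1 (proj2 Hu)) by auto. ring.
    - intros w _ x Hx. rewrite (Dw_ext w _ (fun _ => 0)); auto.
      + rewrite Dw_zero by auto. rewrite Cmod_0. lra.
      + intros y Hy. rewrite E by auto. ring. }
  rewrite distr_lin in Z by auto.
  replace (u phi) with (1 * u phi + (- (1)) * u psi + u psi) by ring. rewrite Z. ring.
Qed.

Lemma distr_zero u phi : distr u -> smooth phi -> (forall x, inSU2 x -> phi x = 0) -> u phi = 0.
Proof.
  intros Hu Hp H. rewrite (distr_ext u phi (fun x => 0 * phi x)); auto using smooth_scal.
  rewrite (proj1 (proj2 Hu)) by auto. ring. intros x Hx. rewrite H by auto. ring.
Qed.

Lemma distr_trans (op : (pt -> C) -> pt -> C) u :
  (forall phi, smooth phi -> smooth (op phi)) ->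
  (forall phi psi, smooth phi -> smooth psi -> eqS (op (fun x => phi x + psi x)) (fun x => op phi x + op psi x)) ->
  (forall c phi, smooth phi -> eqS (op (fun x => c * phi x)) (fun x => c * op phi x)) ->
  (forall k, exists k' K, forall phi M, smooth phi -> semibound k' phi M -> semibound k (op phi) (K * M)) ->
  distr u -> distr (fun phi => u (op phi)).
Proof.
  intros Hs Hp Hc Hb Hu. destruct (Hu) as (H1 & H2 & K & k & H3). split; [|split].
  - intros phi psi Sp Sq. rewrite <- H1 by auto. apply distr_ext; auto using smooth_plus.
  - intros c phi Sp. rewrite <- H2 by auto. apply distr_ext; auto using smooth_scal.
  - destruct (Hb k) as (k' & K' & HK). exists (K * K')%R, k'. intros phi M Sp B.
    rewrite Rmult_assoc. apply H3; auto.
Qed.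

Lemma semibound_d0 k phi M : semibound (S k) phi M -> semibound k (d0 phi) M.
Proof.
  intros H w Hw x Hx. replace (Dw w (d0 phi)) with (Dw (w ++ [D0]) phi).
  - apply H; auto. rewrite length_app. simpl. lia.
  - clear. induction w; simpl; auto. now rewrite IHw.
Qed.

Lemma distr_comb a u b v : distr u -> distr v -> distr (fun phi => a * u phi + b * v phi).
Proof.
  intros (H1 & H2 & K & k & H3) (H1' & H2' & K' & k' & H3'). split; [|split].
  - intros phi psi Sp Sq. rewrite H1, H1' by auto. ring.
  - intros c phi Sp. rewrite H2, H2' by auto. ring.
  - exists (Cmod a * K + Cmod b * K')%R, (k + k')%nat. intros phi M Sp B.
    assert (B1 : semibound k phi M) by (intros w Hw; apply B; lia).
    assert (B2 : semibound k' phi M) by (intros w Hw; apply B; lia).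
    eapply Rle_trans. apply Cmod_triangle. rewrite !Cmod_mult, Rmult_plus_distr_r, !Rmult_assoc.
    apply Rplus_le_compat; (apply Rmult_le_compat_l; [apply Cmod_ge_0|auto]).
Qed.

Lemma distr_d0 u : distr u -> distr (d0_distr u).
Proof.
  intros Hu. assert (H : distr (fun phi => u (d0 phi))).
  { apply (distr_trans d0); auto using smooth_d0.
    - intros phi psi Sp Sq x Hx. now apply d0_plus.
    - intros c phi Sp x Hx. now apply d0_scal.
    - intros k. exists (S k), 1%R. intros phi M Sp B. rewrite Rmult_1_l. now apply semibound_d0. }
  assert (K := distr_comb (- (1)) _ 0 _ H H). unfold d0_distr.
  replace (fun phi => - u (d0 phi)) with (fun phi => - (1) * u (d0 phi) + 0 * u (d0 phi)); auto.
  apply functional_extensionality. intros; ring.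
Qed.

Lemma semibound_conj k phi M : semibound k phi M -> semibound k (fun x => Cconj (phi x)) M.
Proof.
  intros H w Hw x Hx. specialize (H w Hw x Hx). rewrite Dw_comp in *.
  replace (im (fun x => Cconj (phi x))) with (fun x => (-1) * im phi x)%R
    by (apply functional_extensionality; intros; unfold im; simpl; ring).
  rewrite rD_scal. change (re (fun x => Cconj (phi x))) with (re phi).
  replace (rD w (re phi) x, (-1 * rD w (im phi) x)%R) with (Cconj (rD w (re phi) x, rD w (im phi) x)).
  now rewrite Cmod_conj. unfold Cconj; simpl. f_equal; ring.
Qed.

Lemma conj_conj_fun phi : (fun x : pt => Cconj (Cconj (phi x))) = phi.
Proof. apply functional_extensionality. intros. apply Cconj_conj. Qed.

Lemma distr_conj u : distr u -> distr (conj_distr u).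
Proof.
  intros Hu. destruct (Hu) as (H1 & H2 & K & k & H3). unfold conj_distr. split; [|split].
  - intros phi psi Sp Sq. rewrite <- Cplus_conj. f_equal. rewrite <- H1 by now apply smooth_conj.
    f_equal. apply functional_extensionality. intros. apply Cplus_conj.
  - intros c phi Sp. transitivity (Cconj (Cconj c * u (fun x => Cconj (phi x)))).
    2: now rewrite Cmult_conj, Cconj_conj.
    f_equal. rewrite <- H2 by now apply smooth_conj.
    f_equal. apply functional_extensionality. intros. apply Cmult_conj.
  - exists K, k. intros phi M Sp B. rewrite Cmod_conj. apply H3. now apply smooth_conj. now apply semibound_conj.
Qed.

Lemma distr_cA om u : wcont om -> distr u -> distr (fun phi => u (cA om phi)).
Proof.
  intros W. apply (distr_trans (cA om)).
  - intros; now apply smooth_cA.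
  - intros phi psi Sp Sq x Hx. now apply cA_plus.
  - intros c phi Sp x Hx. now apply cA_scal.
  - intros k. destruct (cA_semibound om k W) as [K HK]. exists k, K. auto.
Qed.

(** On distributions d0 is minus its transpose; therefore the projection at l is the transpose of
    the one at -l, and the resolvent at l is minus the transpose of the one at -l. *)
Definition PiD (l : C) (u : (pt -> C) -> C) : (pt -> C) -> C := fun phi => u (Pop (- l) phi).
Definition BD (l : C) (u : (pt -> C) -> C) : (pt -> C) -> C := fun phi => - u (Bop (- l) phi).

Lemma distr_PiD l u : distr u -> distr (PiD l u).
Proof. apply distr_cA, wcont_omP. Qed.

Lemma distr_BD l u : distr u -> distr (BD l u).
Proof.
  intros Hu. assert (H := distr_cA _ u (wcont_omB (- l)) Hu).
  assert (K := distr_comb (- (1)) _ 0 _ H H). unfold BD, Bop.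
  replace (fun phi => - u (cA (omB (- l)) phi)) with (fun phi => - (1) * u (cA (omB (- l)) phi) + 0 * u (cA (omB (- l)) phi)); auto.
  apply functional_extensionality. intros; ring.
Qed.

(** * Completeness of the matrix coefficients *)

(** A smooth function is a limit of polynomials in every C^k norm, and these are spanned by matrix
    entries. The entries are conjugated because Fourier coefficients test against conjugates. *)
Lemma distr_complete u : distr u -> (forall j l n, u (fun x => Cconj (T j l n x)) = 0) ->
  forall phi, smooth phi -> u phi = 0.
Proof.
  intros Hu HT.
  assert (HS : forall f, Sp f -> u (fun x => Cconj (f x)) = 0).
  { induction 1 as [j l n|a f b g Hf IHf Hg IHg|f g Hf IHf E]; auto.
    - replace (fun x => Cconj (a * f x + b * g x)) with (fun x => Cconj a * Cconj (f x) + Cconj b * Cconj (g x)).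
      rewrite (distr_lin u (Cconj a) (fun x => Cconj (f x)) (Cconj b) (fun x => Cconj (g x))), IHf, IHg; auto using smooth_conj, Sp_smooth. ring.
      apply functional_extensionality. intros. now rewrite Cplus_conj, !Cmult_conj.
    - rewrite <- IHf. apply distr_ext; auto.
      apply smooth_conj, (smooth_ext f); auto using Sp_smooth. apply smooth_conj; auto using Sp_smooth.
      intros x Hx. now rewrite E. }
  intros phi Sp. apply distr_small; auto. intros k e He.
  apply smooth_comp in Sp. destruct Sp as [S1 S2].
  assert (He2 : (0 < e / 2)%R) by lra.
  destruct (density (re phi) k (e / 2) S1 He2) as (P & HP & AP).
  destruct (density (im phi) k (e / 2) S2 He2) as (Q & HQ & AQ).
  exists (fun x => (P x, Q x)).
  assert (RP := rsm_rpoly _ HP). assert (RQ := rsm_rpoly _ HQ).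
  split. now apply smooth_pair. split.
  (* [HS] speaks of conjugates of the span, so P + iQ is reached as the conjugate of P - iQ. *)
  - replace (fun x => (P x, Q x)) with (fun x => Cconj (P x, ((-1) * Q x)%R)).
    apply (HS (fun x => (P x, ((-1) * Q x)%R))). apply (Sp_poly P (fun x => ((-1) * Q x)%R)); auto. now apply rpoly_scal.
    apply functional_extensionality. intros x. unfold Cconj; simpl. f_equal; ring.
  - replace e with (e / 2 + e / 2)%R by field. apply comp_semibound; intros w Hw x Hx.
    + rewrite (rD_ext w _ (fun x => re phi x + (-1) * P x)%R); auto.
      2: intros y _; unfold re; simpl; ring.
      rewrite rD_plus, rD_scal; auto using rsm_scal.
      replace (rD w (re phi) x + -1 * rD w P x)%R with (rD w (re phi) x - rD w P x)%R by ring. now apply AP.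
    + rewrite (rD_ext w _ (fun x => im phi x + (-1) * Q x)%R); auto.
      2: intros y _; unfold im; simpl; ring.
      rewrite rD_plus, rD_scal; auto using rsm_scal.
      replace (rD w (im phi) x + -1 * rD w Q x)%R with (rD w (im phi) x - rD w Q x)%R by ring. now apply AQ.
Qed.

Lemma conj_wt j l n : Cconj (wt j l n) = - wt j l n.
Proof. unfold wt, Cconj, Copp; simpl. f_equal; ring. Qed.

(** Tested on a conjugated entry, which has weight - [wt j l' n], the projection at -l gives zero
    unless l is the weight of the entry. In that case the identity is the admissibility condition
    for the row weight l, up to the normalising root and the sign of [tmat_flip]. *)
Lemma compat_distr p q f : distr f -> inE p q f ->
  forall l, (l - q) * (l - Cconj q) = p * Cconj p -> forall phi, smooth phi ->
    (l - Cconj q) * PiD l f phi + p * PiD l (conj_distr f) phi = 0.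
Proof.
  intros Hf HE l Hl.
  assert (Hc := distr_conj f Hf).
  apply (distr_complete (fun phi => (l - Cconj q) * PiD l f phi + p * PiD l (conj_distr f) phi)).
  { apply distr_comb; now apply distr_PiD. }
  intros j l' n.
  destruct (eig_conj _ _ (eig_T j l' n)) as [Sc Ec]. rewrite conj_wt in Ec.
  assert (ST := proj1 (eig_T j l' n)).
  assert (SP := smooth_Pop (- l) _ Sc).
  unfold PiD.
  destruct (excluded_middle_informative (l = wt j l' n)) as [Eq|Neq].
  - assert (EP : eqS (Pop (- l) (fun x => Cconj (T j l' n x))) (fun x => Cconj (T j l' n x))).
    { intros x Hx. apply (eigen_Pop (- l) (- wt j l' n)); auto. now rewrite Eq. }
    rewrite (distr_ext f _ _ Hf SP Sc EP), (distr_ext _ _ _ Hc SP Sc EP).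
    destruct (le_lt_dec n (j + l')) as [Hn|Hn].
    (* Fourier coefficients transpose the indices: their row jj is the column of the matrix
       entry. *)
    + set (L := (j + l')%nat) in *. set (jj := (L - n)%nat).
      assert (Hj : (j <= L)%nat) by (unfold L; lia).
      assert (Hjj : (jj <= L)%nat) by (unfold jj; lia).
      assert (Em : l = (0, mval L jj)%R).
      { rewrite Eq. unfold wt, mval, jj. fold L. rewrite minus_INR by auto. f_equal; field. }
      (* [Delta] at weight m is (im - q)(im - conj q) - |p|^2, compared here by real and imaginary
         parts. *)
      assert (HD : Defs.Delta p q L jj = RtoC 0).
      { unfold Defs.Delta. rewrite !Cmod2. rewrite Em in Hl. destruct p as [p1 p2], q as [q1 q2].
        unfold Cmult, Cminus, Cplus, Copp, Cconj in Hl. simpl in Hl. injection Hl. intros H1 H2.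
        unfold RtoC, Re. simpl. apply (f_equal2 pair); lra. }
      assert (HH := HE L jj Hjj HD j Hj). unfold fhat in HH.
      set (s := sqrt (INR (fact j * fact (L - j) * fact jj * fact (L - jj)))).
      assert (ET : forall x, tmat L j jj x = RtoC s * T j l' n x).
      { intros x. rewrite tmat_T by auto. replace (L - j)%nat with l' by (unfold L; lia).
        replace (L - jj)%nat with n by (unfold jj; lia). unfold s.
        replace (L - j)%nat with l' by (unfold L; lia). replace (L - jj)%nat with n by (unfold jj; lia). reflexivity. }
      assert (Ps : RtoC s <> 0).
      { intros K. apply RtoC_inj in K. revert K. apply Rgt_not_eq, sqrt_lt_R0, lt_0_INR.
        repeat apply Nat.mul_pos_pos; apply lt_O_fact. }
      assert (Cs : Cconj (RtoC s) = RtoC s) by (unfold Cconj, RtoC; simpl; now rewrite Ropp_0).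
      assert (E1 : f (fun x => Cconj (tmat L j jj x)) = RtoC s * f (fun x => Cconj (T j l' n x))).
      { rewrite <- (proj1 (proj2 Hf)) by auto. f_equal. apply functional_extensionality. intros x.
        now rewrite ET, Cmult_conj, Cs. }
      set (g := sgnC (j + jj)).
      assert (Cg : Cconj g = g).
      { unfold g, sgnC. destruct (Nat.even (j + jj)); unfold Cconj, RtoC; simpl; now rewrite Ropp_0. }
      assert (gg : g * g = 1).
      { unfold g, sgnC. destruct (Nat.even (j + jj)); unfold Cmult, RtoC; simpl; f_equal; ring. }
      assert (E2 : f (fun x => Cconj (tmat L (L - j) (L - jj) x)) = g * RtoC s * f (T j l' n)).
      { rewrite <- (proj1 (proj2 Hf)) by auto. f_equal. apply functional_extensionality. intros x.
        rewrite tmat_flip by auto. fold g. rewrite Cmult_conj, Cconj_conj, Cg, ET. ring. }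
      rewrite E1, E2 in HH. rewrite !Cmult_conj, Cg, Cs in HH.
      replace (sgnC (jj + j)) with g in HH by (unfold g; f_equal; lia).
      rewrite <- Em in HH. unfold conj_distr. rewrite conj_conj_fun.
      replace ((l - Cconj q) * f (fun x => Cconj (T j l' n x)) + p * Cconj (f (T j l' n))) with
        (/ RtoC s * ((l - Cconj q) * (RtoC s * f (fun x => Cconj (T j l' n x))) + p * g * (g * RtoC s * Cconj (f (T j l' n))))).
      rewrite HH. ring.
      transitivity (/ RtoC s * ((l - Cconj q) * (RtoC s * f (fun x => Cconj (T j l' n x))) + p * (g * g) * (RtoC s * Cconj (f (T j l' n))))). ring.
      rewrite gg. field. auto.
    + assert (Z : forall x, T j l' n x = 0) by (intros; now apply tau_zero).
      rewrite !distr_zero; auto. ring.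
      intros x _. rewrite Z. unfold Cconj, RtoC; simpl; now rewrite Ropp_0.
      intros x _. rewrite Z. unfold Cconj, RtoC; simpl; now rewrite Ropp_0.
  - assert (EP : forall x, inSU2 x -> Pop (- l) (fun x => Cconj (T j l' n x)) x = 0).
    { intros x Hx. apply (eigen_Pop (- l) (- wt j l' n)); auto. intros K. apply Neq.
      replace l with (- - l) by ring. rewrite K. ring. }
    rewrite !distr_zero; auto. ring.
Qed.

(** * The complex Haar integral and smooth data *)

Lemma smooth_ccont phi : smooth phi -> ccont (re phi) /\ ccont (im phi).
Proof. rewrite smooth_comp. intros [A B]. split; now apply rsm_ccont. Qed.

Lemma haar_lin a F b G : smooth F -> smooth G ->
  haar (fun x => a * F x + b * G x) = a * haar F + b * haar G.
Proof.
  intros HF HG. apply smooth_ccont in HF. apply smooth_ccont in HG.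
  destruct HF as [F1 F2], HG as [G1 G2]. rewrite !haar_eq. fold (re F) (im F) (re G) (im G).
  destruct a as [a1 a2], b as [b1 b2].
  assert (K : forall a g, ccont g -> ccont (fun x => a * g x)%R) by (intros; apply ccont_mult; auto using ccont_const).
  assert (L : forall c1 c2 c3 c4, haarR (fun x => (c1 * re F x + c2 * im F x) + (c3 * re G x + c4 * im G x))%R =
     ((c1 * haarR (re F) + c2 * haarR (im F)) + (c3 * haarR (re G) + c4 * haarR (im G)))%R).
  { intros. rewrite haarR_plus, !haarR_plus, !haarR_scal; auto using ccont_plus. }
  unfold Cmult, Cplus; simpl. apply (f_equal2 pair).
  - rewrite (haarR_ext _ (fun x => (a1 * re F x + (- a2) * im F x) + (b1 * re G x + (- b2) * im G x))%R).
    rewrite L. ring. intros x _; unfold re, im; ring.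
  - rewrite (haarR_ext _ (fun x => (a2 * re F x + a1 * im F x) + (b2 * re G x + b1 * im G x))%R).
    rewrite L. ring. intros x _; unfold re, im; ring.
Qed.

Lemma haar_ext F G : eqS F G -> haar F = haar G.
Proof. intros E. rewrite !haar_eq. apply (f_equal2 pair); apply haarR_ext; intros x Hx; now rewrite E. Qed.

Lemma haar_d0 F : smooth F -> haar (d0 F) = 0.
Proof.
  rewrite smooth_comp. intros [A B]. rewrite haar_eq.
  change (haarR (rl D0 (re F)), haarR (rl D0 (im F))) with (haarR (rl D0 (re F)), haarR (rl D0 (im F))).
  unfold RtoC. apply (f_equal2 pair). apply (haarR_rl D0 (re F) A). apply (haarR_rl D0 (im F) B).
Qed.

Lemma haar_conj F : smooth F -> haar (fun x => Cconj (F x)) = Cconj (haar F).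
Proof.
  intros H. apply smooth_ccont in H. destruct H as [A B]. rewrite !haar_eq. unfold Cconj. simpl.
  apply (f_equal2 pair); auto. rewrite (haarR_ext _ (fun x => (-1) * im F x)%R).
  rewrite haarR_scal by auto. fold (im F). ring. intros x _. unfold im. ring.
Qed.

Lemma ccont_bounded h : ccont h -> exists B, forall x, inSU2 x -> (Rabs (h x) <= B)%R.
Proof.
  intros Hh. destruct (modulus h 1 Hh Rlt_0_1) as (C & PC & HC).
  exists (Rabs (h one) + 1 + C * 2)%R. intros x Hx.
  assert (H := HC one x inSU2_one Hx). assert (D := dot_bound one x inSU2_one Hx).
  replace (h x) with (h one + (h x - h one))%R by ring.
  eapply Rle_trans. apply Rabs_triang.
  assert (C * (1 - dot one x) <= C * 2)%R by (apply Rmult_le_compat_l; lra). lra.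
Qed.

Lemma distr_T_fun f : smooth f -> distr (T_fun f).
Proof.
  intros Hf. unfold T_fun. split; [|split].
  - intros phi psi Sp Sq.
    transitivity (1 * haar (fun x => f x * phi x) + 1 * haar (fun x => f x * psi x)). 2: ring.
    rewrite <- haar_lin by now apply smooth_mult. apply haar_ext. intros x _. ring.
  - intros c phi Sp.
    transitivity (c * haar (fun x => f x * phi x) + 0 * haar (fun x => f x * phi x)). 2: ring.
    rewrite <- haar_lin by now apply smooth_mult. apply haar_ext. intros x _. ring.
  - destruct (smooth_ccont _ Hf) as [C1 C2].
    destruct (ccont_bounded _ C1) as [B1 H1], (ccont_bounded _ C2) as [B2 H2].
    exists (2 * (B1 + B2))%R, 0%nat. intros phi M Sp Hb.
    destruct (smooth_ccont _ (smooth_mult _ _ Hf Sp)) as [D1 D2].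
    destruct (semibound_comp _ _ _ Hb) as [S1 S2].
    assert (A : forall u v u' v', (Rabs u <= B1 -> Rabs v <= B2 -> Rabs u' <= M -> Rabs v' <= M ->
       Rabs (u * u' + v * v') <= (B1 + B2) * M)%R).
    { intros u v u' v' Hu Hv Hu' Hv'. eapply Rle_trans. apply Rabs_triang. rewrite !Rabs_mult, Rmult_plus_distr_r.
      apply Rplus_le_compat; apply Rmult_le_compat; auto using Rabs_pos. }
    rewrite haar_eq. eapply Rle_trans. apply Cmod_le_sum. simpl fst. simpl snd.
    replace (2 * (B1 + B2) * M)%R with ((B1 + B2) * M + (B1 + B2) * M)%R by ring.
    apply Rplus_le_compat; apply haarR_abs; auto; intros x Hx;
    specialize (S1 nil (Nat.le_0_l 0) x Hx); specialize (S2 nil (Nat.le_0_l 0) x Hx);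
    specialize (H1 x Hx); specialize (H2 x Hx); unfold re, im in *; simpl in S1, S2; simpl.
    + replace (fst (f x) * fst (phi x) - snd (f x) * snd (phi x))%R with (fst (f x) * fst (phi x) + snd (f x) * (- snd (phi x)))%R by ring.
      apply A; auto. now rewrite Rabs_Ropp.
    + now apply A.
Qed.

(** As 0 <= w^n <= 1, the convolution of g with the kernel lies between 0 and the integral of g,
    hence vanishes for every n; but its normalized values at x approximate g(x). *)
Lemma haarR_definite g : rsm g -> (forall x, inSU2 x -> (0 <= g x)%R) -> haarR g = 0%R -> forall x, inSU2 x -> g x = 0%R.
Proof.
  intros Hg Hp H0 x Hx. assert (Cg := rsm_ccont _ Hg).
  apply Rle_antisym; auto. apply Rnot_lt_le. intros K.
  assert (K2 : (0 < g x / 2)%R) by lra.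
  destruct (psi_approx g (g x / 2) Cg K2) as [n Hn].
  specialize (Hn n (Nat.le_refl n) x Hx).
  assert (CW : ccont (fun y => (wk x y ^ n)%R)) by (apply rpoly_ccont, rpoly_pow, rpoly_wk).
  assert (W : forall y, inSU2 y -> (0 <= wk x y ^ n <= 1)%R).
  { intros y Hy. assert (D := dot_bound x y Hx Hy). split. apply pow_le; unfold wk; lra.
    rewrite <- (pow1 n). apply pow_incr. unfold wk; lra. }
  assert (Z : psi0 n g x = 0%R).
  { unfold psi0. apply Rle_antisym.
    - rewrite <- H0. apply haarR_le; auto using ccont_mult.
      intros y Hy. rewrite <- (Rmult_1_l (g y)) at 2. apply Rmult_le_compat_r; auto. now apply W.
    - replace 0%R with (haarR (fun y => 0 * g y)%R) by (rewrite haarR_scal by auto; ring).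
      apply haarR_le; auto using ccont_mult, ccont_const.
      intros y Hy. apply Rmult_le_compat_r; auto. now apply W. }
  unfold psi in Hn. rewrite Z, Rmult_0_r, Rminus_0_l, Rabs_Ropp, Rabs_pos_eq in Hn; auto. lra.
Qed.

Lemma haar_definite h : smooth h -> haar (fun x => h x * Cconj (h x)) = 0 -> forall x, inSU2 x -> h x = 0.
Proof.
  intros Hh H x Hx. assert (Hh' := Hh). apply smooth_comp in Hh'. destruct Hh' as [A B].
  assert (E : (re h x * re h x + im h x * im h x)%R = 0%R).
  { apply (haarR_definite (fun x => re h x * re h x + im h x * im h x)%R); auto.
    - apply rsm_plus; now apply rsm_mult.
    - intros y _. generalize (Rle_0_sqr (re h y)) (Rle_0_sqr (im h y)). unfold Rsqr. lra.
    - rewrite haar_eq in H. apply (f_equal fst) in H. simpl in H. rewrite <- H. apply haarR_ext.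
      intros y _. unfold re, im. ring. }
  assert (re h x = 0%R /\ im h x = 0%R) as [E1 E2] by (split; nra).
  unfold re, im in E1, E2. destruct (h x); simpl in *. subst. reflexivity.
Qed.

(** The identity is available only weakly, so its left side h = Pi_l H, with H = (l - conj q) f + p
    conj f, is shown to have zero L^2 norm. For l not imaginary this follows from d0 |h|^2 = (l +
    conj l) |h|^2; for l imaginary, from testing against conj h. *)
Lemma compat_smooth p q f : smooth f -> inE p q (T_fun f) ->
  forall l, (l - q) * (l - Cconj q) = p * Cconj p -> forall x, inSU2 x ->
    (l - Cconj q) * Pop l f x + p * Pop l (fun x => Cconj (f x)) x = 0.
Proof.
  intros Hf HE l Hl.
  pose (H := fun x => (l - Cconj q) * f x + p * Cconj (f x)).
  assert (SC := smooth_conj _ Hf).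
  assert (SH : smooth H) by (apply smooth_plus; now apply smooth_scal).
  pose (h := Pop l H). assert (Sh : smooth h) by now apply smooth_Pop.
  assert (Eh : eqS h (fun x => (l - Cconj q) * Pop l f x + p * Pop l (fun x => Cconj (f x)) x)).
  { intros x Hx. unfold h, H, Pop. rewrite (cA_plus _ (fun x => (l - Cconj q) * f x) (fun x => p * Cconj (f x))), !cA_scal; auto using wcont_omP, smooth_scal. }
  intros x Hx. rewrite <- Eh by auto. revert x Hx. apply haar_definite; auto.
  assert (Dh : forall x, inSU2 x -> d0 h x = l * h x) by (intros; now apply d0_Pop).
  assert (Sc := smooth_conj _ Sh).
  assert (Dc : forall x, inSU2 x -> d0 (fun x => Cconj (h x)) x = Cconj l * Cconj (h x)).
  { intros x Hx. rewrite d0_conj, Dh by auto. apply Cmult_conj. }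
  destruct (excluded_middle_informative (Cconj l = - l)) as [El|El].
  (* The function conj h has eigenvalue conj l = - l, so the projection at -l fixes it and the
     distributional identity becomes an integral identity for H. *)
  - assert (Key : haar (fun x => H x * Cconj (h x)) = 0).
    { assert (C := compat_distr p q (T_fun f) (distr_T_fun f Hf) HE l Hl _ Sc). unfold PiD in C.
      assert (EP : eqS (Pop (- l) (fun x => Cconj (h x))) (fun x => Cconj (h x))).
      { intros x Hx. apply (eigen_Pop (- l) (Cconj l)); auto. }
      assert (SP := smooth_Pop (- l) _ Sc).
      rewrite (distr_ext _ _ _ (distr_T_fun f Hf) SP Sc EP), (distr_ext _ _ _ (distr_conj _ (distr_T_fun f Hf)) SP Sc EP) in C.
      unfold conj_distr, T_fun in C.
      assert (M1 := smooth_mult _ _ Hf Sc). assert (M2 := smooth_mult _ _ Hf (smooth_conj _ Sc)).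
      rewrite <- (haar_conj _ M2), <- (haar_lin _ _ _ _ M1 (smooth_conj _ M2)) in C.
      rewrite <- C. apply haar_ext. intros x _. unfold H. rewrite Cmult_conj, Cconj_conj. ring. }
    (* Since H - h = (d0 - l) w, the product (H - h) conj h equals d0 (w conj h) and has integral
       zero, so H may be replaced by h. *)
    pose (w := Bop l H). assert (Sw : smooth w) by now apply smooth_Bop.
    assert (Dw : forall x, inSU2 x -> d0 w x = H x - h x + l * w x) by (intros; now apply d0_Bop).
    assert (SHh : smooth (fun x => H x * Cconj (h x))) by now apply smooth_mult.
    assert (Swh : smooth (fun x => w x * Cconj (h x))) by now apply smooth_mult.
    transitivity (1 * haar (fun x => H x * Cconj (h x)) + (- (1)) * haar (d0 (fun x => w x * Cconj (h x)))).
    + rewrite <- haar_lin by auto using smooth_d0. apply haar_ext. intros x Hx.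
      rewrite d0_mult, Dw, Dc, El by auto. ring.
    + rewrite Key, haar_d0 by auto. ring.
  - assert (Shh : smooth (fun x => h x * Cconj (h x))) by now apply smooth_mult.
    assert (Z : haar (d0 (fun x => h x * Cconj (h x))) = 0) by now apply haar_d0.
    rewrite (haar_ext _ (fun x => (l + Cconj l) * (h x * Cconj (h x)) + 0 * (h x * Cconj (h x)))) in Z.
    2: { intros x Hx. rewrite d0_mult, Dh, Dc by auto. ring. }
    rewrite haar_lin in Z by auto.
    assert (N : l + Cconj l <> 0).
    { intros K. apply El. replace (Cconj l) with (l + Cconj l - l) by ring. rewrite K. ring. }
    replace (haar (fun x => h x * Cconj (h x))) with (/ (l + Cconj l) * ((l + Cconj l) * haar (fun x => h x * Cconj (h x)) + 0 * haar (fun x => h x * Cconj (h x)))) by (field; auto).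
    rewrite Z. ring.
Qed.

Lemma distr_resolvent u l phi psi : distr u -> smooth phi -> smooth psi ->
  eqS psi (fun x => phi x - Pop l phi x + l * Bop l phi x) ->
  u psi = u phi - u (Pop l phi) + l * u (Bop l phi).
Proof.
  intros Hu Sp Sq E. assert (SP := smooth_Pop l _ Sp). assert (SB := smooth_Bop l _ Sp).
  assert (S1 : smooth (fun x => 1 * phi x + (- (1)) * Pop l phi x)).
  { apply smooth_plus; now apply smooth_scal. }
  rewrite (distr_ext u psi (fun x => 1 * (1 * phi x + (- (1)) * Pop l phi x) + l * Bop l phi x)); auto.
  - rewrite (distr_lin u 1 _ l _ Hu S1 SB), (distr_lin u 1 _ (- (1)) _ Hu Sp SP). ring.
  - apply smooth_plus; now apply smooth_scal.
  - intros x Hx. rewrite E by auto. ring.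
Qed.

Theorem theorem5p5 (p q : C) (hp : p <> RtoC 0) :
  (forall f : (pt -> C) -> C, distr f -> inE p q f ->
     exists u : (pt -> C) -> C, distr u /\ deq (P_distr p q u) f) /\
  (forall f : pt -> C, smooth f -> inE p q (T_fun f) ->
     exists u : pt -> C, smooth u /\
       forall x : pt, inSU2 x ->
         Cminus (Cminus (d0 u x) (Cmult q (u x))) (Cmult p (Cconj (u x))) = f x).
Proof.
  split.
  - intros f Hf HE.
    apply (abstract_solve (pt -> C) smooth distr d0_distr conj_distr BD PiD p q hp); auto.
    + intros a u b v Hu Hv. now apply distr_comb.
    + split; [|split].
      * exact distr_d0.
      * intros u v Hu Hv E phi Sp. unfold d0_distr. rewrite E; auto using smooth_d0.
      * intros a u b v Hu Hv phi Sp. unfold d0_distr. ring.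
    + split; [|split].
      * exact distr_conj.
      * intros u v Hu Hv E phi Sp. unfold conj_distr. rewrite E; auto using smooth_conj.
      * intros a u b v Hu Hv phi Sp. unfold conj_distr. now rewrite Cplus_conj, !Cmult_conj.
    + intros l. split; [|split].
      * exact (distr_BD l).
      * intros u v Hu Hv E phi Sp. unfold BD. rewrite E; auto using smooth_Bop.
      * intros a u b v Hu Hv phi Sp. unfold BD. ring.
    + intros l. split; [|split].
      * exact (distr_PiD l).
      * intros u v Hu Hv E phi Sp. unfold PiD. rewrite E; auto using smooth_Pop.
      * intros a u b v Hu Hv phi Sp. unfold PiD. ring.
    + intros u Hu phi Sp. unfold conj_distr. now rewrite conj_conj_fun, Cconj_conj.
    + intros u Hu phi Sp. unfold conj_distr, d0_distr. rewrite Copp_conj. do 3 f_equal.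
      apply functional_extensionality. intros x. apply d0_conj.
    + intros l u Hu phi Sp. unfold conj_distr, PiD. f_equal.
      apply distr_ext; auto using smooth_Pop, smooth_conj.
      intros x Hx. rewrite <- Pop_conj by auto. now rewrite Copp_conj, Cconj_conj.
    (* Transposition reverses composition: the rule for d B comes from [Bop_d0], and the rule for B
       d from [d0_Bop]. *)
    + intros l u Hu phi Sp. unfold d0_distr, BD, PiD.
      rewrite (distr_resolvent u (- l) phi (Bop (- l) (d0 phi))); auto using smooth_Bop, smooth_d0. ring.
      intros x Hx. now apply Bop_d0.
    + intros l u Hu phi Sp. unfold d0_distr, BD, PiD.
      rewrite (distr_resolvent u (- l) phi (d0 (Bop (- l) phi))); auto using smooth_Bop, smooth_d0. ring.
      intros x Hx. now apply d0_Bop.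
    + intros l u Hu phi Sp. unfold d0_distr, PiD.
      rewrite (distr_ext u (Pop (- l) (d0 phi)) (fun x => (- l) * Pop (- l) phi x)); auto using smooth_d0, smooth_scal, smooth_Pop.
      2: { intros x Hx. now rewrite Pop_d0 by auto. }
      rewrite (proj1 (proj2 Hu)) by now apply smooth_Pop. ring.
    + intros l u Hu phi Sp. unfold d0_distr, PiD.
      rewrite (distr_ext u (d0 (Pop (- l) phi)) (fun x => (- l) * Pop (- l) phi x)); auto using smooth_d0, smooth_scal, smooth_Pop.
      2: { intros x Hx. now rewrite d0_Pop by auto. }
      rewrite (proj1 (proj2 Hu)) by now apply smooth_Pop. ring.
    + now apply compat_distr.
  - intros f Hf HE.
    apply (abstract_solve pt inSU2 smooth d0 (fun g x => Cconj (g x)) Bop Pop p q hp); auto.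
    + intros a u b v Hu Hv. apply smooth_plus; now apply smooth_scal.
    + split; [|split].
      * exact smooth_d0.
      * intros u v Hu Hv E. now apply d0_ext.
      * intros a u b v Hu Hv x Hx. rewrite (d0_plus (fun x => a * u x) (fun x => b * v x)), !d0_scal; auto using smooth_scal.
    + split; [|split].
      * exact smooth_conj.
      * intros u v Hu Hv E x Hx. now rewrite E.
      * intros a u b v Hu Hv x Hx. now rewrite Cplus_conj, !Cmult_conj.
    + intros l. split; [|split].
      * exact (smooth_Bop l).
      * intros u v Hu Hv E. now apply cA_ext.
      * intros a u b v Hu Hv x Hx. unfold Bop. rewrite (cA_plus _ (fun x => a * u x) (fun x => b * v x)), !cA_scal; auto using smooth_scal, wcont_omB.
    + intros l. split; [|split].
      * exact (smooth_Pop l).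
      * intros u v Hu Hv E. now apply cA_ext.
      * intros a u b v Hu Hv x Hx. unfold Pop. rewrite (cA_plus _ (fun x => a * u x) (fun x => b * v x)), !cA_scal; auto using smooth_scal, wcont_omP.
    + intros u Hu x Hx. apply Cconj_conj.
    + intros u Hu x Hx. symmetry. apply d0_conj.
    + intros l u Hu x Hx. symmetry. now apply Pop_conj.
    + intros l u Hu x Hx. now apply d0_Bop.
    + intros l u Hu x Hx. now apply Bop_d0.
    + intros l u Hu x Hx. now apply d0_Pop.
    + intros l u Hu x Hx. now apply Pop_d0.
    + now apply compat_smooth.
Qed.
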